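(* Let $\mathfrak g$ be a non-simply laced (compact) simple Lie algebra of rank $r$, let $n_{\mathfrak g}\in\{2,3\}$ be the ratio of the square lengths of its long and short roots, let $G$ be a compact connected Lie group with Lie algebra $\mathfrak g$, universal covering group $\tilde G$ and Langlands dual ${}^LG$. Let $\Gamma^*(n_{\mathfrak g})\subset SL(2,\mathbb R)$ be the group generated by $$\tilde S=\begin{pmatrix}0&-1/\sqrt{n_{\mathfrak g}}\\ \sqrt{n_{\mathfrak g}}&0\end{pmatrix},\qquad T=\begin{pmatrix}1&1\\0&1\end{pmatrix},$$ which is isomorphic to the Hecke group $G(\sqrt{n_{\mathfrak g}})$. Then the formulas $$T|u\rangle=e^{-\frac{\pi\sqrt{-1}}{12}n_{\mathfrak g}\frac{{}^L\check h}{h}r+\pi\sqrt{-1}(u|u)}|u\rangle,\qquad T|\mu\rangle=e^{-\frac{\pi\sqrt{-1}}{12}n_{\mathfrak g}\frac{\check h}{h}r+\pi\sqrt{-1}(\mu|\mu)}|\mu\rangle,$$ $$\tilde S|u\rangle=\frac{1}{\sqrt{|Z(\tilde G)|}}\sum_{\mu\in({}^L\Lambda)^*/({}^L\Lambda)^{\vee}}e^{-2\pi\sqrt{-1}\frac{\langle\mu,u\rangle}{\sqrt{n_{\mathfrak g}}}}|\mu\rangle,\qquad \tilde S|\mu\rangle=\frac{1}{\sqrt{|Z(\tilde G)|}}\sum_{u\in\Lambda^*/\check\Lambda}e^{-2\pi\sqrt{-1}\frac{\langle\mu,u\rangle}{\sqrt{n_{\mathfrak g}}}}|u\rangle,$$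 for $u\in\Lambda^*/\check\Lambda$ and $\mu\in({}^L\Lambda)^*/({}^L\Lambda)^{\vee}$, define a unitary representation of $\Gamma^*(n_{\mathfrak g})\cong G(\sqrt{n_{\mathfrak g}})$ on $$\mathbb C[\Lambda^*/\check\Lambda]\oplus\mathbb C[({}^L\Lambda)^*/({}^L\Lambda)^{\vee}].$$ Moreover, $\tilde S$ interchanges the vectors $$|G\rangle=\frac{1}{\sqrt{|\pi_1(G)|}}\sum_{u\in\pi_1(G)}|u\rangle\in\mathbb C[\Lambda^*/\check\Lambda],\qquad |{}^LG\rangle=\frac{1}{\sqrt{|\pi_1({}^LG)|}}\sum_{\mu\in\pi_1({}^LG)}|\mu\rangle\in\mathbb C[({}^L\Lambda)^*/({}^L\Lambda)^{\vee}],$$ that is, $\tilde S|G\rangle=|{}^LG\rangle$ and $\tilde S|{}^LG\rangle=|G\rangle$.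
   Context: Non-simply laced: not all roots have the same length, i.e. $\mathfrak g$ is of type $B_r$, $C_r$ ($r\ge2$), $F_4$ (with $n_{\mathfrak g}=2$) or $G_2$ (with $n_{\mathfrak g}=3$). Lattices. Let $T_G$ be a maximal torus of $G$ with Lie algebra $\mathfrak t$, $\Delta\subset\sqrt{-1}\,\mathfrak t^*$ the root system, and $(\cdot|\cdot)$ the Weyl group invariant inner product on $\sqrt{-1}\,\mathfrak t^*$ for which the long roots have square length $2$. It is used to identify $\sqrt{-1}\,\mathfrak t$ with $\sqrt{-1}\,\mathfrak t^*$, so $(\cdot|\cdot)$ also denotes the induced inner product on $\sqrt{-1}\,\mathfrak t$; $\langle\cdot,\cdot\rangle$ is the pairing between $\sqrt{-1}\,\mathfrak t^*$ and $\sqrt{-1}\,\mathfrak t$. For $\alpha\in\Delta$ the coroot $\check\alpha\in\sqrt{-1}\,\mathfrak t$ is given by $\langle\beta,\check\alpha\rangle=2(\beta|\alpha)/(\alpha|\alpha)$ for all $\beta\in\Delta$; $\check\Delta=\{\check\alpha\mid\alpha\in\Delta\}$. Put $\Lambda=\mathrm{span}_{\mathbb Z}\Delta$ and $\check\Lambda=\mathrm{span}_{\mathbb Z}\check\Delta$, with dual lattices $\Lambda^*\subset\sqrt{-1}\,\mathfrak t$ and $\check\Lambda^*\subset\sqrt{-1}\,\mathfrak t^*$. Let $\ell\subset\sqrt{-1}\,\mathfrak t$ be the lattice with $T_G=\mathfrak t/2\pi\sqrt{-1}\,\ell$, so that $\check\Lambda\subset\ell\subset\Lambda^*$; $\ell^*$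 is its dual lattice. Then $\pi_1(G)=\ell/\check\Lambda\subset\Lambda^*/\check\Lambda$ and $Z(\tilde G)\cong\Lambda^*/\check\Lambda$. Langlands dual. The root system of the dual Lie algebra ${}^L\mathfrak g$ is normalised as ${}^L\Delta=\frac{1}{\sqrt{n_{\mathfrak g}}}\check\Delta\subset\sqrt{-1}\,\mathfrak t$ (so its long roots also have square length $2$). Its root lattice is ${}^L\Lambda=\frac{1}{\sqrt{n_{\mathfrak g}}}\check\Lambda$, its coroot lattice is $({}^L\Lambda)^{\vee}=\sqrt{n_{\mathfrak g}}\,\Lambda\subset\sqrt{-1}\,\mathfrak t^*$, and its coweight lattice is $({}^L\Lambda)^*=\sqrt{n_{\mathfrak g}}\,\check\Lambda^*\subset\sqrt{-1}\,\mathfrak t^*$. The Langlands dual group ${}^LG$ is the compact connected Lie group with Lie algebra ${}^L\mathfrak g$ and maximal torus $\mathfrak t^*/2\pi\sqrt{-1}\,{}^L\ell$, where ${}^L\ell=\sqrt{n_{\mathfrak g}}\,\ell^*$; thus $\pi_1({}^LG)={}^L\ell/({}^L\Lambda)^{\vee}\subset({}^L\Lambda)^*/({}^L\Lambda)^{\vee}$. Coxeter numbers. $h$ is the Coxeter number of $\mathfrak g$ (so $|\Delta|=rh$); $\check h=1+\langle\rho,\check\theta\rangle$ is the dual Coxeter number of $\mathfrak g$, where $\rho$ is half the sum of the positive roots and $\theta$ is the highest root; ${}^L\check h$ is the dual Coxeter number of ${}^L\mathfrak g$. Representation space. $\mathbb C[\Lambda^*/\check\Lambda]\oplus\mathbb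 C[({}^L\Lambda)^*/({}^L\Lambda)^{\vee}]=\mathrm{span}_{\mathbb C}\{|u\rangle,|\mu\rangle\mid u\in\Lambda^*/\check\Lambda,\ \mu\in({}^L\Lambda)^*/({}^L\Lambda)^{\vee}\}$, and unitarity is with respect to the Hermitian inner product for which the vectors $|u\rangle,|\mu\rangle$ form an orthonormal basis. The phase factors in the formulas depend only on the classes of $u$ and $\mu$. The symbols $\tilde S,T$ denote both the generators of $\Gamma^*(n_{\mathfrak g})$ and the operators representing them. Hecke group. For $\lambda>0$, $G(\lambda)$ denotes the subgroup of $SL(2,\mathbb R)$ generated by $\begin{pmatrix}0&-1\\1&0\end{pmatrix}$ and $\begin{pmatrix}1&\lambda\\0&1\end{pmatrix}$; the values used here are $\lambda=\sqrt2,\sqrt3$. The isomorphism $G(\sqrt{n_{\mathfrak g}})\cong\Gamma^*(n_{\mathfrak g})$ is conjugation by $\begin{pmatrix}1&0\\0&\sqrt{n_{\mathfrak g}}\end{pmatrix}$, sending these two generators to $\tilde S$ and $T$ respectively. *)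

(* Defs.v *)
From HB Require Import structures.
From mathcomp Require Import all_boot all_order all_algebra finmap.
From mathcomp Require Import complex.
From mathcomp Require Import all_classical all_reals.
From mathcomp Require Import trigo.

Set Implicit Arguments.
Unset Strict Implicit.
Unset Printing Implicit Defensive.

Import Order.TTheory GRing.Theory Num.Theory.
Local Open Scope classical_set_scope.
Local Open Scope fset_scope.
Local Open Scope ring_scope.

(* Setting: V stands for the real vector space i t^*, B for the Weyl invariant
   inner product, r = \dim V for the rank.  The dual space i t is identified
   with V through B, so that the pairing < , > between them is B itself and
   coroots, coweights and cocharacters are elements of V as well.  A compact
   simple Lie algebra is given by its root system D, and a compact connected
   Lie group with that Lie algebra by the lattice ell in i t such that its
   maximal torus is t / 2 pi i ell. *)

Definition rank {R : realType} (V : vectType R) : nat := \dim {:V}.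

Section RootSystem.
Context {R : realType} {V : vectType R}.
Implicit Types (B : {dot V for @idfun R}) (D P : {fset V}) (L M : set V).

Definition coroot B (a : V) : V := (2 / B a a) *: a.

Definition reflection B (a b : V) : V := b - B b (coroot B a) *: a.

Definition root_system B D : Prop :=
  [/\ 0 \notin D,
      span (enum_fset D) = fullv,
      forall a b, a \in D -> b \in D -> reflection B a b \in D,
      forall a b, a \in D -> b \in D -> B b (coroot B a) \is a Num.int
    & forall a (c : R), a \in D -> c *: a \in D -> c = 1 \/ c = - 1].

Definition irreducible B D : Prop :=
  D != fset0 /\
  forall A : {fset V}, A `<=` D -> A != fset0 ->
    (forall a b, a \in A -> b \in D `\` A -> B a b = 0) -> A = D.

Definition long_root B D (a : V) : Prop :=
  a \in D /\ forall b, b \in D -> B b b <= B a a.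

Definition short_root B D (a : V) : Prop :=
  a \in D /\ forall b, b \in D -> B a a <= B b b.

Definition non_simply_laced B D : Prop :=
  exists a b, [/\ a \in D, b \in D & B a a != B b b].

Definition normalized B D : Prop := forall a, long_root B D a -> B a a = 2.

Definition length_ratio B D (n : nat) : Prop :=
  forall a b, long_root B D a -> short_root B D b -> B a a = n%:R * B b b.

Definition zspan D : set V :=
  [set v | exists c : V -> int, v = \sum_(a <- D) a *~ c a].

Definition dual_lattice B L : set V :=
  [set v | forall w, L w -> B v w \is a Num.int].

Definition root_lattice D : set V := zspan D.
Definition coroot_lattice B D : set V := zspan [fset coroot B a | a in D].
Definition coweight_lattice B D : set V := dual_lattice B (root_lattice D).

Definition subgroup L : Prop :=
  L 0 /\ forall v w, L v -> L w -> L (v - w).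

(* The lattices ell of the compact connected Lie groups with root system D. *)
Definition cocharacter_lattice B D L : Prop :=
  [/\ subgroup L, coroot_lattice B D `<=` L & L `<=` coweight_lattice B D]%classic.

Definition positive_system B D P : Prop :=
  exists t : V, (forall a, a \in D -> B t a != 0) /\
    P = [fset a in D | 0 < B t a].

Definition highest_root D P (theta : V) : Prop :=
  theta \in D /\ forall b, b \in D ->
    exists c : V -> nat, theta - b = \sum_(a <- P) a *+ c a.

Definition half_sum P : V := 2^-1 *: \sum_(a <- P) a.

(* The Coxeter number h is determined by |Delta| = r h. *)
Definition coxeter_number D : R := #|` D|%:R / (rank V)%:R.

Definition dual_coxeter_number B D (hv : R) : Prop :=
  exists P theta, [/\ positive_system B D P, highest_root D P theta
    & hv = 1 + B (half_sum P) (coroot B theta)].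

(* Langlands duality: the dual root system, again with long roots of square
   length 2, and the dual cocharacter lattice sqrt n ell^*.  All the lattices of
   the dual group are obtained by applying the definitions of this section to
   [langlands_roots B n D]; for instance its coroot lattice is
   sqrt n Lambda, since the coroot of (coroot a) / sqrt n is sqrt n a. *)
Definition langlands_roots B (n : nat) D : {fset V} :=
  [fset (Num.sqrt n%:R)^-1 *: coroot B a | a in D].

Definition langlands_lattice B (n : nat) L : set V :=
  [set Num.sqrt n%:R *: v | v in dual_lattice B L]%classic.

Definition coset M (v : V) : set V := [set w | M (w - v)]%classic.

(* The finite set of cosets Lambda^* / Lambda^vee, i.e. the center of the
   simply connected group.  [fset_set] returns the given classical set when that
   set is finite, which is the case here as D spans V. *)
Definition center B D : {fset (set V)} :=
  fset_set (coset (coroot_lattice B D) @` coweight_lattice B D)%classic.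

Definition represents B D (x : center B D) (v : V) : Prop := fsval x v.

(* The image ell / Lambda^vee of ell in the center. *)
Definition pi1 B D L : {set center B D} :=
  [set x : center B D |
    `[< exists2 u, L u & fsval x = coset (coroot_lattice B D) u >]]%SET.

End RootSystem.

Section Modular.
Context {R : realType}.
Implicit Types (lambda : R) (n : nat).

Definition mat2 (a b c d : R) : 'M[R]_2 :=
  \matrix_(i < 2, j < 2)
    if i == 0 then (if j == 0 then a else b) else (if j == 0 then c else d).

(* The subgroup generated by X, for X made of invertible matrices. *)
Inductive generated (X : set 'M[R]_2) : set 'M[R]_2 :=
| gen_base g : X g -> generated X g
| gen_one : generated X 1%:M
| gen_mul g h : generated X g -> generated X h -> generated X (g *m h)
| gen_inv g : generated X g -> generated X (invmx g).

(* All of these have determinant 1, hence generate subgroups of SL(2, R). *)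
Definition Tmx : 'M[R]_2 := mat2 1 1 0 1.

Definition Smx n : 'M[R]_2 :=
  mat2 0 (- (Num.sqrt n%:R)^-1) (Num.sqrt n%:R) 0.

Definition Gamma_star n : set 'M[R]_2 := generated [set Smx n; Tmx]%classic.

Definition Hecke lambda : set 'M[R]_2 :=
  generated [set mat2 0 (- 1) 1 0; mat2 1 lambda 0 1]%classic.

(* Conjugation by diag(1, sqrt n). *)
Definition hecke_conj n (g : 'M[R]_2) : 'M[R]_2 :=
  let d := mat2 1 0 0 (Num.sqrt n%:R) in d *m g *m invmx d.

Definition group_isomorphism (G H : set 'M[R]_2) (f : 'M[R]_2 -> 'M[R]_2) :=
  [/\ forall g g', G g -> G g' -> f (g *m g') = f g *m f g',
      forall g g', G g -> G g' -> f g = f g' -> g = g'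
    & [set f g | g in G]%classic = H].

Definition expi (x : R) : R[i] := (cos x +i* sin x)%C.

Definition phase_T {V : vectType R} (B : {dot V for @idfun R}) n
    (h hv : R) (v : V) : R[i] :=
  expi (- (pi / 12) * (n%:R * (hv / h) * (rank V)%:R) + pi * B v v).

Definition phase_S {V : vectType R} (B : {dot V for @idfun R}) n
    (mu u : V) : R[i] :=
  expi (- (2 * pi) * (B mu u / Num.sqrt n%:R)).

(* (|X|)^(-1/2) *)
Definition inv_sqrt (k : nat) : R[i] := ((Num.sqrt k%:R)^-1)%:C%C.

End Modular.

Arguments Tmx R : clear implicits.
Arguments Smx R n : clear implicits.
Arguments Gamma_star R n : clear implicits.

Section RepresentationSpace.
Context {R : realType}.
Implicit Types (X Y : finType).

Definition rep_space X Y : vectType R[i] :=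
  ({ffun X -> R[i]^o} * {ffun Y -> R[i]^o})%type.

Definition ketl {X Y} (x : X) : rep_space X Y := ([ffun x' => (x' == x)%:R], 0).
Definition ketr {X Y} (y : Y) : rep_space X Y := (0, [ffun y' => (y' == y)%:R]).

Definition hdot {X Y} (v w : rep_space X Y) : R[i] :=
  \sum_x (v.1 x)^* * w.1 x + \sum_y (v.2 y)^* * w.2 y.

Definition unitary_representation {X Y} (G : set 'M[R]_2)
    (rho : 'M[R]_2 -> 'End(rep_space X Y)) : Prop :=
  [/\ rho 1%:M = \1%VF,
      forall g h, G g -> G h -> rho (g *m h) = (rho g \o rho h)%VF
    & forall g v w, G g -> hdot (rho g v) (rho g w) = hdot v w].

(* (|G|)^(-1/2) times the sum over a subset of the basis, as in |G> *)
Definition normalized_suml {X Y} (A : {set X}) : rep_space X Y :=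
  inv_sqrt #|A| *: \sum_(x in A) ketl x.
Definition normalized_sumr {X Y} (A : {set Y}) : rep_space X Y :=
  inv_sqrt #|A| *: \sum_(y in A) ketr y.

End RepresentationSpace.

(* Main.v *)
Require Import Defs.
From HB Require Import structures.
From mathcomp Require Import all_boot all_order all_algebra finmap.
From mathcomp Require Import complex.
From mathcomp Require Import all_classical all_reals.
From mathcomp Require Import trigo.
From mathcomp Require Import ring lra zify.

Set Implicit Arguments.
Unset Strict Implicit.
Unset Printing Implicit Defensive.

Import Order.TTheory GRing.Theory Num.Theory.
Local Open Scope ring_scope.

(** Why the theorem holds. The group [Gamma*(n)] has few relations, and the center of
    a non-simply laced simply connected group is so small that these relations can
    be checked by hand.

    The group. Put [m = 4] for [n = 2] and [m = 6] for [n = 3], so that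
    [S^2 = (S T)^m = -1]. The matrices [S^-1 (S T)^a] with [0 < a < m] have
    nonnegative entries, diagonal entries at least [1], and are not diagonal. These
    properties persist in products, and hence a product of such matrices, bordered by
    powers of [S], is never [1] or [-1] unless it is empty ([normal_form_one]). As
    every word in [S] and [T] has such a normal form, operators [sigma] and [tau]
    define a representation as soon as [sigma^2 = (sigma tau)^m = 1]
    ([lifting_exists]). The isomorphism with the Hecke group is conjugation by a
    fixed matrix.

    The phases. The scalars [a] and [b] by which [T] acts on the classes of zero in
    the two summands enter the relations through [a b] only, hence only the sum of
    the dual Coxeter numbers matters. In an irreducible root system whose long roots
    have square length [2], the operator [x |-> sum (alpha | x) alpha] is a scalar by
    Schur's lemma ([casimir_scalar]). Evaluation at the highest root shows that the
    scalar is twice the dual Coxeter number, and its trace is the sum of all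
    [(alpha | alpha)] ([sum_root_norms]). Adding the results for the root system and
    for its dual gives [(hv + Lhv) r = (1 + 1 / n) |Delta|], thus
    [hv + Lhv = (1 + 1 / n) h] ([dual_coxeter_numbers_sum]), and
    [a b = exp (- pi i (n + 1) r / 12)].

    The center. For [n = 3] the root system is a hexagram in the plane, and the
    coweight lattice equals the coroot lattice ([center_data_G]). For [n = 2] let [E]
    be a maximal set of orthonormal short roots such that [e + f] and [e - f] are
    roots for all distinct [e] and [f] in [E]. After passing to the dual root system
    if necessary, [E] is a basis; the long roots are [± e ± f], and the short roots are
    either only the [± e] (type B), or there are further short roots with four
    coordinates [± 1/2] (type F4) ([coordinates_or_dual]). In type F4 the center is
    trivial and [r = 4]; in type B the center has order two, and the nontrivial
    classes of the two dual centers have square lengths [1] and [r / 2] modulo [2]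
    ([center_data_coordinates]).

    The relations. If the center is trivial, [(S T)^2] is the scalar [a b], which is
    [-1] for F4 and a primitive third root of unity for G2. If it has order two, then
    [S] is a real symmetric involution, and [(S T)^4] is the scalar [(a b)^2 q], where
    [q = exp (pi i r / 2)] is the phase of the class of square length [r / 2]; this
    product is [1] ([opST_pow4]). Finally [pi_1(G)] and [pi_1(^L G)] annihilate each
    other, so that one of them is trivial while the other is the whole center, and [S]
    exchanges the corresponding vectors by its definition and [S^2 = 1]
    ([pi1_dual]). *)

(** * Inner products and integers *)

Section InnerProduct.
Context {R : realType} {V : vectType R}.
Implicit Types (B : {dot V for @idfun R}) (u v w : V).

Lemma dotC B u v : B u v = B v u.
Proof. by have := hermC B u v; rewrite /= expr0 mul1r. Qed.

Lemma dotDl B u v w : B (u + v) w = B u w + B v w. Proof. exact: linearDl. Qed.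
Lemma dotDr B u v w : B w (u + v) = B w u + B w v. Proof. exact: linearDr. Qed.
Lemma dotZl B k u v : B (k *: u) v = k * B u v. Proof. exact: linearZl_LR. Qed.
Lemma dotZr B k u v : B v (k *: u) = k * B v u. Proof. exact: linearZr_LR. Qed.
Lemma dotNl B u v : B (- u) v = - B u v.
Proof. by rewrite -scaleN1r dotZl mulN1r. Qed.
Lemma dotNr B u v : B v (- u) = - B v u.
Proof. by rewrite -scaleN1r dotZr mulN1r. Qed.
Lemma dot0l B u : B 0 u = 0. Proof. exact: linear0l. Qed.
Lemma dot0r B u : B u 0 = 0. Proof. exact: linear0r. Qed.

Definition dotE := (dotDl, dotDr, dotNl, dotNr, dotZl, dotZr, dot0l, dot0r).

Lemma dot_suml B I (r : seq I) (P : pred I) (F : I -> V) v :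
  B (\sum_(i <- r | P i) F i) v = \sum_(i <- r | P i) B (F i) v.
Proof.
elim/big_rec2: _ => [|i x y _ <-]; first by rewrite dot0l.
by rewrite dotDl.
Qed.

Lemma dot_sumr B I (r : seq I) (P : pred I) (F : I -> V) v :
  B v (\sum_(i <- r | P i) F i) = \sum_(i <- r | P i) B v (F i).
Proof. by rewrite dotC dot_suml; apply: eq_bigr => i _; rewrite dotC. Qed.

Lemma dot_gt0 B u : u != 0 -> 0 < B u u. Proof. exact: neq0_dnorm_gt0. Qed.

Lemma dot_ge0 B u : 0 <= B u u.
Proof.
by have [->|/(dot_gt0 B)/ltW//] := eqVneq u 0; rewrite dot0l.
Qed.

Lemma dot_eq0 B u : (B u u == 0) = (u == 0).
Proof.
have [->|/(dot_gt0 B)/lt0r_neq0/negPf//] := eqVneq u 0.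
by rewrite dot0l eqxx.
Qed.

(** Turns identities between linear combinations of vectors into identities
    between numbers. *)
Lemma dot_ext B u v : (forall w, B u w = B v w) -> u = v.
Proof.
move=> E; apply/eqP; rewrite -subr_eq0 -(dot_eq0 B) dotDl dotNl E.
by rewrite subrr.
Qed.

Lemma cauchy_schwarz B u v : (B u v) ^+ 2 <= B u u * B v v.
Proof.
have [->|u0] := eqVneq u 0; first by rewrite !dot0l mul0r expr0n.
have p := dot_gt0 B u0.
have := dot_ge0 B (B u u *: v - B u v *: u).
rewrite !dotE (dotC B v u) => H.
have {}H : 0 <= B u u * (B u u * B v v - B u v ^+ 2) by lra.
by rewrite pmulr_rge0 // subr_ge0 in H.
Qed.

Lemma cauchy_schwarz_eq B u v : u != 0 ->
  (B u v) ^+ 2 = B u u * B v v -> v = (B u v / B u u) *: u.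
Proof.
move=> u0 E; have p := dot_gt0 B u0.
apply/eqP; rewrite -subr_eq0 -(dot_eq0 B) !dotE (dotC B v u).
have -> : B v v = B u v ^+ 2 / B u u by rewrite E; field; rewrite lt0r_neq0.
by apply/eqP; field; rewrite lt0r_neq0.
Qed.

End InnerProduct.

Section Integers.
Context {R : realType}.
Implicit Types x y : R.

Lemma int_sqr_lt1 x : x \is a Num.int -> x ^+ 2 < 1 -> x = 0.
Proof.
move=> xi; have [//|x0] := eqVneq x 0.
by have := sqr_intr_ge1 xi x0 => h1 h2; move: (le_lt_trans h1 h2); rewrite ltxx.
Qed.

Lemma abs_lt2 (i : int) : i ^+ 2 < 4 -> -1 <= i /\ i <= 1.
Proof. by move=> h; split; nia. Qed.

Lemma int_sqr_lt4 x : x \is a Num.int -> x ^+ 2 < 4 -> [\/ x = 0, x = 1 | x = -1].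
Proof.
move=> /intrP[m ->]; rewrite -rmorphXn/= => lt4.
have {}lt4 : m ^+ 2 < 4 :> int by rewrite -(ltr_int R).
have : m = 0 \/ m = 1 \/ m = -1 by have := abs_lt2 lt4; lia.
by case=> [->|[->|->]]; [constructor 1|constructor 2|constructor 3].
Qed.

Lemma maximum_seq (T : eqType) (s : seq T) (f : T -> R) :
  s != [::] -> exists2 a, a \in s & forall b, b \in s -> f b <= f a.
Proof.
elim: s => // a [|b s] IH _.
  by exists a; rewrite ?mem_seq1 // => c; rewrite mem_seq1 => /eqP->.
have [//|c cs cmax] := IH.
have [le_ac|lt_ca] := leP (f a) (f c).
  exists c; first by rewrite in_cons cs orbT.
  by move=> d; rewrite in_cons => /orP[/eqP->//|/cmax].
exists a; first by rewrite mem_head.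
move=> d; rewrite in_cons => /orP[/eqP->//|/cmax h].
exact: le_trans h (ltW lt_ca).
Qed.

End Integers.

Lemma span_ind (K : fieldType) (V : vectType K) (X : seq V) (P : V -> Prop) :
  P 0 -> (forall u v, P u -> P v -> P (u + v)) ->
  (forall k a, a \in X -> P (k *: a)) -> forall v, v \in <<X>>%VS -> P v.
Proof.
move=> P0 PD PZ v; rewrite -(in_tupleE X) => /coord_span ->.
elim/big_ind: _ => // i _; apply: PZ.
by rewrite mem_nth // size_tuple.
Qed.

(** * Root systems *)

Section RootSystems.
Context {R : realType} {V : vectType R} (B : {dot V for @idfun R}).
Implicit Types (D P : {fset V}) (a b u v : V).

Lemma reflectionE a b : reflection B a b = b - (2 * B b a / B a a) *: a.
Proof. by rewrite /reflection /coroot dotZr mulrAC. Qed.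

Section Basics.
Context (D : {fset V}).
Hypothesis rsD : root_system B D.

Lemma root_neq0 a : a \in D -> a != 0.
Proof. by case: rsD => D0 _ _ _ _ aD; apply: contraNneq D0 => <-. Qed.

Lemma root_norm_gt0 a : a \in D -> 0 < B a a.
Proof. by move=> /root_neq0/(dot_gt0 B). Qed.

Lemma root_reflection a b :
  a \in D -> b \in D -> b - (2 * B b a / B a a) *: a \in D.
Proof. by case: rsD => _ _ h _ _ aD bD; rewrite -reflectionE h. Qed.

Lemma root_opp a : a \in D -> - a \in D.
Proof.
move=> aD; have := root_reflection aD aD; rewrite mulfK ?gt_eqF ?root_norm_gt0//.
by rewrite scaler_nat mulr2n opprD addrA subrr add0r.
Qed.

Lemma root_int a b : a \in D -> b \in D -> 2 * B b a / B a a \is a Num.int.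
Proof.
by case: rsD => _ _ _ h _ aD bD; have := h _ _ aD bD; rewrite /coroot dotZr mulrAC.
Qed.

Lemma root_cauchy_schwarz a b : a \in D -> b \in D -> b != a -> b != - a ->
  (B a b) ^+ 2 < B a a * B b b.
Proof.
move=> aD bD nba nbNa; rewrite lt_def cauchy_schwarz andbT.
apply/eqP => /esym/(cauchy_schwarz_eq (root_neq0 aD)) E.
case: rsD => _ _ _ _ red; have := red a (B a b / B a a) aD; rewrite -E => /(_ bD).
by case=> c; move: E nba nbNa; rewrite c ?scale1r ?scaleN1r => ->; rewrite eqxx.
Qed.

Lemma root_span_ind (P : V -> Prop) :
  P 0 -> (forall u v, P u -> P v -> P (u + v)) ->
  (forall k a, a \in D -> P (k *: a)) -> forall v, P v.
Proof.
move=> P0 PD PZ v; case: rsD => _ sp _ _ _.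
by apply: (span_ind P0 PD PZ); rewrite sp memvf.
Qed.

Lemma reflection_sum (W : nmodType) (F : V -> W) a : a \in D ->
  \sum_(b <- D) F b = \sum_(b <- D) F (b - (2 * B b a / B a a) *: a).
Proof.
move=> aD; pose s b := b - (2 * B b a / B a a) *: a.
have a0 : B a a != 0 by rewrite gt_eqF ?root_norm_gt0.
have sK : involutive s.
  move=> b; rewrite /s !dotE -addrA -opprD -scalerDl.
  have -> : 2 * B b a / B a a + 2 * (B b a - 2 * B b a / B a a * B a a) / B a a = 0.
    by field.
  by rewrite scale0r subr0.
rewrite -(big_map s predT F); apply: perm_big; apply: uniq_perm.
- exact: fset_uniq.
- by rewrite (map_inj_uniq (inv_inj sK)) fset_uniq.
move=> b; apply/idP/mapP => [bD|[c cD ->]]; last exact: root_reflection.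
by exists (s b); rewrite ?sK //; exact: root_reflection.
Qed.

Hypothesis irrD : irreducible B D.

(** Irreducibility in the form in which it is used: the roots that have the
    property are orthogonal to those that do not. *)
Lemma irreducible_ind (P : V -> Prop) :
  (exists2 a, a \in D & P a) ->
  (forall a b, a \in D -> b \in D -> P a -> B a b != 0 -> P b) ->
  forall b, b \in D -> P b.
Proof.
move=> [a0 a0D Pa0] HP b bD; case: irrD => _ irr.
have E : [fset a in D | `[< P a >]]%fset = D.
  apply: irr.
  - by apply/fsubsetP => x; rewrite !inE => /andP[].
  - by apply/fset0Pn; exists a0; rewrite !inE a0D; apply/asboolP.
  - move=> x y; rewrite !inE => /andP[xD /asboolP Px] /andP[H yD].
    apply/eqP; apply: contraNT H => nz; rewrite yD /=.
    by apply/asboolP; exact: HP Px nz.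
by move: bD; rewrite -{1}E !inE => /andP[_ /asboolP].
Qed.

(** Schur's lemma for the Weyl-equivariant operator [x |-> sum (a | x) a]: it
    sends each root [b] to a multiple of [b], because it commutes with the
    reflection in [b], and as it is symmetric the factors of two non-orthogonal
    roots agree. *)
Lemma casimir_scalar :
  exists c : R, forall x, \sum_(a <- D) B a x *: a = c *: x.
Proof.
pose A x := \sum_(a <- D) B a x *: a.
have AD x y : A (x + y) = A x + A y.
  by rewrite -big_split /=; apply: eq_bigr => a _; rewrite dotDr scalerDl.
have AZ k x : A (k *: x) = k *: A x.
  by rewrite scaler_sumr; apply: eq_bigr => a _; rewrite dotZr scalerA.
pose c b := B (A b) b / B b b.
have Ab b : b \in D -> A b = c b *: b.
  move=> bD; have b0 : B b b != 0 by rewrite gt_eqF ?root_norm_gt0.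
  have : A b = - (A b - (2 * B (A b) b / B b b) *: b).
    rewrite {1}/A (reflection_sum _ bD).
    rewrite (eq_bigr (fun a => - (B a b *: (a - (2 * B a b / B b b) *: b)))).
      rewrite sumrN; congr (- _).
      rewrite {2}/A dot_suml mulr_sumr mulr_suml scaler_suml -sumrB.
      apply: eq_bigr => a _; rewrite scalerBr scalerA dotZl; congr (_ - _ *: _).
      by field.
    move=> a _; rewrite -[RHS]scaleNr; congr (_ *: _); rewrite !dotE; by field.
  move=> /eqP; rewrite opprB eq_sym subr_eq -mulr2n => /eqP E.
  have n2 : (2 : R) != 0 by rewrite pnatr_eq0.
  by apply: (scalerI n2); rewrite scaler_nat -E scalerA /c mulrA.
have Asym x y : B (A x) y = B x (A y).
  rewrite dot_suml dot_sumr; apply: eq_bigr => a _.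
  by rewrite !dotE mulrC (dotC B x a).
have [/fset0Pn[b0 b0D] _] := irrD.
have cE : forall b, b \in D -> c b = c b0.
  apply: (@irreducible_ind (fun b => c b = c b0)); first by exists b0.
  move=> a b aD bD <- nz; apply: (mulIf nz).
  by have := Asym a b; rewrite !Ab // dotZl dotZr => ->.
exists (c b0) => x; rewrite -/(A x); move: x; apply: root_span_ind.
- by rewrite scaler0; have := AZ 0 0; rewrite !scale0r.
- by move=> u v Eu Ev; rewrite AD Eu Ev scalerDr.
- by move=> k a aD; rewrite AZ Ab // (cE a) // !scalerA mulrC.
Qed.

(** Traces are compared: the rank one operator [x |-> (a | x) a] has trace
    [(a | a)]. *)
Lemma casimir_trace c : (forall x, \sum_(a <- D) B a x *: a = c *: x) ->
  \sum_(a <- D) B a a = c * (rank V)%:R.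
Proof.
move=> H; pose e := vbasis (fullv : {vspace V}).
have fr : free e := basis_free (vbasisP _).
rewrite -[rank V]/(\dim {:V}).
have -> : c * (\dim {:V})%:R = \sum_(i < \dim {:V}) coord e i (c *: e`_i).
  rewrite -[in LHS](card_ord (\dim {:V})) -sum1_card natr_sum mulr_sumr.
  apply: eq_bigr => i _; rewrite linearZ /= (coord_free _ _ fr) eqxx.
  by [].
transitivity (\sum_(i < \dim {:V}) \sum_(a <- D) B a e`_i * coord e i a).
  rewrite exchange_big /=; apply: eq_bigr => a _.
  rewrite {2}(coord_vbasis (memvf a)) dot_sumr.
  by apply: eq_bigr => i _; rewrite dotZr mulrC.
apply: eq_bigr => i _; rewrite -H linear_sum /=.
by apply: eq_bigr => a _; rewrite linearZ.
Qed.

(** If [a'] is not orthogonal to [g], then [a'] and its reflection in [g] cannot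
    both be orthogonal to [d] unless [g] is. By this lemma the possible ratios of
    root lengths can be read off from pairs of non-orthogonal roots. *)
Lemma same_length_neighbour a b : a \in D -> b \in D ->
  exists a', [/\ a' \in D, B a' a' = B a a & B a' b != 0].
Proof.
move=> aD; move: b.
apply: (@irreducible_ind
  (fun b => exists a', [/\ a' \in D, B a' a' = B a a & B a' b != 0])).
  by exists a => //; exists a; rewrite gt_eqF ?root_norm_gt0.
move=> g d gD dD [a' [a'D Ea' nz]] gd.
have [E|?] := eqVneq (B a' d) 0; last by exists a'.
exists (a' - (2 * B a' g / B g g) *: g); split; first exact: root_reflection.
  have g0 : B g g != 0 by rewrite gt_eqF ?root_norm_gt0.
  by rewrite -Ea' !dotE (dotC B g a'); field.
by rewrite !dotE E sub0r oppr_eq0 !mulf_neq0 ?invr_eq0 // ?pnatr_eq0 // gt_eqF // root_norm_gt0.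
Qed.

End Basics.

(** * The dual Coxeter number *)

Section HighestRoot.
Context (D : {fset V}) (t theta : V).
Hypothesis rsD : root_system B D.
Hypothesis regt : forall a, a \in D -> B t a != 0.
Let P := [fset a in D | 0 < B t a]%fset.
Hypothesis highest : highest_root D P theta.

Let in_P a : (a \in P) = (a \in D) && (0 < B t a).
Proof. by rewrite !inE. Qed.

Let highest_ge b v : b \in D -> (forall a, a \in P -> 0 <= B v a) ->
  B v b <= B v theta.
Proof.
move=> bD pos; case: highest => _ /(_ b bD)[c E].
rewrite -subr_ge0 -dotNr -dotDr E dot_sumr big_seq sumr_ge0 // => a aP.
by rewrite -scaler_nat dotZr mulr_ge0 ?ler0n ?pos.
Qed.

Let t_pos a : a \in P -> 0 <= B t a.
Proof. by rewrite in_P => /andP[_ /ltW]. Qed.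

Lemma highest_root_positive : theta \in P.
Proof.
have [tD _] := highest; rewrite in_P tD /=.
have := highest_ge (root_opp rsD tD) t_pos; rewrite dotNr => h.
have := regt tD; rewrite lt_def => -> /=; lra.
Qed.

Lemma highest_root_dominant a : a \in P -> 0 <= B theta a.
Proof.
rewrite in_P => /andP[aD ta]; have [tD _] := highest.
have := highest_ge (root_reflection rsD aD tD) t_pos.
have a0 := root_norm_gt0 rsD aD.
rewrite !dotE => h.
have : 0 <= 2 * B theta a / B a a * B t a by lra.
by rewrite pmulr_lge0 // pmulr_lge0 ?invr_gt0 // pmulr_rge0.
Qed.

(** A root of maximal length can be chosen dominant, and then it is dominated by
    [theta] while both lie in the closed positive chamber. *)
Lemma highest_root_long b : b \in D -> B b b <= B theta theta.
Proof.
move=> bD; have [tD _] := highest.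
have D0 : enum_fset D != [::] by apply/eqP => E; have : b \in enum_fset D by []; rewrite E.
have [l lD lmax] := maximum_seq (fun a => B a a) D0.
apply: le_trans (lmax b bD) _.
pose L := [seq a <- enum_fset D | B a a == B l l].
have lL : l \in L by rewrite mem_filter eqxx.
have L0 : L != [::] by apply: contraTneq lL => ->.
have [m mL mmax] := maximum_seq (B t) L0.
have := mL; rewrite mem_filter => /andP[/eqP El mD].
have dom a : a \in P -> 0 <= B m a.
  rewrite in_P => /andP[aD ta]; have a0 := root_norm_gt0 rsD aD.
  have := mmax (m - (2 * B m a / B a a) *: a).
  rewrite mem_filter (root_reflection rsD aD mD) andbT.
  have -> : B (m - (2 * B m a / B a a) *: a) (m - (2 * B m a / B a a) *: a) = B m m.
    by rewrite !dotE (dotC B a m); field; rewrite gt_eqF.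
  rewrite El eqxx !dotE => /(_ isT) h.
  have : 0 <= 2 * B m a / B a a * B t a by lra.
  by rewrite pmulr_lge0 // pmulr_lge0 ?invr_gt0 // pmulr_rge0.
rewrite -El; apply: le_trans (highest_ge mD dom) _.
rewrite dotC; apply: highest_ge => //; exact: highest_root_dominant.
Qed.

Hypothesis theta2 : B theta theta = 2.

(** Positive roots other than [theta] pair with the coroot of [theta] to [0] or
    [1], so squaring the pairing changes only the contribution of [theta]. *)
Lemma highest_root_sqr_sum :
  \sum_(a <- D) B a theta ^+ 2 = 4 * (1 + B (half_sum P) (coroot B theta)).
Proof.
have tP := highest_root_positive.
have [tD _] := highest.
pose s := \sum_(a <- P) B a theta ^+ 2.
have -> : \sum_(a <- D) B a theta ^+ 2 = s + s.
  rewrite (big_fsetID _ (fun a => 0 < B t a)) /= -/P; congr (_ + _).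
  transitivity (\sum_(a <- P) B (- a) theta ^+ 2); last first.
    by apply: eq_bigr => a _; rewrite dotNl sqrrN.
  rewrite -(big_map -%R predT (fun a => B a theta ^+ 2)).
  apply: perm_big; apply: uniq_perm.
  - exact: fset_uniq.
  - by rewrite map_inj_uniq ?fset_uniq //; exact: oppr_inj.
  move=> x; rewrite !inE; apply/andP/mapP => [[xD nx]|[y yP ->]].
    exists (- x); rewrite ?opprK // in_P (root_opp rsD) //= dotNr.
    by have := regt xD; move: nx; rewrite -leNgt oppr_gt0 lt_neqAle => -> ->.
  move: yP; rewrite in_P => /andP[yD ty]; split; first exact: root_opp.
  by rewrite dotNr -leNgt oppr_le0 ltW.
have -> : s = \sum_(a <- P) B a theta + 2.
  rewrite /s (big_fsetD1 theta tP) [in RHS](big_fsetD1 theta tP) /= theta2.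
  rewrite addrAC; congr (_ + _); first ring.
  rewrite big_seq [RHS]big_seq; apply: eq_bigr => a.
  rewrite 2!inE => /andP[nat /[dup] aP]; rewrite in_P => /andP[aD ta].
  have a_ge0 := highest_root_dominant aP.
  have := root_int rsD tD aD; rewrite theta2 mulrAC divff ?pnatr_eq0 // mul1r => ai.
  have nNt : a != - theta.
    apply: contraTneq ta => ->; rewrite dotNr -leNgt oppr_le0.
    by move: tP; rewrite in_P => /andP[_ /ltW].
  have := root_cauchy_schwarz rsD tD aD nat nNt; rewrite theta2 dotC => lt.
  have := highest_root_long aD; rewrite theta2 => le2.
  have : B a theta ^+ 2 < 4 by lra.
  case/(int_sqr_lt4 ai) => E; rewrite E ?expr0n ?expr1n //.
  by move: a_ge0; rewrite dotC E ler0N1.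
by rewrite /half_sum /coroot theta2 divff ?pnatr_eq0 // scale1r dotZl dot_suml; field.
Qed.

End HighestRoot.

(** Both sides are the trace of the Casimir operator, whose scalar is found by
    evaluating it at the highest root. *)
Lemma sum_root_norms D (hv : R) : root_system B D -> irreducible B D ->
  normalized B D -> dual_coxeter_number B D hv ->
  \sum_(a <- D) B a a = 2 * hv * (rank V)%:R.
Proof.
move=> rsD irrD nD [P [theta [[t [regt ->]] hi ->]]].
have [c cE] := casimir_scalar rsD irrD.
have [tD _] := hi.
have t2 : B theta theta = 2 by apply: nD; split => // b; exact: highest_root_long hi _.
rewrite (casimir_trace cE); congr (_ * _).
have := highest_root_sqr_sum rsD regt hi t2.
have -> : \sum_(a <- D) B a theta ^+ 2 = c * 2.
  rewrite -t2 -dotZl -cE dot_suml; apply: eq_bigr => a _.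
  by rewrite dotZl expr2.
by move=> E; lra.
Qed.

(** * Two root lengths and Langlands duality *)

(** The hypotheses on [D] in the form in which they pass to the dual system. *)
Definition two_lengths (n : nat) D : Prop :=
  [/\ root_system B D, irreducible B D,
      forall a, a \in D -> B a a = 2 \/ B a a = 2 / n%:R,
      exists2 a, a \in D & B a a = 2
    & exists2 a, a \in D & B a a = 2 / n%:R].

(** The ratio of the lengths of two non-orthogonal roots is the ratio of two
    integers of product at most [3]; comparison with a longest and with a
    shortest root leaves only the two extreme lengths. *)
Lemma two_lengths_intro (n : nat) D : root_system B D -> irreducible B D ->
  normalized B D -> n = 2%N \/ n = 3%N -> length_ratio B D n -> two_lengths n D.
Proof.
move=> rsD irrD nD n23 lrD.
have [/fset0Pn[b0 b0D] _] := irrD.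
have D0 : enum_fset D != [::].
  by apply/eqP => E; have : b0 \in enum_fset D by []; rewrite E.
have [l lD lmax] := maximum_seq (fun a => B a a) D0.
have [s sD smin] := maximum_seq (fun a => - B a a) D0.
have {}smin b : b \in D -> B s s <= B b b by move/smin; rewrite lerN2.
have l2 : B l l = 2 by apply: nD; split.
have n0 : 0 < n%:R :> R by rewrite ltr0n; lia.
have s2 : B s s = 2 / n%:R.
  have := lrD l s (conj lD lmax) (conj sD smin); rewrite l2 => ->; field.
  by rewrite gt_eqF.
split=> //; [| by exists l| by exists s].
move=> b bD; have b0' := root_norm_gt0 rsD bD.
have [a [aD Ea nz]] := same_length_neighbour rsD irrD lD bD.
rewrite l2 in Ea.
have [E|nba] := eqVneq b a; first by left; rewrite E.
have [E|nbNa] := eqVneq b (- a); first by left; rewrite E dotNl dotNr opprK.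
have lt := root_cauchy_schwarz rsD aD bD nba nbNa; rewrite Ea in lt.
have qi := root_int rsD aD bD.
rewrite Ea mulrAC divff ?pnatr_eq0 // mul1r dotC in qi.
have le2 := lmax b bD; rewrite l2 in le2.
have q1 : B a b ^+ 2 = 1.
  have : B a b ^+ 2 < 4 by lra.
  case/(int_sqr_lt4 qi) => E; rewrite E ?sqrrN ?expr1n //.
  by rewrite E eqxx in nz.
have /intrP[k Ek] : 2 / B b b \is a Num.int.
  have -> : 2 / B b b = B a b * (2 * B a b / B b b).
    by rewrite mulrA mulrCA -expr2 q1 mulr1.
  by rewrite rpredM // (root_int rsD bD aD).
have Eb : B b b = 2 / k%:~R.
  by rewrite -Ek; field; rewrite gt_eqF.
have k0 : 0 < k%:~R :> R by rewrite -Ek divr_gt0.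
have k4 : k%:~R < 4%:~R :> R.
  rewrite q1 Eb in lt; move: lt; rewrite mulrA ltr_pdivlMr // mul1r.
  by congr (_ < _); ring.
have kn : k%:~R <= n%:~R :> R.
  have := smin b bD; rewrite s2 Eb ler_pdivrMr // mulrAC ler_pdivlMr //.
  by rewrite ler_pM2l.
move: k0 k4 kn; rewrite ltr0z ltr_int ler_int => k0 k4 kn.
have [k1|[kn'|[k2 n3]]] : k = 1 \/ k = n%:Z \/ k = 2 /\ n = 3%N.
  by clear -k0 k4 kn n23; lia.
- by left; rewrite Eb k1 mulr1z divr1.
- by right; rewrite Eb kn'.
exfalso; subst n; clear n23.
have n1 : 2 / 3%:R <> 1 :> R by lra.
have [c [cD Ec cnz]] := same_length_neighbour rsD irrD sD bD.
rewrite s2 in Ec.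
have bn1 : B b b = 1 by rewrite Eb k2 (_ : 2%:~R = 2) // divff ?pnatr_eq0.
have nbc : b != c by apply: contra_notN n1 => /eqP E; rewrite -Ec -E bn1.
have nbNc : b != - c.
  by apply: contra_notN n1 => /eqP E; rewrite -Ec -bn1 E dotNl dotNr opprK.
have ltc := root_cauchy_schwarz rsD cD bD nbc nbNc; rewrite Ec bn1 mulr1 in ltc.
have := root_int rsD bD cD; rewrite bn1 divr1 => /intrP[i Ei].
have := root_int rsD cD bD; rewrite Ec (dotC B b c) => /intrP[j Ej].
have E1 : 3 * i%:~R = 2 * j%:~R :> R by rewrite -Ei -Ej; field.
have E2 : i%:~R ^+ 2 < 3 :> R.
  by rewrite -Ei exprMn; lra.
have {}E1 : 3 * i = 2 * j by apply: (@intr_inj R); rewrite !rmorphM.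
have {}E2 : i ^+ 2 < 3 by rewrite -(ltr_int R) rmorphXn.
have i0 : i = 0 by clear -E1 E2; nia.
by move: cnz; rewrite -(mulrI_eq0 _ (@mulfI R 2 _)) ?pnatr_eq0 // Ei i0 eqxx.
Qed.

Lemma two_lengths_normalized n D : (0 < n)%N -> two_lengths n D -> normalized B D.
Proof.
move=> n0 [_ _ len [l lD El] _] a [aD amax].
have := amax l lD; rewrite El; case: (len a aD) => -> // h.
apply/eqP; rewrite eq_le h andbT.
by rewrite ler_pdivrMr ?ltr0n // ler_peMr // ler1n.
Qed.

Section LanglandsDual.
Context (n : nat).
Hypothesis n0 : (0 < n)%N.

Let nR : 0 < n%:R :> R. Proof. by rewrite ltr0n. Qed.
Let sn0 : Num.sqrt n%:R != 0 :> R. Proof. by rewrite gt_eqF // sqrtr_gt0. Qed.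
Let snK : Num.sqrt n%:R ^+ 2 = n%:R :> R. Proof. by rewrite sqr_sqrtr // ltW. Qed.

Definition dual_root a : V := (Num.sqrt n%:R)^-1 *: coroot B a.

Lemma dual_rootE a : dual_root a = (2 / (Num.sqrt n%:R * B a a)) *: a.
Proof. by rewrite /dual_root /coroot scalerA; congr (_ *: _); rewrite invfM; ring. Qed.

Lemma dot_dual_root a b :
  B (dual_root a) (dual_root b) = 4 * B a b / (n%:R * B a a * B b b).
Proof.
rewrite !dual_rootE !dotE; move: sn0 snK; set s := Num.sqrt _ => s0 <-.
have [->|a0] := eqVneq a 0.
  by rewrite !dot0l; ring.
have [->|b0] := eqVneq b 0; first by rewrite !dot0r; ring.
by field; rewrite !dot_eq0 a0 b0 s0.
Qed.

Lemma coroot_dual_root a : a != 0 -> coroot B (dual_root a) = Num.sqrt n%:R *: a.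
Proof.
move=> a0; rewrite /coroot dot_dual_root dual_rootE scalerA; congr (_ *: _).
by move: sn0 snK; set s := Num.sqrt _ => s0 <-; field; rewrite dot_eq0 a0 s0.
Qed.

Lemma dual_rootK a : a != 0 -> dual_root (dual_root a) = a.
Proof.
by move=> a0; rewrite /dual_root coroot_dual_root // scalerA mulVf // scale1r.
Qed.

Lemma langlands_rootsP D b : reflect (exists2 a, a \in D & b = dual_root a)
  (b \in langlands_roots B n D).
Proof. exact: imfsetP. Qed.

Context (D : {fset V}).
Hypothesis rsD : root_system B D.
Local Notation LD := (langlands_roots B n D).

Lemma langlands_roots_involutive : langlands_roots B n LD = D.
Proof.
apply/fsetP => x; apply/langlands_rootsP/idP => [[y /langlands_rootsP[z zD ->] ->]|xD].
  by rewrite dual_rootK ?(root_neq0 rsD).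
exists (dual_root x); last by rewrite dual_rootK ?(root_neq0 rsD).
by apply/langlands_rootsP; exists x.
Qed.

Lemma sum_langlands_roots (F : V -> R) :
  \sum_(b <- LD) F b = \sum_(a <- D) F (dual_root a).
Proof.
rewrite big_imfset //= => x y xD yD /(congr1 dual_root).
by rewrite !dual_rootK ?(root_neq0 rsD).
Qed.

Lemma dual_root_neq0 a : a \in D -> dual_root a != 0.
Proof.
move=> aD; have a0 := root_neq0 rsD aD.
by rewrite dual_rootE scaler_eq0 negb_or a0 andbT mulf_neq0 ?pnatr_eq0 //
  invr_neq0 // mulf_neq0 // dot_eq0.
Qed.

Lemma reflection_dual_root a b : a \in D -> b \in D ->
  reflection B (dual_root a) (dual_root b) = dual_root (reflection B a b).
Proof.
move=> aD bD; have a0 := root_neq0 rsD aD; have b0 := root_neq0 rsD bD.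
have nb : B (reflection B a b) (reflection B a b) = B b b.
  by rewrite !reflectionE !dotE (dotC B a b); field; rewrite dot_eq0.
rewrite (dual_rootE (reflection B a b)) nb reflectionE !dot_dual_root !dual_rootE.
rewrite reflectionE scalerBr !scalerA; congr (_ - _ *: _).
by move: sn0 snK; set s := Num.sqrt _ => s0 <-; field; rewrite !dot_eq0 a0 b0 s0.
Qed.

Lemma langlands_root_system : root_system B LD.
Proof.
have rD := root_neq0 rsD.
split.
- by apply/langlands_rootsP => -[a /dual_root_neq0/eqP h /esym].
- apply/vspaceP => v; rewrite memvf; move: v; apply: (root_span_ind rsD).
  + exact: mem0v.
  + by move=> u v; exact: memvD.
  move=> k a aD; have -> : a = (Num.sqrt n%:R * B a a / 2) *: dual_root a.
    rewrite dual_rootE scalerA -[LHS]scale1r; congr (_ *: _).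
    by field; rewrite dot_eq0 rD // sn0.
  apply: memvZ; apply: memvZ; apply: memv_span.
  by apply/langlands_rootsP; exists a.
- move=> _ _ /langlands_rootsP[a aD ->] /langlands_rootsP[b bD ->].
  rewrite reflection_dual_root //; apply/langlands_rootsP.
  by exists (reflection B a b) => //; rewrite reflectionE (root_reflection rsD aD bD).
- move=> _ _ /langlands_rootsP[a aD ->] /langlands_rootsP[b bD ->].
  rewrite coroot_dual_root ?rD // dual_rootE !dotE.
  have -> : 2 / (Num.sqrt n%:R * B b b) * (Num.sqrt n%:R * B b a) = 2 * B a b / B b b.
    by rewrite (dotC B b a); field; rewrite dot_eq0 rD // sn0.
  exact: (root_int rsD bD aD).
- move=> _ c /langlands_rootsP[a aD ->] /langlands_rootsP[b bD E].
  have a0 := rD a aD; have b0 := rD b bD.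
  have c0 : c != 0.
    apply: contraTneq (dual_root_neq0 bD) => c_eq0.
    by rewrite -E c_eq0 scale0r eqxx.
  have Eb : b = c^-1 *: a.
    move: E => /(congr1 dual_root); rewrite dual_rootK // => <-.
    rewrite (dual_rootE (c *: _)) dotZl dotZr dot_dual_root (dual_rootE a) !scalerA.
    congr (_ *: _); move: sn0 snK; set s := Num.sqrt _ => s0 <-; field.
    by rewrite ?dot_eq0 s0 a0 c0.
  case: (rsD) => _ _ _ _ red; have := red a c^-1 aD.
  rewrite -Eb => /(_ bD) [] /(congr1 GRing.inv); rewrite invrK ?invr1 ?invrN1.
    by left.
  by right.
Qed.

Lemma langlands_irreducible : irreducible B D -> irreducible B LD.
Proof.
move=> irrD; split.
  have [/fset0Pn[a aD] _] := irrD.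
  by apply/fset0Pn; exists (dual_root a); apply/langlands_rootsP; exists a.
move=> A /fsubsetP AD /fset0Pn[x xA] orth.
have all_A : forall a, a \in D -> dual_root a \in A.
  apply: (irreducible_ind irrD).
    by have /langlands_rootsP[a aD E] := AD _ xA; exists a; rewrite -?E.
  move=> a b aD bD aA; apply: contraNT => bA.
  have bLA : dual_root b \in (LD `\` A)%fset.
    by rewrite inE bA; apply/langlands_rootsP; exists b.
  have d0 : n%:R * B a a * B b b != 0.
    by rewrite !mulf_neq0 ?dot_eq0 ?(root_neq0 rsD) // gt_eqF.
  have /eqP := orth _ _ aA bLA.
  by rewrite dot_dual_root !mulf_eq0 pnatr_eq0 invr_eq0 (negPf d0) orbF.
apply/fsetP => y; apply/idP/idP => [/AD//|/langlands_rootsP[a aD ->]].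
exact: all_A.
Qed.

End LanglandsDual.

Lemma langlands_two_lengths n D : (0 < n)%N ->
  two_lengths n D -> two_lengths n (langlands_roots B n D).
Proof.
move=> n0 [rsD irrD len [l lD El] [s sD Es]].
have nR : n%:R != 0 :> R by rewrite pnatr_eq0 -lt0n.
have long_to_short a : B a a = 2 -> B (dual_root n a) (dual_root n a) = 2 / n%:R.
  by move=> E; rewrite dot_dual_root // E; field.
have short_to_long a : B a a = 2 / n%:R -> B (dual_root n a) (dual_root n a) = 2.
  by move=> E; rewrite dot_dual_root // E; field.
split.
- exact: langlands_root_system.
- exact: langlands_irreducible.
- move=> _ /langlands_rootsP[a aD ->]; case: (len a aD) => E; [right|left]; auto.
- by exists (dual_root n s); [apply/langlands_rootsP; exists s|exact: short_to_long].
- by exists (dual_root n l); [apply/langlands_rootsP; exists l|exact: long_to_short].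
Qed.

(** Adding the traces of the Casimir operators of [D] and of its dual: a root and
    its dual root together contribute [2 + 2 / n], whatever their lengths. *)
Lemma dual_coxeter_numbers_sum n D (hv Lhv : R) : (0 < n)%N ->
  two_lengths n D -> dual_coxeter_number B D hv ->
  dual_coxeter_number B (langlands_roots B n D) Lhv ->
  (hv + Lhv) * (rank V)%:R = (1 + n%:R^-1) * #|` D|%:R.
Proof.
move=> n0 tD hD hLD; have [rsD irrD len _ _] := tD.
have tLD := langlands_two_lengths n0 tD; have [rsLD irrLD _ _ _] := tLD.
have nR : n%:R != 0 :> R by rewrite pnatr_eq0 -lt0n.
have := sum_root_norms rsLD irrLD (two_lengths_normalized n0 tLD) hLD.
have := sum_root_norms rsD irrD (two_lengths_normalized n0 tD) hD.
rewrite (sum_langlands_roots n0 rsD (fun b => B b b)) => E1 E2.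
have : \sum_(a <- D) B a a + \sum_(a <- D) B (dual_root n a) (dual_root n a)
    = (2 + 2 / n%:R) * #|` D|%:R.
  rewrite -big_split /= -sum1_size natr_sum mulr_sumr big_seq [RHS]big_seq.
  apply: eq_bigr => a aD; rewrite dot_dual_root //.
  by case: (len a aD) => ->; field.
by rewrite E1 E2 => E; apply: (@mulfI _ 2); rewrite ?pnatr_eq0 //; lra.
Qed.

End RootSystems.

Section Classification.
Context {R : realType} {V : vectType R} (B : {dot V for @idfun R}).
Implicit Types (D P : {fset V}) (a b u v : V).

(** * Root systems with length ratio two *)

Lemma cardfs2_pair (K : choiceType) (A : {fset K}) : #|` A| = 2%N ->
  exists x y, x != y /\ A = [fset x; y]%fset.
Proof.
move=> A2; have [x xA] : exists x, x \in A by apply/fset0Pn; rewrite -cardfs_gt0 A2.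
have [y] : exists y, y \in (A `\ x)%fset.
  by apply/fset0Pn; rewrite -cardfs_gt0; move: A2; rewrite (cardfsD1 x) xA add1n => -[->].
rewrite in_fsetD1 => /andP[nyx yA]; exists x, y; rewrite eq_sym; split=> //.
apply/esym/eqP; rewrite eqEfcard cardfs2 eq_sym nyx A2 andbT.
by apply/fsubsetP => z; rewrite !inE => /orP[] /eqP ->.
Qed.

(** The vectors [± e] and [± e ± f], for [e] and [f] in a frame of [k] members, are
    the roots of a subsystem of type B_k. *)
Definition frame D (E : {fset V}) : Prop :=
  (forall e, e \in E -> e \in D /\ B e e = 1) /\
  (forall e f, e \in E -> f \in E -> e != f ->
     [/\ B e f = 0, e + f \in D & e - f \in D]).

Definition proj (E : {fset V}) v : V := \sum_(e <- E) B v e *: e.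

Section Frames.
Context (D E : {fset V}).
Hypothesis frE : frame D E.

Lemma dot_frame e f : e \in E -> f \in E -> B e f = (e == f)%:R.
Proof.
move=> eE fE; have [<-|nef] := eqVneq e f; first by have [_ ->] := frE.1 e eE.
by have [-> _ _] := frE.2 e f eE fE nef.
Qed.

Lemma dot_sum_frame (k : V -> R) f : f \in E -> B (\sum_(e <- E) k e *: e) f = k f.
Proof.
move=> fE; rewrite dot_suml (big_fsetD1 f fE) /= dotZl dot_frame // eqxx mulr1.
rewrite big_seq big1 ?addr0 // => e; rewrite 2!inE => /andP[nef eE].
by rewrite dotZl dot_frame // (negPf nef) mulr0.
Qed.

Lemma frame_bessel v :
  B (v - proj E v) (v - proj E v) = B v v - \sum_(e <- E) B v e ^+ 2.
Proof.
have S : B v (proj E v) = \sum_(e <- E) B v e ^+ 2.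
  by rewrite dot_sumr; apply: eq_bigr => e _; rewrite dotZr expr2.
have -> : B (v - proj E v) (v - proj E v)
    = B v v - 2 * B v (proj E v) + B (proj E v) (proj E v).
  by rewrite !(dotDl, dotDr, dotNl, dotNr) (dotC B (proj E v) v); ring.
have -> : B (proj E v) (proj E v) = \sum_(e <- E) B v e ^+ 2.
  rewrite {2}/proj dot_sumr big_seq [RHS]big_seq; apply: eq_bigr => e eE.
  by rewrite dotZr /proj (dot_sum_frame (B v)) // expr2.
by rewrite S; ring.
Qed.

Lemma frame_parseval v : \sum_(e <- E) B v e ^+ 2 = B v v -> v = proj E v.
Proof.
move=> S; apply/eqP; rewrite -subr_eq0 -(dot_eq0 B) frame_bessel S.
by rewrite subrr.
Qed.

Lemma frame_pair_span v e f : e \in E -> f \in E -> e != f ->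
  B v e ^+ 2 + B v f ^+ 2 = B v v -> v = B v e *: e + B v f *: f.
Proof.
move=> eE fE nef S; apply/eqP; rewrite -subr_eq0 -(dot_eq0 B) !dotE.
rewrite (dotC B e v) (dotC B f v) (dot_frame eE eE) (dot_frame fE fE).
rewrite (dot_frame eE fE) (dot_frame fE eE) !eqxx (eq_sym f) (negPf nef).
by rewrite -S /=; apply/eqP; ring.
Qed.

Lemma frame_signed_sum e f (x y : R) : root_system B D -> e \in E -> f \in E ->
  e != f -> x ^+ 2 = 1 -> y ^+ 2 = 1 -> x *: e + y *: f \in D.
Proof.
move=> rsD eE fE nef /eqP; rewrite sqrf_eq1 => Ex /eqP; rewrite sqrf_eq1 => Ey.
have [_ p m] := frE.2 e f eE fE nef.
case/orP: Ex => /eqP ->; case/orP: Ey => /eqP ->; rewrite ?scale1r ?scaleN1r //.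
  by rewrite -[- e + f]opprK opprD opprK (root_opp rsD).
by rewrite -opprD (root_opp rsD).
Qed.

End Frames.

Section RatioTwo.
Context (D : {fset V}).
Hypothesis tlD : two_lengths B 2 D.

Let rsD : root_system B D. Proof. by case: tlD. Qed.
Let irrD : irreducible B D. Proof. by case: tlD. Qed.

Lemma ratio2_lengths a : a \in D -> B a a = 2 \/ B a a = 1.
Proof.
move=> aD; case: tlD => _ _ /(_ a aD)[->|->] _ _; [by left|right].
by rewrite divff ?pnatr_eq0.
Qed.

Lemma long_reflection a b : a \in D -> B a a = 2 -> b \in D -> b - B b a *: a \in D.
Proof.
move=> aD Ea bD; have := root_reflection rsD aD bD.
by rewrite Ea mulrAC divff ?pnatr_eq0 // mul1r.
Qed.

Lemma short_reflection a b : a \in D -> B a a = 1 -> b \in D ->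
  b - (2 * B b a) *: a \in D.
Proof. by move=> aD Ea bD; have := root_reflection rsD aD bD; rewrite Ea divr1. Qed.

Lemma dot_long_root a b : a \in D -> B a a = 2 -> b \in D -> b != a -> b != - a ->
  [\/ B a b = 0, B a b = 1 | B a b = -1].
Proof.
move=> aD Ea bD nba nbNa.
have := root_int rsD aD bD; rewrite Ea mulrAC divff ?pnatr_eq0 // mul1r dotC => i.
apply: (int_sqr_lt4 i); have := root_cauchy_schwarz rsD aD bD nba nbNa.
by case: (ratio2_lengths bD) => ->; rewrite Ea => h; lra.
Qed.

Lemma dot_long_short a b : a \in D -> B a a = 2 -> b \in D -> B b b = 1 ->
  [\/ B a b = 0, B a b = 1 | B a b = -1].
Proof.
move=> aD Ea bD Eb; have n12 : (1 : R) != 2 by rewrite eq_sym; apply/eqP => h; lra.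
apply: dot_long_root => //.
  by apply: contra_neq n12 => E; rewrite -Ea -Eb E.
by apply: contra_neq n12 => E; rewrite -Ea -Eb E !dotE opprK.
Qed.

Lemma dot_short_short a b : a \in D -> B a a = 1 -> b \in D -> B b b = 1 ->
  b != a -> b != - a -> B a b = 0 \/ B a b ^+ 2 = 1 / 4.
Proof.
move=> aD Ea bD Eb nba nbNa.
have := root_int rsD aD bD; rewrite Ea divr1 dotC => i.
have := root_cauchy_schwarz rsD aD bD nba nbNa; rewrite Ea Eb => lt.
have /(int_sqr_lt4 i)[] : (2 * B a b) ^+ 2 < 4 by rewrite exprMn; lra.
- by move/eqP; rewrite mulf_eq0 pnatr_eq0 /= => /eqP; left.
- move=> h; right; have -> : B a b = 1 / 2 by lra.
  by field.
- move=> h; right; have -> : B a b = - (1 / 2) by lra.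
  by field.
Qed.

(** A long root that meets a frame in a single member [e] is [e] plus a short root
    orthogonal to the frame, which can be added to it. *)
Lemma frame_extend E a e : frame D E -> a \in D -> B a a = 2 -> e \in E ->
  B a e != 0 -> (forall f, f \in E -> f != e -> B a f = 0) ->
  exists2 E', frame D E' & (#|` E| < #|` E'|)%N.
Proof.
move=> frE; wlog Eae : a / B a e = 1.
  move=> W aD Ea eE nz others; have [eD Ee] := frE.1 e eE.
  case: (dot_long_short aD Ea eD Ee) => E1; first by rewrite E1 eqxx in nz.
    exact: (W a).
  apply: (W (- a)); rewrite ?dotNl ?dotNr ?opprK ?E1 ?opprK ?oner_eq0 //.
    exact: (root_opp rsD).
  by move=> f fE nfe; rewrite dotNl others // oppr0.
move=> aD Ea eE _ others; have [eD Ee] := frE.1 e eE.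
have Eea : B e a = 1 by rewrite dotC.
pose x := a - e.
have xD : x \in D.
  have := root_opp rsD (long_reflection aD Ea eD).
  by rewrite Eea scale1r opprB.
have Ex : B x x = 1 by rewrite /x !dotE Ee Ea Eae Eea; ring.
have orth f : f \in E -> B x f = 0.
  move=> fE; have [->|nfe] := eqVneq f e; first by rewrite /x !dotE Eae Ee subrr.
  by rewrite /x !dotE others // (dot_frame frE) // eq_sym (negPf nfe) subrr.
have xE : x \notin E by apply/negP => /orth; rewrite Ex => /eqP; rewrite oner_eq0.
have xpe : x + e \in D by rewrite /x subrK.
clearbody x.
have xP f : f \in E -> x + f \in D.
  move=> fE; have [->//|nfe] := eqVneq f e.
  have nef' : e != f by rewrite eq_sym.
  have [_ _ efD] := frE.2 e f eE fE nef'.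
  have [fD Ef] := frE.1 f fE.
  have nef := negPf nef'.
  have Eefef : B (e - f) (e - f) = 2.
    by rewrite !dotE Ee Ef !(dot_frame frE) // (negPf nfe) nef /=; ring.
  have := long_reflection efD Eefef xpe.
  have -> : B (x + e) (e - f) = 1.
    by rewrite !dotE !orth // Ee (dot_frame frE) // nef /=; ring.
  by rewrite scale1r opprB addrACA subrr addr0.
have xM f : f \in E -> x - f \in D.
  move=> fE; have [fD Ef] := frE.1 f fE.
  have := short_reflection fD Ef (xP f fE).
  rewrite dotDl orth // Ef add0r mulr1 scaler_nat mulr2n opprD addrA addrK.
  by [].
exists (x |` E)%fset; last by rewrite cardfsU1 xE.
split=> [f|f g]; rewrite !inE.
  by case/orP => [/eqP->|/frE.1].
case/orP => [/eqP->|fE]; case/orP => [/eqP->|gE]; rewrite ?eqxx //.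
- by move=> _; rewrite orth // xP // xM.
- move=> _; rewrite dotC orth // addrC xP // -opprB (root_opp rsD) ?xM //.
- exact: frE.2.
Qed.

Lemma frame_sub E : frame D E -> (E `<=` D)%fset.
Proof. by move=> [h _]; apply/fsubsetP => e /h[]. Qed.

Lemma maximal_frame : exists2 E, frame D E &
  forall E', frame D E' -> (#|` E'| <= #|` E|)%N.
Proof.
pose Q k := `[< exists2 E, frame D E & #|` E| = k >].
have exQ : exists k, Q k.
  by exists 0%N; apply/asboolP; exists fset0; rewrite ?cardfs0 //; split.
have ubQ k : Q k -> (k <= #|` D|)%N.
  by move=> /asboolP[E /frame_sub/fsubset_leq_card + <-].
case: (ex_maxnP exQ ubQ) => k /asboolP[E frE Ek] kmax; exists E => // E' frE'.
by rewrite Ek; apply: kmax; apply/asboolP; exists E'.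
Qed.

Lemma short_neighbour a : a \in D -> B a a = 2 ->
  exists b, [/\ b \in D, B b b = 1 & B a b = 1].
Proof.
move=> aD Ea; case: tlD => _ _ _ _ [s sD Es].
have [b [bD Eb nz]] := same_length_neighbour rsD irrD sD aD.
have {}Eb : B b b = 1 by rewrite Eb Es divff ?pnatr_eq0.
rewrite dotC in nz; case: (dot_long_short aD Ea bD Eb) => E.
- by rewrite E eqxx in nz.
- by exists b.
- by exists (- b); rewrite (root_opp rsD) // !dotE E !opprK.
Qed.

Lemma frame2 a b : a \in D -> B a a = 2 -> b \in D -> B b b = 1 -> B a b = 1 ->
  frame D [fset b; a - b]%fset /\ b != a - b.
Proof.
move=> aD Ea bD Eb Eab; have Eba : B b a = 1 by rewrite dotC.
have xD : a - b \in D.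
  have := root_opp rsD (long_reflection aD Ea bD).
  by rewrite Eba scale1r opprB.
have Ex : B (a - b) (a - b) = 1 by rewrite !dotE Ea Eb Eab Eba; ring.
have Ebx : B b (a - b) = 0 by rewrite !dotE Eba Eb subrr.
have dD : b - (a - b) \in D.
  have := root_opp rsD (short_reflection bD Eb aD).
  by rewrite Eab mulr1 scaler_nat mulr2n !opprB addrA.
split; last by apply/eqP => E; move: Ebx; rewrite -E Eb => /eqP; rewrite oner_eq0.
split=> [f|f g]; rewrite !inE; first by case/orP => /eqP ->.
case/orP => /eqP ->; case/orP => /eqP ->; rewrite ?eqxx //= => _.
  by rewrite Ebx addrC subrK.
by rewrite dotC Ebx subrK -opprB (root_opp rsD).
Qed.

Lemma exists_frame2 : exists2 E, frame D E & #|` E| = 2%N.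
Proof.
have [_ _ _ [a aD Ea] _] := tlD.
have [b [bD Eb Eab]] := short_neighbour aD Ea.
have [frE nbx] := frame2 aD Ea bD Eb Eab.
by exists [fset b; a - b]%fset; rewrite // cardfs2 nbx.
Qed.

(** Of the two members of a frame with sum [a], the root [c] meets exactly one,
    because its pairings with them and with [a] all lie in [{0, 1, -1}]. *)
Lemma exists_frame3 a c : a \in D -> B a a = 2 -> c \in D -> B c c = 2 ->
  c != a -> c != - a -> B a c != 0 -> exists2 E, frame D E & (2 < #|` E|)%N.
Proof.
move=> aD Ea cD Ec nca ncNa nz.
have [b [bD Eb Eab]] := short_neighbour aD Ea.
have [frE nbx] := frame2 aD Ea bD Eb Eab.
have cardE : #|` [fset b; a - b]%fset| = 2%N by rewrite cardfs2 nbx.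
have bE : b \in [fset b; a - b]%fset by rewrite !inE eqxx.
have xE : a - b \in [fset b; a - b]%fset by rewrite !inE eqxx orbT.
have [xD Ex] := frE.1 _ xE.
have Sum : B c b + B c (a - b) = B a c by rewrite -dotDr addrC subrK dotC.
have ext e : e \in [fset b; a - b]%fset -> B c e != 0 ->
    (forall f, f \in [fset b; a - b]%fset -> f != e -> B c f = 0) ->
    exists2 E, frame D E & (2 < #|` E|)%N.
  move=> eE nze o; have [E frE' lt] := frame_extend frE cD Ec eE nze o.
  by exists E; rewrite // -cardE.
have [cb0|cb_neq0] := eqVneq (B c b) 0.
  apply: (ext (a - b)) => //; first by move: Sum; rewrite cb0 add0r => ->.
  by move=> f; rewrite !inE => /orP[/eqP->//|/eqP->]; rewrite eqxx.
apply: (ext b) => // f; rewrite !inE => /orP[/eqP->|/eqP-> _]; first by rewrite eqxx.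
move: Sum cb_neq0 nz.
case: (dot_long_root aD Ea cD nca ncNa) => ->;
  case: (dot_long_short cD Ec bD Eb) => ->;
  case: (dot_long_short cD Ec xD Ex) => -> //; rewrite ?eqxx // => h; exfalso; lra.
Qed.

Section MaximalFrame.
Context (E : {fset V}).
Hypothesis frE : frame D E.
Hypothesis maxE : forall E', frame D E' -> (#|` E'| <= #|` E|)%N.

Lemma long_root_frame a e : a \in D -> B a a = 2 -> e \in E -> B a e != 0 ->
  exists f, [/\ f \in E, f != e & B a f != 0].
Proof.
move=> aD Ea eE nz; apply: contrapT => H.
have [|E' /maxE + lt] := frame_extend frE aD Ea eE nz.
  move=> f fE nfe; apply/eqP; apply/negPn/negP => nzf; apply: H.
  by exists f.
by rewrite leqNgt lt.
Qed.

Lemma long_root_pair a e : a \in D -> B a a = 2 -> e \in E -> B a e != 0 ->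
  exists f, [/\ f \in E, e != f, B a e ^+ 2 = 1, B a f ^+ 2 = 1 &
    a = B a e *: e + B a f *: f].
Proof.
move=> aD Ea eE nz; have [f [fE nfe nzf]] := long_root_frame aD Ea eE nz.
have sq g : g \in E -> B a g != 0 -> B a g ^+ 2 = 1.
  move=> /frE.1[gD Eg]; case: (dot_long_short aD Ea gD Eg) => -> //.
  - by rewrite eqxx.
  - by rewrite expr1n.
  - by rewrite sqrrN expr1n.
exists f; rewrite eq_sym nfe !sq //; split=> //.
by apply: (frame_pair_span frE) => //; rewrite 1?eq_sym // !sq // Ea.
Qed.

(** The pairing of [b] with the long root [f - e] is an integer, so [b] cannot meet
    [e] with a pairing of [± 1/2] and be orthogonal to [f]. *)
Lemma short_root_spinor b e : b \in D -> B b b = 1 -> b \notin E -> - b \notin E ->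
  e \in E -> B b e != 0 -> forall f, f \in E -> B b f ^+ 2 = 1 / 4.
Proof.
move=> bD Eb bE NbE eE nz.
have sq g : g \in E -> B b g = 0 \/ B b g ^+ 2 = 1 / 4.
  move=> gE; have [gD Eg] := frE.1 g gE; apply: dot_short_short => //.
    by apply: contraNneq bE => <-.
  by apply: contraNneq NbE => <-.
have [E0|sqe] := sq e eE; first by rewrite E0 eqxx in nz.
move=> f fE; have [->//|nfe] := eqVneq f e.
have [E0|//] := sq f fE.
have [_ _ efD] := frE.2 f e fE eE nfe.
have [eD Ee] := frE.1 e eE; have [fD Ef] := frE.1 f fE.
have Eefef : B (f - e) (f - e) = 2.
  by rewrite !dotE Ee Ef !(dot_frame frE) // (negPf nfe) eq_sym (negPf nfe) /=; ring.
exfalso; have := dot_long_short efD Eefef bD Eb.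
rewrite !dotE !(dotC B _ b) E0 add0r => -[] h; move: sqe.
- by move/eqP: h; rewrite oppr_eq0 (negPf nz).
- by rewrite -sqrrN h expr1n => h'; lra.
- by rewrite -sqrrN h sqrrN expr1n => h'; lra.
Qed.

(** Bessel's inequality bounds the number of members by [4]. Were there only three
    members, reflecting a signed sum of two of them in [b] would give a long root
    that meets the third member only, and the frame could be enlarged. *)
Lemma spinor_card b : b \in D -> B b b = 1 -> (2 < #|` E|)%N ->
  (forall f, f \in E -> B b f ^+ 2 = 1 / 4) -> #|` E| = 4%N.
Proof.
move=> bD Eb k3 sq.
have S : \sum_(e <- E) B b e ^+ 2 = (#|` E|)%:R * (1 / 4).
  rewrite -sum1_size natr_sum mulr_suml big_seq [RHS]big_seq.
  by apply: eq_bigr => e eE; rewrite sq // [RHS]mul1r.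
have := dot_ge0 B (b - proj E b); rewrite (frame_bessel frE) S Eb => le.
have {}le : (#|` E| <= 4)%N by rewrite -(ler_nat R); lra.
have [//|E3] : #|` E| = 4%N \/ #|` E| = 3%N by lia.
have [e3 e3E] : exists e3, e3 \in E.
  by apply/fset0Pn; rewrite -cardfs_gt0 E3.
have /cardfs2_pair[e1 [e2 [n12 E12]]] : #|` (E `\ e3)%fset| = 2%N.
  by move: E3; rewrite (cardfsD1 e3) e3E add1n => -[->].
have [n13 e1E] : e1 != e3 /\ e1 \in E.
  by apply/andP; rewrite -in_fsetD1 E12 !inE eqxx.
have [n23 e2E] : e2 != e3 /\ e2 \in E.
  by apply/andP; rewrite -in_fsetD1 E12 !inE eqxx orbT.
pose g := (2 * B b e1) *: e1 + (2 * B b e2) *: e2.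
have gD : g \in D.
  by apply: (frame_signed_sum frE) => //; rewrite exprMn sq //; field.
have Egb : B g b = 1.
  rewrite /g !dotE !(dotC B _ b); have := sq e1 e1E; have := sq e2 e2E; lra.
have o := dot_frame frE.
have g1 : B g e1 = 2 * B b e1.
  rewrite /g !dotE (o _ _ e1E e1E) (o _ _ e2E e1E) eqxx eq_sym (negPf n12).
  by rewrite mulr1 mulr0 addr0.
have g2 : B g e2 = 2 * B b e2.
  rewrite /g !dotE (o _ _ e1E e2E) (o _ _ e2E e2E) eqxx (negPf n12).
  by rewrite mulr1 mulr0 add0r.
have g3 : B g e3 = 0.
  rewrite /g !dotE (o _ _ e1E e3E) (o _ _ e2E e3E) (negPf n13) (negPf n23).
  by rewrite !mulr0 addr0.
have Egg : B g g = 2.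
  rewrite {2}/g dotDr !dotZr g1 g2; have := sq e1 e1E; have := sq e2 e2E; lra.
clearbody g; pose d := g - 2 *: b.
have dD : d \in D by have := short_reflection bD Eb gD; rewrite Egb mulr1.
have Ed : B d d = 2 by rewrite /d !dotE Egb (dotC B b g) Egb Egg Eb; ring.
have d3 : B d e3 != 0.
  rewrite /d !dotE g3 add0r oppr_eq0 mulf_neq0 ?pnatr_eq0 //.
  by rewrite -sqrf_eq0 sq // mul1r invr_eq0 pnatr_eq0.
have [f [fE nf3]] := long_root_frame dD Ed e3E d3.
have : f \in (E `\ e3)%fset by rewrite in_fsetD1 nf3.
rewrite E12 !inE => /orP[] /eqP ->.
  by rewrite /d !dotE g1 subrr eqxx.
by rewrite /d !dotE g2 subrr eqxx.
Qed.

Hypothesis k2 : (1 < #|` E|)%N.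
Hypothesis k3 : (2 < #|` E|)%N \/
  forall b c, b \in D -> B b b = 1 -> c \in D -> B c c = 1 -> B b c != 0 ->
    c = b \/ c = - b.

Lemma short_root_frame b e : b \in D -> B b b = 1 -> e \in E -> B b e != 0 ->
  [\/ b \in E, - b \in E |
    #|` E| = 4%N /\ forall f, f \in E -> B b f ^+ 2 = 1 / 4].
Proof.
move=> bD Eb eE nz; have [|bE] := boolP (b \in E); first by constructor 1.
have [|NbE] := boolP (- b \in E); first by constructor 2.
constructor 3; have sq := short_root_spinor bD Eb bE NbE eE nz; split=> //.
case: k3 => [lt|h]; first exact: spinor_card bD Eb lt sq.
have [eD Ee] := frE.1 e eE.
case: (h b e bD Eb eD Ee nz) => Ebe; first by rewrite -Ebe eE in bE.
by rewrite -Ebe eE in NbE.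
Qed.

Lemma root_proj_frame a e : a \in D -> e \in E -> B a e != 0 -> a = proj E a.
Proof.
move=> aD eE nz.
have projD x y u v : u = proj E u -> v = proj E v ->
    x *: u + y *: v = proj E (x *: u + y *: v).
  move=> {1}-> {1}->; rewrite /proj !scaler_sumr -big_split /=.
  by apply: eq_bigr => f _; rewrite !dotE scalerDl !scalerA.
have projE f : f \in E -> f = proj E f.
  move=> fE; apply: (frame_parseval frE).
  rewrite (big_fsetD1 f fE) /= big_seq big1 ?addr0.
    by have [_ ->] := frE.1 f fE; rewrite expr1n.
  move=> g; rewrite in_fsetD1 => /andP[ngf gE].
  by rewrite (dot_frame frE) // eq_sym (negPf ngf) expr0n.
case: (ratio2_lengths aD) => Ea.
  have [f [fE _ _ _ ->]] := long_root_pair aD Ea eE nz.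
  by apply: projD; apply: projE.
case: (short_root_frame aD Ea eE nz) => [|/projE h|[E4 sq]]; first exact: projE.
  have := projD (-1) 0 _ _ h h; rewrite scale0r addr0 scaleN1r opprK; exact.
apply: (frame_parseval frE); rewrite Ea.
have -> : \sum_(e <- E) B a e ^+ 2 = \sum_(e <- E) (1 / 4).
  by rewrite big_seq [RHS]big_seq; apply: eq_bigr => f /sq.
by rewrite big_const_seq count_predT E4 /=; field.
Qed.

(** A root that is not orthogonal to the frame lies in its span, so by irreducibility
    all roots do. *)
Lemma frame_spans v : v = proj E v.
Proof.
have [e0 e0E] : exists e0, e0 \in E by apply/fset0Pn; rewrite -cardfs_gt0 ltnW.
have [e0D Ee0] := frE.1 e0 e0E.
have projP a b : a = proj E a -> B a b != 0 -> exists2 e, e \in E & B b e != 0.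
  move=> Ea nz; apply: contrapT => H; move: nz; rewrite Ea dot_suml.
  rewrite big_seq big1 ?eqxx // => e eE; rewrite dotZl; have [E0|nz] := eqVneq (B e b) 0.
    by rewrite E0 mulr0.
  by case: H; exists e; rewrite // dotC.
have rootP : forall a, a \in D -> a = proj E a.
  apply: (irreducible_ind irrD) => [|a b aD bD Ea nz].
    exists e0 => //; apply: (root_proj_frame e0D e0E).
    by rewrite Ee0 oner_eq0.
  have [e eE nze] := projP a b Ea nz; exact: root_proj_frame bD eE nze.
move: v; apply: (root_span_ind rsD).
- by rewrite /proj big1 // => e _; rewrite dot0l scale0r.
- move=> u v Eu Ev; rewrite {1}Eu {1}Ev /proj -big_split /=.
  by apply: eq_bigr => e _; rewrite dotDl scalerDl.
- move=> k a aD; rewrite {1}(rootP a aD) /proj scaler_sumr.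
  by apply: eq_bigr => e _; rewrite dotZl scalerA.
Qed.

Lemma frame_rank : #|` E| = rank V.
Proof.
have := @casimir_trace _ _ B E 1; rewrite mul1r => h.
apply/eqP; rewrite -(eqr_nat R) -h.
  rewrite -sum1_size natr_sum; apply/eqP; rewrite big_seq [RHS]big_seq.
  by apply: eq_bigr => e /frE.1[_ ->].
move=> x; rewrite scale1r [RHS]frame_spans.
by apply: eq_bigr => e _; rewrite dotC.
Qed.

Lemma frame_meets a : a \in D -> exists2 e, e \in E & B a e != 0.
Proof.
move=> aD; apply: contrapT => H; have /eqP := root_neq0 rsD aD; apply.
rewrite [a]frame_spans /proj big_seq big1 // => e eE.
have [->|nz] := eqVneq (B a e) 0; first by rewrite scale0r.
by case: H; exists e.
Qed.

End MaximalFrame.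

(** Type B, or type F4 if there are roots as in the last alternative. *)
Definition coordinates (E : {fset V}) : Prop :=
  [/\ frame D E, forall v, v = proj E v, (1 < #|` E|)%N /\ #|` E| = rank V,
      forall a, a \in D -> B a a = 2 -> exists e f, [/\ e \in E, f \in E, e != f,
        B a e ^+ 2 = 1 /\ B a f ^+ 2 = 1 & a = B a e *: e + B a f *: f]
    & forall b, b \in D -> B b b = 1 -> [\/ b \in E, - b \in E |
        #|` E| = 4%N /\ forall f, f \in E -> B b f ^+ 2 = 1 / 4]].

Lemma coordinates_of_maximal E : frame D E ->
  (forall E', frame D E' -> (#|` E'| <= #|` E|)%N) ->
  (2 < #|` E|)%N \/ (forall b c, b \in D -> B b b = 1 -> c \in D -> B c c = 1 ->
    B b c != 0 -> c = b \/ c = - b) -> coordinates E.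
Proof.
move=> frE maxE k3; have [E2 frE2 cE2] := exists_frame2.
have k2 : (1 < #|` E|)%N by rewrite -ltnS -cE2 ltnS maxE.
split=> //.
- exact: frame_spans.
- split=> //; exact: frame_rank.
- move=> a aD Ea; have [e eE nz] := frame_meets frE maxE k2 k3 aD.
  have [f [fE nef sqe sqf Ef]] := long_root_pair frE maxE aD Ea eE nz.
  by exists e, f.
- move=> b bD Eb; have [e eE nz] := frame_meets frE maxE k2 k3 bD.
  exact: short_root_frame nz.
Qed.

End RatioTwo.

(** If two long roots of [D] enclose an angle of 60 degrees then a maximal frame has
    at least three members; otherwise no two short roots of the dual system do so,
    as happens in type C, whose dual is of type B. *)
Lemma coordinates_or_dual D : two_lengths B 2 D ->
  (exists E, coordinates D E) \/ (exists E, coordinates (langlands_roots B 2 D) E).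
Proof.
move=> tlD; have [rsD _ _ _ _] := tlD.
have [[a [c [[aD Ea] [cD Ec] [nca ncNa] nz]]]|no_long] :=
  pselect (exists a c, [/\ a \in D /\ B a a = 2, c \in D /\ B c c = 2,
    c != a /\ c != - a & B a c != 0]).
  left; have [E3 frE3 lt3] := exists_frame3 tlD aD Ea cD Ec nca ncNa nz.
  have [E frE maxE] := maximal_frame D.
  exists E; apply: coordinates_of_maximal => //; left.
  exact: leq_trans lt3 (maxE _ frE3).
right; have tlLD := langlands_two_lengths (isT : (0 < 2)%N) tlD.
have [E frE maxE] := maximal_frame (langlands_roots B 2 D).
exists E; apply: coordinates_of_maximal => //; right.
have long x : x \in D -> B (dual_root B 2 x) (dual_root B 2 x) = 1 -> B x x = 2.
  move=> xD; case: (ratio2_lengths tlD xD) => // Ex.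
  by rewrite dot_dual_root // Ex => h; exfalso; lra.
move=> _ _ /langlands_rootsP[x xD ->] Ex /langlands_rootsP[y yD ->] Ey nz.
have nzxy : B x y != 0.
  by apply: contraNneq nz => E0; rewrite dot_dual_root // E0 mulr0 mul0r.
have [->|nyx] := eqVneq y x; first by left.
have [->|nyNx] := eqVneq y (- x).
  by right; rewrite !dual_rootE !dotE opprK scalerN.
case: no_long; exists x, y; split=> //; split=> //; exact: long.
Qed.

(** * Root systems with length ratio three *)

Section RatioThree.
Context (D : {fset V}).
Hypothesis tlD : two_lengths B 3 D.

Let rsD : root_system B D. Proof. by case: tlD. Qed.
Let irrD : irreducible B D. Proof. by case: tlD. Qed.

Let long_int a b : a \in D -> B a a = 2 -> b \in D ->
  exists i : int, B b a = i%:~R.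
Proof.
move=> aD Ea bD; have := root_int rsD aD bD.
by rewrite Ea mulrAC divff ?pnatr_eq0 // mul1r => /intrP.
Qed.

Let long_reflection3 a b : a \in D -> B a a = 2 -> b \in D -> b - B b a *: a \in D.
Proof.
move=> aD Ea bD; have := root_reflection rsD aD bD.
by rewrite Ea mulrAC divff ?pnatr_eq0 // mul1r.
Qed.

Let short_reflection3 a b : a \in D -> B a a = 2 / 3 -> b \in D ->
  b - (3 * B b a) *: a \in D.
Proof.
move=> aD Ea bD; have := root_reflection rsD aD bD.
by rewrite Ea; congr (_ - _ *: _ \in D); field.
Qed.

(** [a1] and [a2] are simple roots of the subsystem of long roots, of type A2. Up to
    signs these are the roots of a system of type G2. *)
Definition hexagon a1 a2 : Prop :=
  [/\ [/\ a1 \in D, a2 \in D & a1 + a2 \in D],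
      [/\ B a1 a1 = 2, B a2 a2 = 2 & B a1 a2 = -1]
    & [/\ 3^-1 *: (a1 - a2) \in D, 3^-1 *: (2 *: a1 + a2) \in D
        & 3^-1 *: (a1 + 2 *: a2) \in D]].

Lemma exists_hexagon : exists a1 a2, hexagon a1 a2.
Proof.
have [_ _ _ [a aD Ea] [s sD Es]] := tlD.
have [b0 [b0D Eb0 nz]] := same_length_neighbour rsD irrD sD aD.
have [b [bD Eb Eab]] : exists b, [/\ b \in D, B b b = 2 / 3 & B b a = 1].
  have [i Ei] := long_int aD Ea b0D.
  have : B b0 a \is a Num.int by rewrite Ei intr_int.
  have := cauchy_schwarz B b0 a; rewrite Eb0 Es Ea => le.
  move/int_sqr_lt4; case; first by lra.
  - by move=> E; rewrite E eqxx in nz.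
  - by exists b0; rewrite Eb0.
  - by move=> E; exists (- b0); rewrite (root_opp rsD) // !dotE E !opprK Eb0.
have Eba : B a b = 1 by rewrite dotC.
have n3 : (3 : R) != 0 by rewrite pnatr_eq0.
have a2D : a - 3 *: b \in D by have := short_reflection3 bD Eb aD; rewrite Eba mulr1.
have E12 : B a (a - 3 *: b) = -1 by rewrite !dotE Ea Eba; ring.
have E22 : B (a - 3 *: b) (a - 3 *: b) = 2.
  by rewrite !dotE Ea Eba Eab Eb; field.
have E0 : 3^-1 *: (a - (a - 3 *: b)) = b.
  by rewrite opprB addrCA subrr addr0 scalerA mulVf // scale1r.
exists a, (a - 3 *: b); split; split=> //.
- have := long_reflection3 aD Ea a2D; rewrite dotC E12 scaleN1r opprK.
  by rewrite addrC.
- by rewrite E0.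
- have := root_opp rsD (long_reflection3 aD Ea bD); rewrite Eab.
  by congr (_ \in D); apply: (dot_ext (B := B)) => w; rewrite !dotE; field.
- have Eb2 : B b (a - 3 *: b) = -1 by rewrite !dotE Eab Eb; field.
  have := long_reflection3 a2D E22 bD; rewrite Eb2.
  by congr (_ \in D); apply: (dot_ext (B := B)) => w; rewrite !dotE; field.
Qed.

Section Plane.
Context (a1 a2 : V).
Hypothesis hex : hexagon a1 a2.

(** A root outside the plane would have pairings [i] and [j] with [a1] and [a2] for
    which the Cauchy-Schwarz inequality against the twelve roots of the hexagon and
    the integrality of the Cartan numbers leave only [i = j = 0]. *)
Lemma hexagon_coordinates g : g \in D -> B g a1 != 0 \/ B g a2 != 0 ->
  exists x y, g = x *: a1 + y *: a2.
Proof.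
move=> gD nz; apply: contrapT => out.
have [[D1 D2 D12] [E11 E22 E12] [S0 S1 S2]] := hex.
have E21 : B a2 a1 = -1 by rewrite dotC.
have inspan (x y : R) : g != x *: a1 + y *: a2.
  by apply/eqP => E; apply: out; exists x, y.
have inspanN (x y : R) : g != - (x *: a1 + y *: a2).
  by rewrite opprD -!scaleNr.
have [i Ei] := long_int D1 E11 gD; have [j Ej] := long_int D2 E22 gD.
have Q0 : B (3^-1 *: (a1 - a2)) (3^-1 *: (a1 - a2)) = 2 / 3.
  by rewrite !dotE E11 E22 E12 E21; field.
have Q1 : B (3^-1 *: (2 *: a1 + a2)) (3^-1 *: (2 *: a1 + a2)) = 2 / 3.
  by rewrite !dotE E11 E22 E12 E21; field.
have Q2 : B (3^-1 *: (a1 + 2 *: a2)) (3^-1 *: (a1 + 2 *: a2)) = 2 / 3.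
  by rewrite !dotE E11 E22 E12 E21; field.
have F0 : 3^-1 *: (a1 - a2) = 3^-1 *: a1 + (- 3^-1) *: a2 by rewrite scalerBr scaleNr.
have F1 : 3^-1 *: (2 *: a1 + a2) = (3^-1 * 2) *: a1 + 3^-1 *: a2.
  by rewrite scalerDr scalerA.
have F2 : 3^-1 *: (a1 + 2 *: a2) = 3^-1 *: a1 + (3^-1 * 2) *: a2.
  by rewrite scalerDr scalerA.
have F12 : a1 + a2 = 1 *: a1 + 1 *: a2 by rewrite !scale1r.
have G1 : a1 = 1 *: a1 + 0 *: a2 by rewrite scale1r scale0r addr0.
have G2 : a2 = 0 *: a1 + 1 *: a2 by rewrite scale1r scale0r add0r.
have ij0 : i = 0 /\ j = 0; last first.
  by case: ij0 nz => i0 j0; rewrite Ei Ej i0 j0 eqxx; case.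
have CS c : c \in D -> g != c -> g != - c -> B g c ^+ 2 < B c c * B g g.
  by move=> cD n1 n2; rewrite dotC; apply: (root_cauchy_schwarz rsD).
have toint (k m : int) : k%:~R ^+ 2 < m%:~R :> R -> k ^+ 2 < m.
  by rewrite -rmorphXn /= ltr_int.
have H0 : 3 * B g (3^-1 *: (a1 - a2)) = (i - j)%:~R.
  by rewrite !dotE Ei Ej rmorphB /=; field.
have H1 : 3 * B g (3^-1 *: (2 *: a1 + a2)) = (2 * i + j)%:~R.
  by rewrite !dotE Ei Ej rmorphD rmorphM /=; field.
have H2 : 3 * B g (3^-1 *: (a1 + 2 *: a2)) = (i + 2 * j)%:~R.
  by rewrite !dotE Ei Ej rmorphD rmorphM /=; field.
have [_ _ len _ _] := tlD.
have in3 (c : V) (x y : R) : c = x *: a1 + y *: a2 -> g != c /\ g != - c.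
  by move=> ->; split; [exact: inspan|exact: inspanN].
have C c (x y : R) : c \in D -> c = x *: a1 + y *: a2 -> B g c ^+ 2 < B c c * B g g.
  by move=> cD /in3[n1 n2]; exact: CS.
have C0 := C _ _ _ S0 F0; have C1 := C _ _ _ S1 F1; have C2 := C _ _ _ S2 F2.
have L1 := C _ _ _ D1 G1; have L2 := C _ _ _ D2 G2; have L12 := C _ _ _ D12 F12.
rewrite Q0 in C0; rewrite Q1 in C1; rewrite Q2 in C2.
rewrite E11 Ei in L1; rewrite E22 Ej in L2.
have E1212 : B (a1 + a2) (a1 + a2) = 2 by rewrite !dotE E11 E22 E12 E21; ring.
rewrite E1212 dotDr Ei Ej -intrD in L12.
case: (len g gD) => Eg; rewrite Eg in C0 C1 C2 L1 L2 L12.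
  have {}L1 : i ^+ 2 < 4 by apply: toint; lra.
  have {}L2 : j ^+ 2 < 4 by apply: toint; lra.
  have {}L12 : (i + j) ^+ 2 < 4 by apply: toint; lra.
  have [m Em] := long_int gD Eg S0.
  have m3 : i - j = 3 * m.
    by apply: (@intr_inj R); rewrite -H0 dotC Em rmorphM.
  have := abs_lt2 L1; have := abs_lt2 L2; have := abs_lt2 L12.
  by clear -m3; lia.
have {}C0 : (i - j) ^+ 2 < 4 by apply: toint; rewrite -H0 exprMn; lra.
have {}C1 : (2 * i + j) ^+ 2 < 4 by apply: toint; rewrite -H1 exprMn; lra.
have {}C2 : (i + 2 * j) ^+ 2 < 4 by apply: toint; rewrite -H2 exprMn; lra.
have := abs_lt2 C0; have := abs_lt2 C1; have := abs_lt2 C2.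
by clear; lia.
Qed.

Lemma hexagon_spans v : exists x y, v = x *: a1 + y *: a2.
Proof.
have [[D1 D2 _] [E11 E22 E12] _] := hex.
have rootP : forall g, g \in D -> exists x y, g = x *: a1 + y *: a2.
  apply: (irreducible_ind irrD) => [|g c gD cD [x [y Eg]] nz].
    by exists a1 => //; exists 1, 0; rewrite scale1r scale0r addr0.
  apply: hexagon_coordinates => //.
  have [E1|] := eqVneq (B c a1) 0; last by left.
  have [E2|] := eqVneq (B c a2) 0; last by right.
  by move: nz; rewrite Eg !dotE !(dotC B _ c) E1 E2 !mulr0 addr0 eqxx.
move: v; apply: (root_span_ind rsD).
- by exists 0, 0; rewrite !scale0r addr0.
- move=> _ _ [x [y ->]] [x' [y' ->]]; exists (x + x'), (y + y').
  by rewrite !scalerDl addrACA.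
- move=> k a /rootP[x [y ->]]; exists (k * x), (k * y).
  by rewrite scalerDr !scalerA.
Qed.

Lemma hexagon_rank : rank V = 2%N.
Proof.
have [_ [E11 E22 E12] _] := hex; have E21 : B a2 a1 = -1 by rewrite dotC.
have fr : free [:: a1; a2].
  apply/freeP => k; rewrite !big_ord_recl big_ord0 addr0 /= => E.
  have := congr1 (B a1) E; have := congr1 (B a2) E.
  rewrite !dotE E11 E22 E12 E21 => h1 h2 i.
  have k0 : k ord0 = 0 by lra.
  have k1 : k (lift ord0 ord0) = 0 by lra.
  by case: (unliftP ord0 i) => [l ->|->//]; rewrite (ord1 l).
have sp : <<[:: a1; a2]>>%VS = fullv.
  apply/vspaceP => v; rewrite memvf; have [x [y ->]] := hexagon_spans v.
  by apply: memvD; apply: memvZ; apply: memv_span; rewrite !inE eqxx ?orbT.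
by rewrite /rank -sp; apply/eqP; rewrite /free in fr; exact: fr.
Qed.

End Plane.
End RatioThree.

End Classification.

(** * Phases *)

Section Phases.
Context {R : realType}.
Implicit Types x y : R.

Lemma int_add x y : x \is a Num.int -> y \is a Num.int -> x + y \is a Num.int.
Proof. exact: rpredD. Qed.
Lemma int_sub x y : x \is a Num.int -> y \is a Num.int -> x - y \is a Num.int.
Proof. exact: rpredB. Qed.
Lemma int_mul x y : x \is a Num.int -> y \is a Num.int -> x * y \is a Num.int.
Proof. exact: rpredM. Qed.

Lemma int_opp x : x \is a Num.int -> - x \is a Num.int.
Proof. by rewrite rpredN. Qed.

Lemma expi0 : expi (0 : R) = 1.
Proof. by rewrite /expi cos0 sin0. Qed.

Lemma expiD x y : expi (x + y) = expi x * expi y.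
Proof.
rewrite /expi cosD sinD; apply/eqP; rewrite eq_complex /=.
by rewrite !eqxx /= addrC eqxx.
Qed.

Lemma expi_pi : expi (pi : R) = -1.
Proof. by rewrite /expi cospi sinpi; apply/eqP; rewrite eq_complex /= oppr0 !eqxx. Qed.

Lemma conj_expi x : (expi x)^* * expi x = 1.
Proof.
rewrite /expi /=; apply/eqP; rewrite eq_complex /=.
have := cos2Dsin2 x; rewrite !expr2 => E.
by apply/andP; split; apply/eqP; rewrite -?E; ring.
Qed.

Lemma expi_2pi_nat (m : nat) : expi (2 * pi * m%:R : R) = 1.
Proof.
elim: m => [|m IH]; first by rewrite mulr0 expi0.
rewrite -[m.+1%:R]natr1 mulrDr mulr1 expiD IH mul1r -[2]natr1 mulrDl mul1r expiD.
by rewrite !expi_pi mulrN1 opprK.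
Qed.

Lemma expi_2pi_int x : x \is a Num.int -> expi (2 * pi * x) = 1.
Proof.
rewrite intrE => /orP[/natrP[m ->]|/natrP[m Em]]; first exact: expi_2pi_nat.
have := expi_2pi_nat m; rewrite -Em => E.
by rewrite -[LHS]mulr1 -{1}E -expiD mulrN subrr expi0.
Qed.

Lemma expi_even x : x / 2 \is a Num.int -> expi (pi * x) = 1.
Proof.
by move/expi_2pi_int => <-; congr expi; field.
Qed.

Lemma expi_congr x y : (x - y) / 2 \is a Num.int -> expi (pi * x) = expi (pi * y).
Proof.
by move/expi_even => E; rewrite -[RHS]mul1r -E -expiD -mulrDr subrK.
Qed.

Lemma half_or x : 2 * x \is a Num.int ->
  x \is a Num.int \/ x - 1 / 2 \is a Num.int.
Proof.
move=> /intrP[m Em]; have Ex : x = m%:~R / 2 by rewrite -Em; field.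
have [j [Ej|Ej]] : exists j, m = 2 * j \/ m = 2 * j + 1.
  by exists (m %/ 2)%Z; lia.
  left; suff -> : x = j%:~R by exact: intr_int.
  by rewrite Ex Ej rmorphM /=; field.
right; suff -> : x - 1 / 2 = j%:~R by exact: intr_int.
by rewrite Ex Ej rmorphD rmorphM /=; field.
Qed.

Lemma half_shift x : x - 1 / 2 \is a Num.int -> (x \is a Num.int) = false.
Proof.
move=> h; apply/negP => xi; have := rpredB xi h; rewrite subKr => /int_sqr_lt1 E.
have lt : (1 / 2 : R) ^+ 2 < 1 by rewrite expr2; lra.
by have := E lt; lra.
Qed.

Lemma expi_odd x : x \is a Num.int -> x / 2 \isn't a Num.int -> expi (pi * x) = -1.
Proof.
move=> xi nx; have [||h] := @half_or (x / 2); rewrite ?(negPf nx) //.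
  by rewrite mulrC divfK ?pnatr_eq0.
rewrite (@expi_congr _ 1); first by rewrite mulr1 expi_pi.
by rewrite mulrBl.
Qed.

(** Half-integers fall into two classes modulo the integers. *)
Lemma half_int_diff x y : 2 * x \is a Num.int -> 2 * y \is a Num.int ->
  (x - y \is a Num.int) = ((x \is a Num.int) == (y \is a Num.int)).
Proof.
move=> /half_or[xi|hx] /half_or[yi|hy].
- by rewrite rpredB // xi yi.
- rewrite xi (half_shift hy) /=; apply/negP => h.
  by have := rpredB xi h; rewrite subKr (half_shift hy).
- rewrite yi (half_shift hx) /=; apply/negP => h.
  by have := rpredD h yi; rewrite subrK (half_shift hx).
- rewrite (half_shift hx) (half_shift hy) eqxx.
  by have := rpredB hx hy; rewrite opprB addrA subrK.
Qed.

End Phases.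

(** * Lattices and the center *)

Section Lattices.
Context {R : realType} {V : vectType R} (B : {dot V for @idfun R}).
Implicit Types (D : {fset V}) (a b u v w : V).

Lemma zspan_gen D a : a \in D -> zspan D a.
Proof.
move=> aD; exists (fun b => (b == a)%:Z); rewrite (big_fsetD1 a aD) /= eqxx mulr1z.
rewrite big_seq big1 ?addr0 // => b; rewrite in_fsetD1 => /andP[/negPf-> _].
by rewrite mulr0z.
Qed.

Lemma zspan_sub D v w : zspan D v -> zspan D w -> zspan D (v - w).
Proof.
move=> [c ->] [d ->]; exists (fun a => c a - d a); rewrite -sumrB.
by apply: eq_bigr => a _; rewrite mulrzBr.
Qed.

Lemma zspan0 D : zspan D 0.
Proof. by exists (fun=> 0); rewrite big1. Qed.

Lemma zspan_opp D v : zspan D v -> zspan D (- v).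
Proof. by move=> h; rewrite -sub0r; apply: zspan_sub => //; exact: zspan0. Qed.

Lemma zspan_add D v w : zspan D v -> zspan D w -> zspan D (v + w).
Proof. by move=> hv hw; rewrite -[w]opprK; apply: zspan_sub => //; exact: zspan_opp. Qed.

Lemma zspan_scale D k v : k \is a Num.int -> zspan D v -> zspan D (k *: v).
Proof.
move=> /intrP[m ->] [c ->]; exists (fun a => c a * m); rewrite scaler_sumr.
by apply: eq_bigr => a _; rewrite scaler_int mulrzA.
Qed.

Lemma zspan_sum D I (r : seq I) (P : pred I) (F : I -> V) :
  (forall i, P i -> zspan D (F i)) -> zspan D (\sum_(i <- r | P i) F i).
Proof.
move=> h; elim/big_ind: _ => //; first exact: zspan0.
by move=> x y; exact: zspan_add.
Qed.

Lemma zspan_ind D (P : V -> Prop) : P 0 -> (forall v w, P v -> P w -> P (v - w)) ->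
  (forall a, a \in D -> P a) -> forall v, zspan D v -> P v.
Proof.
move=> P0 PB PG _ [c ->].
have PN v : P v -> P (- v) by move=> h; rewrite -sub0r; exact: PB.
have PD v w : P v -> P w -> P (v + w).
  by move=> hv hw; rewrite -[w]opprK; apply: PB => //; exact: PN.
have Pn v m : P v -> P (v *+ m).
  by move=> h; elim: m => [|m IH]; rewrite ?mulr0n // mulrS; exact: PD.
rewrite big_seq; elim/big_ind: _ => // a aD.
case: (c a) => m; first by rewrite -pmulrn; apply: Pn; exact: PG.
by rewrite NegzE mulrNz; apply: PN; rewrite -pmulrn; apply: Pn; exact: PG.
Qed.

Lemma coweightP D u :
  coweight_lattice B D u <-> forall a, a \in D -> B u a \is a Num.int.
Proof.
split=> [h a aD|h w]; first by apply: h; exact: zspan_gen.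
apply: (zspan_ind (P := fun w => B u w \is a Num.int)) => //; first by rewrite dot0r.
by move=> v {}w hv hw; rewrite dotDr dotNr int_sub.
Qed.

Lemma coroot_lattice_gen D a : a \in D -> coroot_lattice B D (coroot B a).
Proof. by move=> aD; apply: zspan_gen; apply/imfsetP; exists a. Qed.

Lemma coroot_lattice_ind D (P : V -> Prop) : P 0 ->
  (forall v w, P v -> P w -> P (v - w)) ->
  (forall a, a \in D -> P (coroot B a)) -> forall v, coroot_lattice B D v -> P v.
Proof.
move=> P0 PB PG; apply: (zspan_ind (P := P)) => // _ /imfsetP[a aD ->]; exact: PG.
Qed.

Lemma coroot_lattice_coweight D v : root_system B D ->
  coroot_lattice B D v -> coweight_lattice B D v.
Proof.
case=> _ _ _ ints _; apply: (coroot_lattice_ind (P := coweight_lattice B D)).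
- by apply/coweightP => a aD; rewrite dot0l.
- move=> {}v w /coweightP hv /coweightP hw; apply/coweightP => a aD.
  by rewrite dotDl dotNl int_sub ?hv ?hw.
- by move=> a aD; apply/coweightP => b bD; rewrite dotC; exact: ints.
Qed.

Lemma coweight_sub D u v :
  coweight_lattice B D u -> coweight_lattice B D v -> coweight_lattice B D (u - v).
Proof.
move=> /coweightP hu /coweightP hv; apply/coweightP => a aD.
by rewrite dotDl dotNl int_sub ?hu ?hv.
Qed.

Lemma coweight_add D u v :
  coweight_lattice B D u -> coweight_lattice B D v -> coweight_lattice B D (u + v).
Proof.
move=> /coweightP hu /coweightP hv; apply/coweightP => a aD.
by rewrite dotDl int_add ?hu ?hv.
Qed.

Section Dual.
Context (n : nat) (D : {fset V}).
Hypothesis n0 : (0 < n)%N.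
Hypothesis rsD : root_system B D.
Local Notation LD := (langlands_roots B n D).
Local Notation sn := (Num.sqrt n%:R).

Let sn0 : sn != 0 :> R. Proof. by rewrite gt_eqF // sqrtr_gt0 ltr0n. Qed.

Lemma langlands_coweightP w : coweight_lattice B LD (sn *: w) <->
  forall a, a \in D -> B w (coroot B a) \is a Num.int.
Proof.
have E a : B (sn *: w) (dual_root B n a) = B w (coroot B a).
  by rewrite /dual_root dotZl dotZr mulrA divff // mul1r.
split=> [/coweightP h a aD|h]; first by rewrite -E h //; apply/langlands_rootsP; exists a.
by apply/coweightP => _ /langlands_rootsP[a aD ->]; rewrite E h.
Qed.

Lemma langlands_coroot_lattice w : coroot_lattice B LD (sn *: w) <-> root_lattice D w.
Proof.
have EC a : a \in D -> coroot B (dual_root B n a) = sn *: a.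
  by move=> aD; rewrite coroot_dual_root // (root_neq0 rsD).
split.
  have -> : w = sn^-1 *: (sn *: w) by rewrite scalerA mulVf // scale1r.
  rewrite (scalerA sn) divff // scale1r.
  apply: (coroot_lattice_ind (P := fun v => root_lattice D (sn^-1 *: v))).
  - by rewrite scaler0; exact: zspan0.
  - by move=> u v hu hv; rewrite scalerBr; exact: zspan_sub.
  - move=> _ /langlands_rootsP[a aD ->]; rewrite EC // scalerA mulVf // scale1r.
    exact: zspan_gen.
apply: (zspan_ind (P := fun w => coroot_lattice B LD (sn *: w))).
- by rewrite scaler0; exact: zspan0.
- by move=> u v hu hv; rewrite scalerBr; exact: zspan_sub.
- move=> a aD; rewrite -EC //; apply: coroot_lattice_gen.
  by apply/langlands_rootsP; exists a.
Qed.

Lemma langlands_coweight_exists mu : exists w, mu = sn *: w.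
Proof. by exists (sn^-1 *: mu); rewrite scalerA divff // scale1r. Qed.

Lemma phase_S_scaled w u : phase_S B n (sn *: w) u = expi (2 * pi * - B w u).
Proof. by rewrite /phase_S dotZl; congr expi; field. Qed.

End Dual.

(** The classes modulo the coroot lattice of the coweights of a dual pair of root
    systems are told apart by booleans [k1] and [k2], on which all phases depend:
    the centers are subgroups of [bool]. *)
Definition center_data (n : nat) (D1 D2 : {fset V}) (k1 k2 : V -> bool)
    (p q : R[i]) : Prop :=
  let W1 := coweight_lattice B D1 in let W2 := coweight_lattice B D2 in
  [/\ forall u v, W1 u -> W1 v -> coroot_lattice B D1 (u - v) <-> k1 u = k1 v,
      forall u v, W2 u -> W2 v -> coroot_lattice B D2 (u - v) <-> k2 u = k2 v,
      forall u, W1 u -> expi (pi * B u u) = if k1 u then p else 1,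
      forall u, W2 u -> expi (pi * B u u) = if k2 u then q else 1
    & forall u v, W1 u -> W2 v ->
        phase_S B n v u = if k1 u && k2 v then -1 else 1].

Lemma center_data_sym n D1 D2 k1 k2 p q :
  center_data n D1 D2 k1 k2 p q -> center_data n D2 D1 k2 k1 q p.
Proof.
case=> h1 h2 h3 h4 h5; split=> // u v hu hv.
by rewrite andbC -h5 // /phase_S dotC.
Qed.

Section TypeBF.
Context (D E : {fset V}).
Hypothesis tlD : two_lengths B 2 D.
Hypothesis coE : coordinates B D E.
Local Notation LD := (langlands_roots B 2 D).
Local Notation s2 := (Num.sqrt 2%:R).

Let rsD : root_system B D. Proof. by case: tlD. Qed.
Let frE : frame B D E. Proof. by case: coE. Qed.
Let ED e : e \in E -> e \in D. Proof. by case/frE.1. Qed.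

Let dot_coord u v : B u v = \sum_(e <- E) B u e * B v e.
Proof.
have [_ h _ _ _] := coE; rewrite {1}(h v) dot_sumr.
by apply: eq_bigr => e _; rewrite dotZr mulrC.
Qed.

Let sum_int (F : V -> R) : (forall e, e \in E -> F e \is a Num.int) ->
  \sum_(e <- E) F e \is a Num.int.
Proof. by move=> h; rewrite big_seq rpred_sum. Qed.

Let e0_exists : exists e, e \in E.
Proof. by apply/fset0Pn; rewrite -cardfs_gt0; case: coE => _ _ [h _] _ _; exact: ltnW h. Qed.

Let integral v := forall e, e \in E -> B v e \is a Num.int.
Let coord_sum v := \sum_(e <- E) B v e.

Let coord_sumB u v : coord_sum (u - v) = coord_sum u - coord_sum v.
Proof. by rewrite -sumrB; apply: eq_bigr => e _; rewrite dotDl dotNl. Qed.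

Let coroot_short a : B a a = 1 -> coroot B a = 2 *: a.
Proof. by rewrite /coroot => ->; rewrite divr1. Qed.

Let coroot_long a : B a a = 2 -> coroot B a = a.
Proof. by rewrite /coroot => ->; rewrite divff ?pnatr_eq0 // scale1r. Qed.

Let pair_long e f : e \in E -> f \in E -> e != f ->
  [/\ e + f \in D, e - f \in D, B (e + f) (e + f) = 2 & B (e - f) (e - f) = 2].
Proof.
move=> eE fE nef; have [Eef pD mD] := frE.2 e f eE fE nef.
have [_ Ee] := frE.1 e eE; have [_ Ef] := frE.1 f fE.
have Efe : B f e = 0 by rewrite dotC.
by split=> //; rewrite !dotE Ee Ef Eef Efe; ring.
Qed.

Lemma root_lattice_of_integral v : integral v -> root_lattice D v.
Proof.
move=> hv; have [_ pr _ _ _] := coE; rewrite (pr v) /proj big_seq.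
apply: zspan_sum => e eE; apply: zspan_scale; first exact: hv.
exact/zspan_gen/ED.
Qed.

Lemma coroot_lattice_of_even v : integral v -> coord_sum v / 2 \is a Num.int ->
  coroot_lattice B D v.
Proof.
move=> hv even; have [e0 e0E] := e0_exists.
have -> : v = \sum_(e <- E) B v e *: (e - e0) + (coord_sum v / 2) *: (2 *: e0).
  have [_ pr _ _ _] := coE; rewrite scalerA divfK ?pnatr_eq0 // scaler_suml.
  rewrite -big_split /= {1}(pr v); apply: eq_bigr => e _.
  by rewrite -scalerDr subrK.
apply: zspan_add; last first.
  apply: zspan_scale => //; have [_ Ee0] := frE.1 e0 e0E.
  by rewrite -coroot_short //; exact/coroot_lattice_gen/ED.
rewrite big_seq; apply: zspan_sum => e eE; apply: zspan_scale; first exact: hv.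
have [->|ne] := eqVneq e e0; first by rewrite subrr; exact: zspan0.
have [_ mD _ Em] := pair_long eE e0E ne.
by rewrite -(coroot_long Em); exact: coroot_lattice_gen.
Qed.

Lemma coweight_integral u : coweight_lattice B D u -> integral u.
Proof. by move=> /coweightP h e eE; apply: h; exact: ED. Qed.

(** The squares of the coordinates have the same parities as the coordinates. *)
Lemma norm_phase u : integral u -> expi (pi * B u u) = expi (pi * coord_sum u).
Proof.
move=> hu; apply: expi_congr; rewrite dot_coord -sumrB mulr_suml.
apply: sum_int => e /hu /intrP[m ->].
have [j Ej] : exists j, m * m - m = 2 * j.
  have [k [->|->]] : exists k, m = 2 * k \/ m = 2 * k + 1.
    by exists (m %/ 2)%Z; lia.
    by exists (2 * k * k - k); ring.
  by exists (2 * k * k + k); ring.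
suff -> : (m%:~R * m%:~R - m%:~R) / 2 = j%:~R :> R by exact: intr_int.
by rewrite -rmorphM -rmorphB /= Ej rmorphM /=; field.
Qed.

Lemma coweight_even_phase u : integral u -> coord_sum u / 2 \is a Num.int ->
  expi (pi * B u u) = 1.
Proof. by move=> hu even; rewrite norm_phase // expi_even. Qed.

(** Integrality on the coroots [2 e] of short roots and on the long roots [e - f]. *)
Lemma langlands_coweight_half w : coweight_lattice B LD (s2 *: w) ->
  (forall e, e \in E -> 2 * B w e \is a Num.int) /\
  (forall e f, e \in E -> f \in E -> B w e - B w f \is a Num.int).
Proof.
move=> /(langlands_coweightP D (isT : (0 < 2)%N)) h; split=> [e eE|e f eE fE].
  have [eD Ee] := frE.1 e eE.
  by have := h e eD; rewrite coroot_short // dotZr.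
have [->|nef] := eqVneq e f; first by rewrite subrr.
have [_ mD _ Em] := pair_long eE fE nef.
by have := h _ mD; rewrite coroot_long // dotDr dotNr.
Qed.

Lemma langlands_coweight_cases w : coweight_lattice B LD (s2 *: w) ->
  integral w \/ forall e, e \in E -> B w e - 1 / 2 \is a Num.int.
Proof.
move=> /langlands_coweight_half[h1 h2]; have [e0 e0E] := e0_exists.
case: (half_or (h1 e0 e0E)) => h; [left|right] => e eE.
  by have := int_add (h2 e e0 eE e0E) h; rewrite subrK.
by have := int_add (h2 e e0 eE e0E) h; rewrite addrA subrK.
Qed.

Let dot_scaled w : B (s2 *: w) (s2 *: w) = 2 * B w w.
Proof. by rewrite dotZl dotZr mulrA -expr2 sqr_sqrtr // ler0n. Qed.

Let dot_int u w : integral u -> integral w -> B u w \is a Num.int.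
Proof.
by move=> hu hw; rewrite dot_coord; apply: sum_int => e eE; rewrite int_mul ?hu ?hw.
Qed.

Lemma dual_norm_phase w : integral w -> expi (pi * B (s2 *: w) (s2 *: w)) = 1.
Proof.
move=> hw; rewrite dot_scaled; apply: expi_even.
by rewrite mulrC mulrA mulVf ?pnatr_eq0 // mul1r; exact: dot_int.
Qed.

(** Each of the [r] coordinates of [w] contributes [1 / 2] modulo [2] to [2 (w | w)],
    since [(m + 1 / 2) ^ 2 - 1 / 4 = m (m + 1)]. *)
Lemma dual_norm_phase_half w : (forall e, e \in E -> B w e - 1 / 2 \is a Num.int) ->
  expi (pi * B (s2 *: w) (s2 *: w)) = expi (pi * ((rank V)%:R / 2)).
Proof.
move=> hw; rewrite dot_scaled; apply: expi_congr; have [_ _ [_ <-] _ _] := coE.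
have -> : (2 * B w w - (#|` E|)%:R / 2) / 2 = \sum_(e <- E) (B w e ^+ 2 - 1 / 4).
  rewrite sumrB big_const_seq count_predT dot_coord.
  have -> : iter (size E) (+%R (1 / 4)) 0 = (#|` E|)%:R / 4 :> R.
    by elim: (size E) => [|m IH] /=; rewrite ?mul0r // IH -natr1; field.
  under [in RHS]eq_bigr do rewrite expr2.
  by field.
apply: sum_int => e /hw h.
have -> : B w e ^+ 2 - 1 / 4 = (B w e - 1 / 2) * (B w e - 1 / 2 + 1) by field.
by apply: int_mul => //; apply: int_add => //; exact: int_num1.
Qed.

Let phase_S2 w u : phase_S B 2 (s2 *: w) u = expi (2 * pi * - B w u).
Proof. exact: phase_S_scaled. Qed.

Lemma pairing_phase w u : integral w -> integral u -> phase_S B 2 (s2 *: w) u = 1.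
Proof. by move=> hw hu; rewrite phase_S2 expi_2pi_int // int_opp ?dot_int. Qed.

Lemma pairing_phase_half w u : (forall e, e \in E -> B w e - 1 / 2 \is a Num.int) ->
  integral u -> phase_S B 2 (s2 *: w) u = expi (pi * coord_sum u).
Proof.
move=> hw hu; rewrite phase_S2 (_ : 2 * pi * - B w u = pi * (- 2 * B w u)); last by ring.
apply: expi_congr; rewrite dot_coord.
have -> : (- 2 * (\sum_(e <- E) B w e * B u e) - coord_sum u) / 2
    = - \sum_(e <- E) (B w e - 1 / 2 + 1) * B u e.
  have -> : \sum_(e <- E) (B w e - 1 / 2 + 1) * B u e
      = \sum_(e <- E) B w e * B u e + 1 / 2 * coord_sum u.
    by rewrite mulr_sumr -big_split /=; apply: eq_bigr => e _; field.
  by field.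
apply: int_opp; apply: sum_int => e eE.
by apply: int_mul; [apply: int_add; [exact: hw|exact: int_num1]|exact: hu].
Qed.

Let coord_sumZ k u : coord_sum (k *: u) = k * coord_sum u.
Proof. by rewrite mulr_sumr; apply: eq_bigr => e _; rewrite dotZl. Qed.

Let coord_sumN u : coord_sum (- u) = - coord_sum u.
Proof. by rewrite -scaleN1r coord_sumZ mulN1r. Qed.

Let coord_sumD u v : coord_sum (u + v) = coord_sum u + coord_sum v.
Proof. by rewrite -{1}[v]opprK coord_sumB coord_sumN opprK. Qed.

Let coord_sum_frame e : e \in E -> coord_sum e = 1.
Proof.
move=> eE; rewrite /coord_sum (big_fsetD1 e eE) /= (dot_frame frE) // eqxx.
rewrite big_seq big1 ?addr0 // => f; rewrite in_fsetD1 => /andP[nf fE].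
by rewrite (dot_frame frE) // eq_sym (negPf nf).
Qed.

Let coord_sum_int u : integral u -> coord_sum u \is a Num.int.
Proof. exact: sum_int. Qed.

Section NoSpinor.
Hypothesis noSp : forall b, b \in D -> B b b = 1 -> b \in E \/ - b \in E.

Let integral_frame e : e \in E -> integral e.
Proof. by move=> eE f fE; rewrite (dot_frame frE). Qed.

Let integral_comb x y u v : x \is a Num.int -> y \is a Num.int ->
  integral u -> integral v -> integral (x *: u + y *: v).
Proof. by move=> xi yi hu hv e eE; rewrite !dotE int_add // int_mul ?hu ?hv. Qed.

Let sign_int (x : R) : x ^+ 2 = 1 -> x = 1 \/ x = -1.
Proof. by move/eqP; rewrite sqrf_eq1 => /orP[] /eqP; [left|right]. Qed.

Let sign_in_int (x : R) : x ^+ 2 = 1 -> x \is a Num.int.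
Proof. by case/sign_int => ->; [|apply: int_opp]; exact: int_num1. Qed.

Let root_integral a : a \in D -> integral a.
Proof.
move=> aD; case: (ratio2_lengths tlD aD) => Ea.
  have [_ _ _ lr _] := coE; have [e [f [eE fE _ [sx sy] ->]]] := lr a aD Ea.
  by apply: integral_comb; [exact: sign_in_int|exact: sign_in_int|
    exact: integral_frame|exact: integral_frame].
case: (noSp aD Ea) => h; first exact: integral_frame.
by move=> e eE; rewrite -[a]opprK dotNl; apply: int_opp; exact: (integral_frame h).
Qed.

Lemma coroot_lattice_even v : coroot_lattice B D v -> coord_sum v / 2 \is a Num.int.
Proof.
apply: (coroot_lattice_ind (P := fun v => coord_sum v / 2 \is a Num.int)).
- by rewrite -(subrr 0) coord_sumB subrr mul0r int_num0.
- by move=> u w hu hw; rewrite coord_sumB mulrBl int_sub.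
move=> a aD; case: (ratio2_lengths tlD aD) => Ea.
  have [_ _ _ lr _] := coE; have [e [f [eE fE _ [sx sy] Eq]]] := lr a aD Ea.
  rewrite coroot_long // Eq coord_sumD !coord_sumZ !coord_sum_frame // !mulr1.
  case: (sign_int sx) => ->; case: (sign_int sy) => ->.
  - have -> : (1 + 1) / 2 = 1 :> R by field.
    exact: int_num1.
  - by rewrite subrr mul0r int_num0.
  - by rewrite addNr mul0r int_num0.
  - have -> : (-1 - 1) / 2 = -1 :> R by field.
    exact: (int_opp (int_num1 _)).
rewrite coroot_short // coord_sumZ mulrAC divff ?pnatr_eq0 // mul1r.
by apply: coord_sum_int; exact: root_integral.
Qed.

Lemma integral_of_root_lattice v : root_lattice D v -> integral v.
Proof.
apply: (zspan_ind (P := integral)) => [e _|u w hu hw e eE|]; last exact: root_integral.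
  by rewrite dot0l.
by rewrite dotDl dotNl int_sub ?hu ?hw.
Qed.

(** Type B: the nontrivial classes are represented by a short root [e] and by
    [sqrt 2] times half the sum of the frame, of square lengths [1] and [r / 2]. *)
Lemma center_data_B : exists k1 k2,
  [/\ center_data 2 D LD k1 k2 (-1) (expi (pi * ((rank V)%:R / 2))),
      exists2 u, coweight_lattice B D u & k1 u
    & exists2 u, coweight_lattice B LD u & k2 u].
Proof.
have [e0 e0E] := e0_exists.
pose k1 u := coord_sum u / 2 \isn't a Num.int.
pose k2 v := B (s2^-1 *: v) e0 \isn't a Num.int.
have s20 : s2 != 0 :> R by rewrite gt_eqF // sqrtr_gt0 ltr0n.
have Ek2 w : k2 (s2 *: w) = (B w e0 \isn't a Num.int).
  by rewrite /k2 scalerA mulVf // scale1r.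
have half2 u : integral u -> 2 * (coord_sum u / 2) \is a Num.int.
  by move=> hu; rewrite mulrC divfK ?pnatr_eq0 // coord_sum_int.
have k2F w : coweight_lattice B LD (s2 *: w) -> k2 (s2 *: w) = false -> integral w.
  move=> h; rewrite Ek2 => /negbFE i0 e eE.
  have [_ h2] := langlands_coweight_half h.
  by have := int_add (h2 e e0 eE e0E) i0; rewrite subrK.
have k2T w : coweight_lattice B LD (s2 *: w) -> k2 (s2 *: w) ->
    forall e, e \in E -> B w e - 1 / 2 \is a Num.int.
  move=> /langlands_coweight_cases[h|//]; rewrite Ek2 => /negP[]; exact: h.
have k1phase u : integral u -> expi (pi * coord_sum u) = if k1 u then -1 else 1.
  move=> hu; rewrite /k1; case: ifPn => [|/negPn] h; last exact: expi_even.
  by apply: expi_odd => //; exact: coord_sum_int.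
exists k1, k2; split; first split.
- move=> u v /coweight_integral hu /coweight_integral hv.
  have E1 : coord_sum (u - v) / 2 = coord_sum u / 2 - coord_sum v / 2.
    by rewrite coord_sumB mulrBl.
  have E2 := half_int_diff (half2 u hu) (half2 v hv).
  rewrite -E1 in E2; split=> [/coroot_lattice_even|/negb_inj h].
    by rewrite E2 => /eqP; rewrite /k1 => ->.
  apply: coroot_lattice_of_even; last by rewrite E2 h.
  by move=> e eE; rewrite dotDl dotNl int_sub ?hu ?hv.
- move=> u v.
  have [w ->] := langlands_coweight_exists (isT : (0 < 2)%N) u.
  have [w' ->] := langlands_coweight_exists (isT : (0 < 2)%N) v.
  move=> hw hw'; rewrite !Ek2 -scalerBr.
  have [h1 h2] := langlands_coweight_half hw.
  have [h1' h2'] := langlands_coweight_half hw'.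
  have E2 := half_int_diff (h1 e0 e0E) (h1' e0 e0E).
  split=> [/(langlands_coroot_lattice (isT : (0 < 2)%N) rsD)|/negb_inj h].
    move=> /integral_of_root_lattice/(_ e0 e0E); rewrite dotDl dotNl E2.
    by move/eqP ->.
  apply/(langlands_coroot_lattice (isT : (0 < 2)%N) rsD).
  apply: root_lattice_of_integral => e eE; rewrite dotDl dotNl.
  have -> : B w e - B w' e = (B w e - B w e0) + (B w e0 - B w' e0) - (B w' e - B w' e0).
    ring.
  by rewrite int_sub ?h2' // int_add ?h2 // E2 h.
- by move=> u /coweight_integral hu; rewrite norm_phase // k1phase.
- move=> u; have [w ->] := langlands_coweight_exists (isT : (0 < 2)%N) u => hw.
  case: ifPn => [/(k2T w hw)|/negbTE/(k2F w hw)]; first exact: dual_norm_phase_half.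
  exact: dual_norm_phase.
- move=> u v /coweight_integral hu.
  have [w ->] := langlands_coweight_exists (isT : (0 < 2)%N) v => hw.
  case E2 : (k2 (s2 *: w)); rewrite ?andbT ?andbF.
    by rewrite pairing_phase_half ?k1phase //; exact: k2T.
  by apply: pairing_phase => //; exact: k2F.
- exists e0.
    by apply/coweightP => a aD; rewrite dotC; exact: (root_integral aD).
  by rewrite /k1 coord_sum_frame // half_shift // subrr.
- pose w := 2^-1 *: \sum_(e <- E) e.
  have Ew e : e \in E -> B w e = 2^-1.
    move=> eE; rewrite /w dotZl dot_suml -[LHS]/(2^-1 * _).
    rewrite (eq_bigr (fun f => B e f)); last by move=> f _; rewrite dotC.
    by rewrite -/(coord_sum e) coord_sum_frame // mulr1.
  exists (s2 *: w); last by rewrite Ek2 Ew // half_shift // mul1r subrr.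
  apply/(langlands_coweightP D (isT : (0 < 2)%N)) => a aD.
  have Ea : B w a = coord_sum a / 2.
    rewrite dot_coord mulr_suml big_seq [RHS]big_seq; apply: eq_bigr => e eE.
    by rewrite Ew // mulrC.
  have /coroot_lattice_even : coroot_lattice B D (coroot B a) by exact: coroot_lattice_gen.
  by rewrite /coroot dotZr Ea coord_sumZ mulrA.
Qed.

End NoSpinor.

(** Type F4: pairing with the root [b] makes the sum of the coordinates of a coweight
    even, and on the dual side [b] itself accounts for the half-integral coweights. *)
Lemma center_data_F b : b \in D -> #|` E| = 4%N ->
  (forall f, f \in E -> B b f ^+ 2 = 1 / 4) ->
  center_data 2 D LD (fun=> false) (fun=> false) 1 1 /\ rank V = 4%N.
Proof.
move=> bD E4 sq; split; last by have [_ _ [_ <-] _ _] := coE.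
have half e : e \in E -> B b e = 1 / 2 \/ B b e = - (1 / 2).
  move=> /sq h; have : (2 * B b e) ^+ 2 = 1 by rewrite exprMn h; field.
  by move=> /eqP; rewrite sqrf_eq1 => /orP[] /eqP h'; [left|right]; lra.
have even u : coweight_lattice B D u -> coord_sum u / 2 \is a Num.int.
  move=> hu; have /coweightP/(_ b bD) := hu; rewrite dot_coord => h.
  have -> : coord_sum u / 2 = \sum_(e <- E) B u e * B b e
      + \sum_(e <- E) (B u e / 2 - B u e * B b e).
    by rewrite -big_split /= mulr_suml; apply: eq_bigr => e _; ring.
  rewrite int_add //; apply: sum_int => e eE; have hue := coweight_integral hu eE.
  case: (half e eE) => ->; last by rewrite (_ : _ - _ = B u e) //; field.
  by rewrite (_ : _ - _ = 0) //; field.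
have dual w : coweight_lattice B LD (s2 *: w) -> root_lattice D w.
  move/langlands_coweight_cases => [|h]; first exact: root_lattice_of_integral.
  rewrite -[w](subrK b); apply: zspan_add; last exact: zspan_gen.
  apply: root_lattice_of_integral => e eE; rewrite dotDl dotNl.
  case: (half e eE) => ->; first exact: h.
  have -> : B w e - - (1 / 2) = B w e - 1 / 2 + 1 by field.
  by apply: int_add; [exact: h|exact: int_num1].
split=> [u v hu hv|u v|u hu|u|u v hu].
- split=> // _; have huv := coweight_sub hu hv.
  by apply: coroot_lattice_of_even; [exact: coweight_integral|exact: even].
- have [w ->] := langlands_coweight_exists (isT : (0 < 2)%N) u.
  have [w' ->] := langlands_coweight_exists (isT : (0 < 2)%N) v.
  move=> hw hw'; split=> // _; rewrite -scalerBr.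
  apply/(langlands_coroot_lattice (isT : (0 < 2)%N) rsD).
  by apply: zspan_sub; exact: dual.
- by apply: coweight_even_phase; [exact: coweight_integral|exact: even].
- have [w ->] := langlands_coweight_exists (isT : (0 < 2)%N) u => hw.
  have [/dual_norm_phase//|/dual_norm_phase_half ->] := langlands_coweight_cases hw.
  have [_ _ [_ <-] _ _] := coE; rewrite E4 expi_even //.
  by rewrite (_ : 4 / 2 / 2 = 1) //; field.
- have [w ->] := langlands_coweight_exists (isT : (0 < 2)%N) v => /dual hw.
  rewrite phase_S2 expi_2pi_int //; apply: int_opp; rewrite dotC; exact: hu.
Qed.

End TypeBF.

Lemma center_data_coordinates D E : two_lengths B 2 D -> coordinates B D E ->
  let LD := langlands_roots B 2 D in
  (center_data 2 D LD (fun=> false) (fun=> false) 1 1 /\ rank V = 4%N) \/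
  exists k1 k2,
  [/\ center_data 2 D LD k1 k2 (-1) (expi (pi * ((rank V)%:R / 2))),
      exists2 u, coweight_lattice B D u & k1 u
    & exists2 u, coweight_lattice B LD u & k2 u].
Proof.
move=> tlD coE LD.
have [[b [bD E4 sq]]|nosp] := pselect (exists b, [/\ b \in D, #|` E| = 4%N &
    forall f, f \in E -> B b f ^+ 2 = 1 / 4]).
  by left; exact: (center_data_F tlD coE bD E4 sq).
right; apply: (center_data_B tlD coE) => b bD Eb; have [_ _ _ _ sr] := coE.
case: (sr b bD Eb) => [|| [E4 sq]]; [by left|by right|].
by case: nosp; exists b.
Qed.

(** Type G2: the coweight and coroot lattices are both spanned by [a1] and [a2]. *)
Lemma center_data_G D : two_lengths B 3 D ->
  center_data 3 D (langlands_roots B 3 D) (fun=> false) (fun=> false) 1 1 /\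
  rank V = 2%N.
Proof.
move=> tlD; have [a1 [a2 hex]] := exists_hexagon tlD.
split; last exact: (hexagon_rank tlD hex).
have [rsD _ _ _ _] := tlD.
have [[D1 D2 _] [E11 E22 E12] [S0 S1 S2]] := hex.
have E21 : B a2 a1 = -1 by rewrite dotC.
have C1 : coroot B a1 = a1 by rewrite /coroot E11 divff ?pnatr_eq0 // scale1r.
have C2 : coroot B a2 = a2 by rewrite /coroot E22 divff ?pnatr_eq0 // scale1r.
have s3 : Num.sqrt 3%:R ^+ 2 = 3 :> R by rewrite sqr_sqrtr // ler0n.
have coords u : coweight_lattice B D u -> exists i j : int, u = i%:~R *: a1 + j%:~R *: a2.
  move/coweightP => h; have [x [y Eu]] := hexagon_spans tlD hex u.
  have i1 := h _ D1; have i2 := h _ D2; have i0 := h _ S0.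
  have /intrP[i Ei] : x \is a Num.int.
    have -> : x = B u a1 - B u (3^-1 *: (a1 - a2)).
      by rewrite Eu !dotE E11 E22 E12 E21; field.
    by rewrite int_sub.
  have /intrP[j Ej] : y \is a Num.int.
    have -> : y = B u a2 + B u (3^-1 *: (a1 - a2)).
      by rewrite Eu !dotE E11 E22 E12 E21; field.
    by rewrite int_add.
  by exists i, j; rewrite -Ei -Ej.
have dual w : coweight_lattice B (langlands_roots B 3 D) (Num.sqrt 3%:R *: w) ->
    exists i j : int, w = i%:~R *: (3^-1 *: (2 *: a1 + a2))
                        + j%:~R *: (3^-1 *: (a1 + 2 *: a2)).
  move/(langlands_coweightP D (isT : (0 < 3)%N)) => h.
  have [x [y Ew]] := hexagon_spans tlD hex w.
  have := h _ D1; rewrite C1 => /intrP[i Ei].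
  have := h _ D2; rewrite C2 => /intrP[j Ej].
  exists i, j; rewrite -Ei -Ej Ew; apply: (dot_ext (B := B)) => v.
  by rewrite !dotE E11 E22 E12 E21; field.
have dual_in_root_lattice w : coweight_lattice B (langlands_roots B 3 D) (Num.sqrt 3%:R *: w) ->
    root_lattice D w.
  move/dual => [i [j ->]].
  by apply: zspan_add; apply: zspan_scale; rewrite ?intr_int //; exact: zspan_gen.
split=> [u v hu hv|u v|u hu|u|u v hu].
- split=> // _; have [i [j ->]] := coords _ (coweight_sub hu hv).
  rewrite -[in X in coroot_lattice _ _ X]C1 -[in X in coroot_lattice _ _ X]C2.
  by apply: zspan_add; apply: zspan_scale; rewrite ?intr_int //; exact: coroot_lattice_gen.
- have [w ->] := langlands_coweight_exists (isT : (0 < 3)%N) u.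
  have [w' ->] := langlands_coweight_exists (isT : (0 < 3)%N) v.
  move=> hw hw'; split=> // _; rewrite -scalerBr.
  apply/(langlands_coroot_lattice (isT : (0 < 3)%N) rsD).
  by apply: zspan_sub; exact: dual_in_root_lattice.
- have [i [j ->]] := coords _ hu; apply: expi_even.
  rewrite (_ : _ / 2 = (i * i - i * j + j * j)%:~R) ?intr_int //.
  by rewrite !dotE E11 E22 E12 E21 rmorphD rmorphB !rmorphM /=; field.
- have [w ->] := langlands_coweight_exists (isT : (0 < 3)%N) u => /dual[i [j ->]].
  apply: expi_even; rewrite dotZl dotZr mulrA -expr2 s3.
  rewrite (_ : _ / 2 = (i * i + i * j + j * j)%:~R) ?intr_int //.
  by rewrite !dotE E11 E22 E12 E21 !rmorphD !rmorphM /=; field.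
- have [w ->] := langlands_coweight_exists (isT : (0 < 3)%N) v => /dual_in_root_lattice hw.
  rewrite phase_S_scaled // expi_2pi_int //; apply: int_opp; rewrite dotC; exact: hu.
Qed.

End Lattices.

(** * The Hecke group as a free product *)

Section Mat2.
Context {R : realType}.
Implicit Types (a b c d k : R) (M N : 'M[R]_2).

Lemma mat2_ext M N : M 0 0 = N 0 0 -> M 0 1 = N 0 1 -> M 1 0 = N 1 0 ->
  M 1 1 = N 1 1 -> M = N.
Proof.
move=> h1 h2 h3 h4; apply/matrixP => i j.
have I (k : 'I_2) : k = 0 \/ k = 1.
  by case: k => -[|[|k]] //= p; [left|right]; apply: val_inj.
by case: (I i) => ->; case: (I j) => ->.
Qed.

Lemma mat2E a b c d : (mat2 a b c d 0 0 = a) * (mat2 a b c d 0 1 = b) *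
  (mat2 a b c d 1 0 = c) * (mat2 a b c d 1 1 = d).
Proof. by rewrite /mat2 !mxE. Qed.

Lemma mat2_mul a b c d a' b' c' d' : mat2 a b c d *m mat2 a' b' c' d' =
  mat2 (a * a' + b * c') (a * b' + b * d') (c * a' + d * c') (c * b' + d * d').
Proof.
by apply: mat2_ext; rewrite mxE !big_ord_recl big_ord0 addr0 !mxE /=.
Qed.

Lemma mat2_scale k a b c d : k *: mat2 a b c d = mat2 (k * a) (k * b) (k * c) (k * d).
Proof. by apply: mat2_ext; rewrite !mxE. Qed.

Lemma mat2_1 : 1%:M = mat2 1 0 0 1 :> 'M[R]_2.
Proof. by apply: mat2_ext; rewrite !mxE. Qed.

Lemma mat2_inj a b c d a' b' c' d' : mat2 a b c d = mat2 a' b' c' d' ->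
  [/\ a = a', b = b', c = c' & d = d'].
Proof.
by move=> E; split; [have := congr1 (fun M => M 0 0) E|have := congr1 (fun M => M 0 1) E
  |have := congr1 (fun M => M 1 0) E|have := congr1 (fun M => M 1 1) E]; rewrite !mat2E.
Qed.

Lemma invmx_unique m (M N : 'M[R]_m) : M *m N = 1%:M ->
  M \in unitmx /\ invmx M = N.
Proof.
move=> E; have [uM uN] := mulmx1_unit E; split=> //.
by rewrite -[LHS]mulmx1 -E mulKmx.
Qed.

End Mat2.

Section NormalForm.
Context {R : realType} (n : nat).
Hypothesis n23 : n = 2%N \/ n = 3%N.
Local Notation s := (Num.sqrt n%:R : R).
Local Notation S := (Smx R n).
Local Notation T := (Tmx R).

(** The [m] with [(S T)^m = -1]: the trace [sqrt n] of [S T] is [2 cos (pi / m)]. *)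
Definition half_order : nat := if n == 2%N then 4 else 6.
Local Notation m := half_order.

Let n_gt0 : 0 < n%:R :> R. Proof. by case: n23 => ->; rewrite ltr0n. Qed.
Let s_gt0 : 0 < s. Proof. by rewrite sqrtr_gt0. Qed.
Let s_neq0 : s != 0. Proof. by rewrite gt_eqF. Qed.
Let s2 : s * s = n%:R. Proof. by rewrite -expr2 sqr_sqrtr // ltW. Qed.

(** The values at [s / 2] of the first Chebyshev polynomials of the second kind,
    preceded by [0]: [(S T)^(a + 1) = c (a + 1) (S T) - c a]. *)
Definition chebyshev : nat -> R :=
  nth 0 (if n == 2%N then [:: 0; 1; s; 1; 0] else [:: 0; 1; s; 2; s; 1; 0]).
Local Notation c := chebyshev.

Lemma half_order_gt1 : (1 < m)%N. Proof. by rewrite /half_order; case: eqP. Qed.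

Lemma chebyshev_ends : [/\ c 0 = 0, c 1 = 1, c m.-1 = 1 & c m = 0].
Proof. by rewrite /chebyshev /half_order; case: eqP. Qed.

Lemma chebyshev_facts a : (a.+1 < m)%N -> let x := c a in let y := c a.+1 in
  [/\ c a.+2 = s * y - x, 1 <= y, 0 <= y - x / s, 0 <= s * x
    & 0 < y - x / s + s * x].
Proof.
have s_ge1 : 1 <= s.
  by rewrite -[X in X <= _]sqrtr1 ler_wsqrtr // ler1n; case: n23 => ->.
have div_s k : k / s = k * s / n%:R by apply/eqP; rewrite eqr_div ?(gt_eqF n_gt0) // -mulrA s2.
rewrite /chebyshev /half_order !div_s.
case: n23 (s2) s_ge1 => -> /=; set t := Num.sqrt _ => t2 t1.
  by case: a => [|[|[|a]]] //= _; split; nra.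
by case: a => [|[|[|[|[|a]]]]] //= _; split; nra.
Qed.


(** [V a] is [S^-1 (S T)^a]. *)
Definition Vmx a : 'M[R]_2 :=
  let x := c a.-1 in let y := c a in mat2 y (y - x / s) (s * x) y.
Local Notation V := Vmx.

Let SS : S *m S = (-1) *: 1%:M.
Proof.
rewrite /Smx mat2_mul mat2_1 mat2_scale; congr mat2; first by field.
- ring.
- ring.
- by field.
Qed.

Let SSM (M : 'M[R]_2) : S *m (S *m M) = (-1) *: M.
Proof. by rewrite mulmxA SS -scalemxAl mul1mx. Qed.

Lemma Vmx1 : V 1 = T.
Proof.
have [c0 c1 _ _] := chebyshev_ends.
by rewrite /Vmx /Tmx c0 c1 mul0r subr0 mulr0.
Qed.

Lemma Vmx_last : V m = S.
Proof.
have [_ _ cm1 cm] := chebyshev_ends.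
by rewrite /Vmx /Smx cm1 cm mulr1 mul1r sub0r.
Qed.

Lemma Vmx_next a : (0 < a < m)%N -> T *m (S *m V a) = V a.+1.
Proof.
case: a => // a /andP[_ am]; have [E _ _ _ _] := chebyshev_facts am.
rewrite /Vmx /= E /Tmx /Smx !mat2_mul; congr mat2; by field.
Qed.

Definition Tinv : 'M[R]_2 := mat2 1 (-1) 0 1.

Let TTinv : T *m Tinv = 1%:M.
Proof. by rewrite /Tmx /Tinv mat2_mul mat2_1; congr mat2; ring. Qed.

Let TinvT : Tinv *m T = 1%:M.
Proof. by rewrite /Tmx /Tinv mat2_mul mat2_1; congr mat2; ring. Qed.

Lemma invmx_S : S \in unitmx /\ invmx S = (-1) *: S.
Proof. by apply: invmx_unique; rewrite -scalemxAr SS scalerA mulrNN mulr1 scale1r. Qed.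

Lemma invmx_T : T \in unitmx /\ invmx T = Tinv.
Proof. exact: invmx_unique TTinv. Qed.

Lemma Gamma_star_unit g : Gamma_star R n g -> g \in unitmx.
Proof.
elim=> [h|| h k _ uh _ uk|h _ uh].
- by case=> ->; [have [] := invmx_S|have [] := invmx_T].
- exact: unitmx1.
- by rewrite unitmx_mul uh uk.
- by rewrite unitmx_inv.
Qed.

(** Satisfied by all nonempty products of the [V a]. *)
Definition positive_mx (M : 'M[R]_2) : Prop := exists a b c d,
  [/\ M = mat2 a b c d, 1 <= a, 1 <= d, 0 <= b /\ 0 <= c & 0 < b + c].

Lemma positive_V a : (0 < a < m)%N -> positive_mx (V a).
Proof.
case: a => // a /andP[_ am]; have [_ h1 h2 h3 h4] := chebyshev_facts am.
by exists (c a.+1), (c a.+1 - c a / s), (s * c a), (c a.+1).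
Qed.

Lemma positive_mul M N : positive_mx M -> positive_mx N -> positive_mx (M *m N).
Proof.
move=> [a [b [c [d [-> ha hd [hb hc] hbc]]]]] [a' [b' [c' [d' [-> ha' hd' [hb' hc'] hbc']]]]].
rewrite mat2_mul; do 4! eexists; split; first reflexivity; try split; nra.
Qed.

Section Lifting.
Context {A : Type} (op : A -> A -> A) (e sigma tau tau' : A).
Hypothesis opA : associative op.
Hypothesis op1 : left_id e op.
Hypothesis opr1 : right_id e op.
Hypothesis sigma2 : op sigma sigma = e.
Hypothesis tauV : op tau tau' = e.
Hypothesis Vtau : op tau' tau = e.
Hypothesis order_st : iter m (op (op sigma tau)) e = e.

(** The counterpart of [Vmx] in [A], where [sigma] is its own inverse. *)
Definition Wop a : A := op sigma (iter a (op (op sigma tau)) e).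
Local Notation W := Wop.

Let sK x : op sigma (op sigma x) = x. Proof. by rewrite opA sigma2 op1. Qed.
Let tK x : op tau' (op tau x) = x. Proof. by rewrite opA Vtau op1. Qed.

Let W1 : W 1 = tau. Proof. by rewrite /Wop /= opr1 sK. Qed.
Let Wm : W m = sigma. Proof. by rewrite /Wop order_st opr1. Qed.
Let W_next a : op tau (op sigma (W a)) = W a.+1.
Proof. by rewrite /Wop sK /= -opA sK. Qed.

(** Words [V a1 ... V ak S^eps] with their images; in [normal_form] they are preceded
    by a sign, which has the image [e], and possibly by a further factor [S]. *)
Inductive tail : 'M[R]_2 -> A -> Prop :=
| tail_one : tail 1%:M e
| tail_S : tail S sigma
| tail_cons a M x : (0 < a < m)%N -> tail M x -> tail (V a *m M) (op (W a) x).

Definition normal_form (g : 'M[R]_2) (x : A) : Prop :=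
  exists (k : R) M y, [/\ k ^+ 2 = 1, tail M y &
    (g = k *: M /\ x = y) \/ (g = k *: (S *m M) /\ x = op sigma y)].

Lemma normal_form_scale k g x : k ^+ 2 = 1 ->
  normal_form g x -> normal_form (k *: g) x.
Proof.
move=> k1 [l [M [y [l1 t h]]]]; exists (k * l), M, y; split=> //.
  by rewrite exprMn k1 l1 mulr1.
by case: h => -[-> ->]; [left|right]; rewrite scalerA.
Qed.

Let nf0 M x : tail M x -> normal_form M x.
Proof. by exists 1, M, x; split=> //; rewrite ?expr1n //; left; rewrite scale1r. Qed.

Let nf1 M x : tail M x -> normal_form (S *m M) (op sigma x).
Proof. by exists 1, M, x; split=> //; rewrite ?expr1n //; right; rewrite scale1r. Qed.

Let m1N : (-1) ^+ 2 = 1 :> R. Proof. by rewrite sqrrN expr1n. Qed.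

Let nfN M x : normal_form M x -> normal_form ((-1) *: M) x.
Proof. exact: normal_form_scale. Qed.

Lemma normal_form_S g x : normal_form g x -> normal_form (S *m g) (op sigma x).
Proof.
move=> [k [M [y [k1 t [[-> ->]|[-> ->]]]]]]; rewrite -scalemxAr.
  exact/normal_form_scale/nf1.
by rewrite SSM sK; do 2! apply: normal_form_scale => //; exact: nf0.
Qed.

Lemma normal_form_T g x : normal_form g x -> normal_form (T *m g) (op tau x).
Proof.
have m1 := half_order_gt1.
move=> [k [M [y [k1 t [[-> ->]|[-> ->]]]]]]; rewrite -scalemxAr;
  apply: normal_form_scale => //.
  by rewrite -Vmx1 -W1; apply: nf0; exact: tail_cons.
case: t => [||a M' x' /[dup] am /andP[a0 lt] t'].
- by rewrite mulmx1 opr1 -Vmx1 -W1; apply: nf0; apply: tail_cons => //; exact: tail_S.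
- rewrite SS sigma2 -scalemxAr; apply: nfN; rewrite -Vmx1 -W1.
  by apply: nf0; apply: tail_cons => //; exact: tail_one.
- have -> : T *m (S *m (V a *m M')) = V a.+1 *m M' by rewrite -Vmx_next // !mulmxA.
  have -> : op tau (op sigma (op (W a) x')) = op (W a.+1) x' by rewrite -W_next !opA.
  have [Em|nm] := eqVneq a.+1 m; first by rewrite Em Vmx_last Wm; exact: nf1.
  by apply: nf0; apply: tail_cons => //; rewrite /= ltn_neqAle nm.
Qed.

(** From [V m = S] and [V (a + 1) = T S (V a)] follow [T^-1 S = S (V (m - 1))] and
    [T^-1 (V (a + 1)) = S (V a)]. *)
Lemma normal_form_Tinv g x : normal_form g x -> normal_form (Tinv *m g) (op tau' x).
Proof.
have m1 := half_order_gt1.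
have ms : m = m.-1.+1 by rewrite prednK // ltnW.
have lt_m : (0 < m.-1 < m)%N by lia.
have TS : Tinv *m S = S *m V m.-1.
  by rewrite -{1}Vmx_last {1}ms -Vmx_next // mulmxA TinvT mul1mx.
have ts : op tau' sigma = op sigma (W m.-1).
  by rewrite -{1}Wm {1}ms -W_next tK.
have T1 : Tinv = (-1) *: (S *m (V m.-1 *m S)).
  rewrite mulmxA -TS -mulmxA SS -scalemxAr mulmx1 scalerA mulrNN mulr1.
  by rewrite scale1r.
have t1 : tau' = op sigma (op (W m.-1) sigma).
  by rewrite opA -ts -opA sigma2 opr1.
move=> [k [M [y [k1 t [[-> ->]|[-> ->]]]]]]; rewrite -scalemxAr;
  apply: normal_form_scale => //; last first.
  rewrite mulmxA TS -mulmxA opA ts -opA; apply: nf1; exact: tail_cons.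
case: t => [||a M' x' /[dup] am /andP[a0 lt] t'].
- rewrite mulmx1 opr1 T1 t1; apply: nfN; apply: nf1; apply: tail_cons => //.
  exact: tail_S.
- rewrite TS ts -[V m.-1]mulmx1 -[W m.-1]opr1; apply: nf1; apply: tail_cons => //.
  exact: tail_one.
- case: a a0 am lt => // -[_ _ _|a _ am lt].
    by rewrite Vmx1 W1 mulmxA TinvT mul1mx tK; exact: nf0.
  have -> : Tinv *m (V a.+2 *m M') = S *m (V a.+1 *m M').
    by rewrite -Vmx_next ?(ltnW lt) // !mulmxA TinvT mul1mx.
  have -> : op tau' (op (W a.+2) x') = op sigma (op (W a.+1) x').
    by rewrite -W_next !opA Vtau op1.
  by apply: nf1; apply: tail_cons => //; rewrite (ltnW lt).
Qed.

Lemma tail_positive M x : tail M x ->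
  [\/ M = 1%:M /\ x = e, M = S /\ x = sigma |
    exists2 N, positive_mx N & M = N \/ M = N *m S].
Proof.
elim=> [||a {}M {}x am _ IH]; [by constructor 1|by constructor 2|constructor 3].
have pV := positive_V am.
case: IH => [[-> _]|[-> _]|[N pN [->|->]]].
- by exists (V a) => //; left; rewrite mulmx1.
- by exists (V a) => //; right.
- by exists (V a *m N); [exact: positive_mul|left].
- by exists (V a *m N); [exact: positive_mul|right; rewrite mulmxA].
Qed.

(** A matrix with nonnegative entries, positive on the diagonal and not diagonal,
    remains different from [1] and [-1] when multiplied by [S] on either side. *)
Lemma normal_form_one x : normal_form 1%:M x -> x = e.
Proof.
move=> [k [M [y [k1 t h]]]].
have k0 : k != 0 by apply: contra_eq_neq k1 => ->; rewrite expr0n eq_sym oner_eq0.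
have notS l : l != 0 -> mat2 1 0 0 1 = l *: S -> False.
  by move=> l0; rewrite /Smx mat2_scale => /mat2_inj[/eqP]; rewrite mulr0 oner_eq0.
case: (tail_positive t) h => [[-> ->]|[-> ->]|[N [a [b [c' [d [-> ha hd [hb hc] hbc]]]]] E]].
- by case=> -[E ->] //; case: (notS k k0); rewrite -mat2_1 E mulmx1.
- by case=> -[E ->]; [case: (notS k k0); rewrite -mat2_1 E|rewrite sigma2].
have sa : 0 < s * a by rewrite mulr_gt0 //; lra.
have ds : 0 < d * s by rewrite mulr_gt0 //; lra.
have kI z : 0 = k * z -> z = 0 by move=> E0; apply: (mulfI k0); rewrite -E0 mulr0.
move=> h; exfalso; case: E h => -> -[] [+ _]; rewrite mat2_1 /Smx ?mat2_mul ?mat2_scale;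
  move=> /mat2_inj[_ /kI E2 /kI E3 _].
- lra.
- lra.
- lra.
- have : s * (b * s) = 0 by lra.
  have : s^-1 * (c' * s^-1) = 0 by lra.
  move=> /eqP; rewrite !mulf_eq0 invr_eq0 (negPf s_neq0) orbF => /eqP c0 /eqP.
  by rewrite !mulf_eq0 (negPf s_neq0) orbF => /eqP b0; lra.
Qed.

(** The subgroup of pairs generated by [(S, sigma)] and [(T, tau)]. The third component
    is the inverse of the second in the monoid [A]. *)
Inductive graph : 'M[R]_2 -> A -> A -> Prop :=
| graph_S : graph S sigma sigma
| graph_T : graph T tau tau'
| graph_one : graph 1%:M e e
| graph_mul g h x x' y y' :
    graph g x x' -> graph h y y' -> graph (g *m h) (op x y) (op y' x')
| graph_inv g x x' : graph g x x' -> graph (invmx g) x' x.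

Lemma graph_Gamma_star g x x' : graph g x x' -> Gamma_star R n g.
Proof.
elim=> [|||? ? ? ? ? ? _ h1 _ h2|? ? ? _ h].
- by apply: gen_base; left.
- by apply: gen_base; right.
- exact: gen_one.
- exact: gen_mul.
- exact: gen_inv.
Qed.

Lemma Gamma_star_graph g : Gamma_star R n g -> exists x x', graph g x x'.
Proof.
elim=> [h|| h k _ [x [x' hx]] _ [y [y' hy]]|h _ [x [x' hx]]].
- by case=> ->; [exists sigma, sigma; exact: graph_S|exists tau, tau'; exact: graph_T].
- by exists e, e; exact: graph_one.
- by exists (op x y), (op y' x'); exact: graph_mul.
- by exists x', x; exact: graph_inv.
Qed.

Lemma graph_inverse g x x' : graph g x x' -> op x x' = e /\ op x' x = e.
Proof.
elim=> [|||? ? a a' b b' _ [h1 h2] _ [h3 h4]|? ? ? _ [h1 h2]] //.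
split; first by rewrite opA -(opA a) h3 opr1.
by rewrite opA -(opA b') h2 opr1.
Qed.

Lemma graph_closed (K : A -> Prop) g x x' : K e -> K sigma -> K tau -> K tau' ->
  (forall y z, K y -> K z -> K (op y z)) -> graph g x x' -> K x /\ K x'.
Proof.
move=> Ke Ks Kt Kt' KM.
by elim=> [|||? ? ? ? ? ? _ [? ?] _ [? ?]|? ? ? _ [? ?]]; split=> //; exact: KM.
Qed.

Lemma graph_normal_form g x x' : graph g x x' -> forall h y, normal_form h y ->
  normal_form (g *m h) (op x y) /\ normal_form (invmx g *m h) (op x' y).
Proof.
elim=> [|||g1 g2 a a' b b' /graph_Gamma_star/Gamma_star_unit u1 IH1
  /graph_Gamma_star/Gamma_star_unit u2 IH2|g1 a a' /graph_Gamma_star/Gamma_star_unit u IH] h y nf.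
- split; first exact: normal_form_S.
  have [_ ->] := invmx_S; rewrite -scalemxAl; apply: nfN; exact: normal_form_S.
- split; first exact: normal_form_T.
  have [_ ->] := invmx_T; exact: normal_form_Tinv.
- by rewrite invmx1 mul1mx op1.
- split; first by rewrite -mulmxA -opA; apply: (IH1 _ _ _).1; exact: (IH2 _ _ nf).1.
  have -> : invmx (g1 *m g2) = invmx g2 *m invmx g1.
    have [] // := @invmx_unique _ _ (g1 *m g2) (invmx g2 *m invmx g1).
    by rewrite mulmxA -(mulmxA g1) mulmxV // mulmx1 mulmxV.
  by rewrite -mulmxA -opA; apply: (IH2 _ _ _).2; exact: (IH1 _ _ nf).2.
- by rewrite invmxK; have [] := IH _ _ nf.
Qed.

(** The only relations between [S] and [T] modulo signs are consequences of
    [S^2 = (S T)^m = 1]: two images of [g] differ by an image of [1], which is [e] by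
    the uniqueness of normal forms. *)
Lemma graph_functional g x x' y y' : graph g x x' -> graph g y y' -> x = y.
Proof.
move=> gx gy; have ug := Gamma_star_unit (graph_Gamma_star gx).
have gz := graph_mul (graph_inv gx) gy.
have [+ _] := graph_normal_form gz (nf0 tail_one).
rewrite mulVmx // mulmx1 opr1 => /normal_form_one E.
have [h _] := graph_inverse gx.
by rewrite -[y]op1 -h -opA E opr1.
Qed.

(** The last clause transports properties of [sigma], [tau] and [tau'] to all values
    of [rho]. *)
Lemma lifting_exists : exists rho : 'M[R]_2 -> A,
  [/\ rho 1%:M = e, rho S = sigma, rho T = tau,
      forall g h, Gamma_star R n g -> Gamma_star R n h ->
        rho (g *m h) = op (rho g) (rho h)
    & forall K : A -> Prop, K e -> K sigma -> K tau -> K tau' ->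
        (forall y z, K y -> K z -> K (op y z)) ->
        forall g, Gamma_star R n g -> K (rho g)].
Proof.
have rhoP g : {x | Gamma_star R n g -> exists x', graph g x x'}.
  apply: cid; have [/Gamma_star_graph[x [x' h]]|no] := pselect (Gamma_star R n g).
    by exists x => _; exists x'.
  by exists e.
exists (fun g => sval (rhoP g)).
have E g x x' : graph g x x' -> sval (rhoP g) = x.
  move=> gx; case: (rhoP g) => y /= /(_ (graph_Gamma_star gx))[y' gy].
  exact: graph_functional gy gx.
split; [exact: E graph_one|exact: E graph_S|exact: E graph_T| |].
- move=> g h /Gamma_star_graph[x [x' gx]] /Gamma_star_graph[y [y' gy]].
  by rewrite (E _ _ _ gx) (E _ _ _ gy) (E _ _ _ (graph_mul gx gy)).
- move=> K Ke Ks Kt Kt' KM g /Gamma_star_graph[x [x' gx]].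
  by rewrite (E _ _ _ gx); have [] := graph_closed Ke Ks Kt Kt' KM gx.
Qed.

End Lifting.
End NormalForm.

Section HeckeIsomorphism.
Context {R : realType} (n : nat).
Hypothesis n0 : (0 < n)%N.
Local Notation s := (Num.sqrt n%:R : R).

Let s_neq0 : s != 0. Proof. by rewrite gt_eqF // sqrtr_gt0 ltr0n. Qed.

Let d : 'M[R]_2 := mat2 1 0 0 s.

Let dV : d \in unitmx /\ invmx d = mat2 1 0 0 s^-1.
Proof.
apply: invmx_unique; rewrite /d mat2_mul mat2_1; congr mat2; by field.
Qed.

Lemma hecke_conj_mat2 a b c k :
  hecke_conj n (mat2 a b c k : 'M[R]_2) = mat2 a (b / s) (s * c) k.
Proof.
rewrite /hecke_conj; have [_ ->] := dV.
rewrite !mat2_mul; congr mat2; by field.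
Qed.

Let conj_mul (g h : 'M[R]_2) :
  hecke_conj n (g *m h) = hecke_conj n g *m hecke_conj n h.
Proof. by rewrite /hecke_conj -/d !mulmxA mulmxKV; case: dV. Qed.

Let conj_inj : injective (hecke_conj n : 'M[R]_2 -> 'M[R]_2).
Proof.
have [ud _] := dV; move=> g h; rewrite /hecke_conj -/d => E.
have {}E : d *m g = d *m h by have := congr1 (mulmx^~ d) E; rewrite !mulmxKV.
by rewrite -[LHS](mulKmx ud) E mulKmx.
Qed.

Let conj_inv (g : 'M[R]_2) : g \in unitmx ->
  hecke_conj n (invmx g) = invmx (hecke_conj n g).
Proof.
move=> ug; have E : hecke_conj n g *m hecke_conj n (invmx g) = 1%:M.
  by rewrite -conj_mul mulmxV // /hecke_conj mulmx1 mulmxV //; case: dV.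
by have [_ ->] := invmx_unique E.
Qed.

Lemma hecke_conj_S : hecke_conj n (mat2 0 (- 1) 1 0 : 'M[R]_2) = Smx R n.
Proof. by rewrite hecke_conj_mat2 /Smx mulr1 mulN1r. Qed.

Lemma hecke_conj_T : hecke_conj n (mat2 1 s 0 1 : 'M[R]_2) = Tmx R.
Proof. by rewrite hecke_conj_mat2 /Tmx mulr0 divff. Qed.

Lemma hecke_unit (g : 'M[R]_2) : Hecke s g -> g \in unitmx.
Proof.
elim=> [h|| h k _ uh _ uk|h _ uh].
- case=> ->.
    have [] // := @invmx_unique _ _ (mat2 0 (- 1) 1 0 : 'M[R]_2) (mat2 0 1 (- 1) 0).
    by rewrite mat2_mul mat2_1; congr mat2; ring.
  have [] // := @invmx_unique _ _ (mat2 1 s 0 1 : 'M[R]_2) (mat2 1 (- s) 0 1).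
  by rewrite mat2_mul mat2_1; congr mat2; ring.
- exact: unitmx1.
- by rewrite unitmx_mul uh uk.
- by rewrite unitmx_inv.
Qed.

Lemma hecke_isomorphism :
  group_isomorphism (Hecke s) (Gamma_star R n) (hecke_conj n).
Proof.
split=> [g g' _ _|g g' _ _ /conj_inj//|]; first exact: conj_mul.
apply/seteqP; split=> [_ [g hg <-]|g].
  elim: hg => [h|| h k _ gh _ gk|h hh gh].
  - by case=> ->; apply: gen_base; [left; exact: hecke_conj_S|right; exact: hecke_conj_T].
  - by rewrite /hecke_conj mulmx1 mulmxV; [exact: gen_one|case: dV].
  - by rewrite conj_mul; exact: gen_mul.
  - by rewrite conj_inv; [exact: gen_inv|exact: hecke_unit].
elim=> [h|| _ _ _ [h hh <-] _ [k hk <-]|_ _ [h hh <-]].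
- case=> ->; [exists (mat2 0 (- 1) 1 0)|exists (mat2 1 s 0 1)].
  + by apply: gen_base; left.
  + exact: hecke_conj_S.
  + by apply: gen_base; right.
  + exact: hecke_conj_T.
- by exists 1%:M; [exact: gen_one|rewrite /hecke_conj mulmx1 mulmxV //; case: dV].
- by exists (h *m k); [exact: gen_mul|exact: conj_mul].
- by exists (invmx h); [exact: gen_inv|rewrite conj_inv //; exact: hecke_unit].
Qed.

End HeckeIsomorphism.

(** * The operators *)

Section Operators.
Context {R : realType} {X Y : finType}.
Local Notation C := R[i].
Local Notation W := (@rep_space R X Y).
Implicit Types (v w : W) (x : X) (y : Y).

Lemma rep_ext v w : (forall x, v.1 x = w.1 x) -> (forall y, v.2 y = w.2 y) -> v = w.
Proof.
move=> h1 h2; rewrite (surjective_pairing v) (surjective_pairing w).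
by congr pair; apply/ffunP.
Qed.

Definition diag_fun (tX : X -> C) (tY : Y -> C) v : W :=
  ([ffun x => tX x * v.1 x], [ffun y => tY y * v.2 y]).

Lemma diag_fun_is_linear tX tY : linear (diag_fun tX tY).
Proof.
move=> k v w; apply: rep_ext => z; rewrite /diag_fun /= !ffunE /= mulrDr;
  by congr (_ + _); rewrite /GRing.scale /= mulrCA.
Qed.

HB.instance Definition _ tX tY :=
  GRing.isLinear.Build C W W *:%R (diag_fun tX tY) (@diag_fun_is_linear tX tY).

Definition fourier_fun (c : C) (chi : Y -> X -> C) v : W :=
  ([ffun x => c * \sum_y chi y x * v.2 y], [ffun y => c * \sum_x chi y x * v.1 x]).

Lemma fourier_fun_is_linear c chi : linear (fourier_fun c chi).
Proof.
move=> k v w; apply: rep_ext => z;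
  rewrite /fourier_fun /= !ffunE /= /GRing.scale /= mulrCA -mulrDr;
  congr (_ * _); rewrite mulr_sumr -big_split /=;
  by apply: eq_bigr => i _; rewrite !ffunE /GRing.scale /=; ring.
Qed.

HB.instance Definition _ c chi :=
  GRing.isLinear.Build C W W *:%R (fourier_fun c chi) (@fourier_fun_is_linear c chi).

Definition diag_op tX tY : 'End(W) := linfun (diag_fun tX tY).
Definition fourier_op c chi : 'End(W) := linfun (fourier_fun c chi).

Lemma diag_op1 tX tY v x : (diag_op tX tY v).1 x = tX x * v.1 x.
Proof. by rewrite lfunE /= ffunE. Qed.

Lemma diag_op2 tX tY v y : (diag_op tX tY v).2 y = tY y * v.2 y.
Proof. by rewrite lfunE /= ffunE. Qed.

Lemma fourier_op1 c chi v x : (fourier_op c chi v).1 x = c * \sum_y chi y x * v.2 y.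
Proof. by rewrite lfunE /= ffunE. Qed.

Lemma fourier_op2 c chi v y : (fourier_op c chi v).2 y = c * \sum_x chi y x * v.1 x.
Proof. by rewrite lfunE /= ffunE. Qed.

Lemma ketl1 x x' : (ketl x : W).1 x' = (x' == x)%:R. Proof. by rewrite ffunE. Qed.
Lemma ketr2 y y' : (ketr y : W).2 y' = (y' == y)%:R. Proof. by rewrite ffunE. Qed.
Lemma ketl2 x y : (ketl x : W).2 y = 0. Proof. by rewrite ffunE. Qed.
Lemma ketr1 y x : (ketr y : W).1 x = 0. Proof. by rewrite ffunE. Qed.

Lemma rep_sum1 (I : Type) (r : seq I) (P : pred I) (F : I -> W) x :
  (\sum_(i <- r | P i) F i).1 x = \sum_(i <- r | P i) (F i).1 x.
Proof.
by elim/big_rec2: _ => [|i u v _ <-]; rewrite ffunE.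
Qed.

Lemma rep_sum2 (I : Type) (r : seq I) (P : pred I) (F : I -> W) y :
  (\sum_(i <- r | P i) F i).2 y = \sum_(i <- r | P i) (F i).2 y.
Proof.
by elim/big_rec2: _ => [|i u v _ <-]; rewrite ffunE.
Qed.

Lemma rep_scale1 k v x : (k *: v).1 x = k * v.1 x. Proof. by rewrite ffunE. Qed.
Lemma rep_scale2 k v y : (k *: v).2 y = k * v.2 y. Proof. by rewrite ffunE. Qed.

Lemma diag_ketl tX tY x : diag_op tX tY (ketl x) = tX x *: ketl x.
Proof.
apply: rep_ext => z; rewrite ?diag_op1 ?diag_op2 ?rep_scale1 ?rep_scale2 ?ketl1 ?ketl2.
  by case: eqP => [->|]; rewrite ?mulr0.
by rewrite !mulr0.
Qed.

Lemma diag_ketr tX tY y : diag_op tX tY (ketr y) = tY y *: ketr y.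
Proof.
apply: rep_ext => z; rewrite ?diag_op1 ?diag_op2 ?rep_scale1 ?rep_scale2 ?ketr1 ?ketr2.
  by rewrite !mulr0.
by case: eqP => [->|]; rewrite ?mulr0.
Qed.

Lemma sum_delta (I : finType) (F : I -> C) i : \sum_j F j * (j == i)%:R = F i.
Proof.
rewrite (bigD1 i) //= eqxx mulr1 big1 ?addr0 // => j /negPf ->.
by rewrite mulr0.
Qed.

Lemma fourier_ketl c chi x :
  fourier_op c chi (ketl x) = c *: \sum_y chi y x *: ketr y.
Proof.
apply: rep_ext => z; rewrite ?fourier_op1 ?fourier_op2 ?rep_scale1 ?rep_scale2
  ?rep_sum1 ?rep_sum2; congr (_ * _).
  rewrite [RHS]big1 ?big1 // => y _; first by rewrite ketl2 mulr0.
  by rewrite rep_scale1 ketr1 mulr0.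
transitivity (chi z x).
  by rewrite -(sum_delta (chi z) x); apply: eq_bigr => i _; rewrite ketl1.
rewrite -(sum_delta (fun y => chi y x) z); apply: eq_bigr => y _.
by rewrite rep_scale2 ketr2 eq_sym.
Qed.

Lemma fourier_ketr c chi y :
  fourier_op c chi (ketr y) = c *: \sum_x chi y x *: ketl x.
Proof.
apply: rep_ext => z; rewrite ?fourier_op1 ?fourier_op2 ?rep_scale1 ?rep_scale2
  ?rep_sum1 ?rep_sum2; congr (_ * _); last first.
  rewrite [RHS]big1 ?big1 // => x _; first by rewrite ketr1 mulr0.
  by rewrite rep_scale2 ketl2 mulr0.
transitivity (chi y z).
  by rewrite -(sum_delta (chi^~ z) y); apply: eq_bigr => i _; rewrite ketr2.
rewrite -(sum_delta (chi y) z); apply: eq_bigr => x _.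
by rewrite rep_scale1 ketl1 eq_sym.
Qed.

Definition isometric (f : 'End(W)) : Prop := forall v w, hdot (f v) (f w) = hdot v w.

Lemma diag_isometric tX tY : (forall x, (tX x)^* * tX x = 1) ->
  (forall y, (tY y)^* * tY y = 1) -> isometric (diag_op tX tY).
Proof.
move=> hX hY v w; rewrite /hdot; congr (_ + _); apply: eq_bigr => z _.
  by rewrite !diag_op1 rmorphM /= mulrACA hX mul1r.
by rewrite !diag_op2 rmorphM /= mulrACA hY mul1r.
Qed.

(** A real symmetric kernel gives a self-adjoint operator, which is isometric as
    soon as it is an involution. *)
Lemma fourier_isometric c chi : c^* = c -> (forall y x, (chi y x)^* = chi y x) ->
  (forall v, fourier_op c chi (fourier_op c chi v) = v) -> isometric (fourier_op c chi).
Proof.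
move=> hc hchi inv v w.
have adj u z : hdot (fourier_op c chi u) z = hdot u (fourier_op c chi z).
  rewrite /hdot addrC; congr (_ + _).
    transitivity (\sum_y \sum_x c * chi y x * (u.1 x)^* * z.2 y).
      apply: eq_bigr => y _; rewrite fourier_op2 rmorphM /= hc rmorph_sum mulr_sumr mulr_suml.
      by apply: eq_bigr => x _; rewrite rmorphM /= hchi; ring.
    rewrite exchange_big /=; apply: eq_bigr => x _.
    by rewrite fourier_op1 mulrCA mulr_sumr mulr_sumr; apply: eq_bigr => y _; ring.
  transitivity (\sum_x \sum_y c * chi y x * (u.2 y)^* * z.1 x).
    apply: eq_bigr => x _; rewrite fourier_op1 rmorphM /= hc rmorph_sum mulr_sumr mulr_suml.
    by apply: eq_bigr => y _; rewrite rmorphM /= hchi; ring.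
  rewrite exchange_big /=; apply: eq_bigr => y _.
  by rewrite fourier_op2 mulrCA mulr_sumr mulr_sumr; apply: eq_bigr => x _; ring.
by rewrite adj inv.
Qed.

End Operators.

(** * The relations, for centers of order one and two *)

Lemma card_singleton (T : finType) (x0 : T) : (forall x, x = x0) -> #|T| = 1%N.
Proof.
by move=> h; rewrite -(card1 x0); apply: eq_card => x; rewrite (h x) !inE eqxx.
Qed.

Lemma card_pair (T : finType) (x0 x1 : T) : x1 != x0 ->
  (forall x, x = x0 \/ x = x1) -> #|T| = 2%N.
Proof.
move=> x10 h; transitivity #|pred2 x0 x1|; last by rewrite card2 eq_sym x10.
by apply: eq_card => x; case: (h x) => ->; rewrite !inE eqxx ?orbT.
Qed.

Section Relations.
Context {R : realType} {X Y : finType}.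
Local Notation C := R[i].
Local Notation W := (@rep_space R X Y).
Context (kX : X -> bool) (kY : Y -> bool) (a b p q : C).

Definition eigenX x : C := a * (if kX x then p else 1).
Definition eigenY y : C := b * (if kY y then q else 1).
Definition sign_chi y x : C := if kX x && kY y then -1 else 1.
Let c : C := inv_sqrt #|X|.

Definition opS : 'End(W) := fourier_op c sign_chi.
Definition opT : 'End(W) := diag_op eigenX eigenY.
Definition opST : 'End(W) := (opS \o opT)%VF.

Lemma opST1 (v : W) x : (opST v).1 x = c * \sum_y sign_chi y x * (eigenY y * v.2 y).
Proof.
rewrite comp_lfunE fourier_op1; congr (_ * _); apply: eq_bigr => y _.
by rewrite diag_op2.
Qed.

Lemma opST2 (v : W) y : (opST v).2 y = c * \sum_x sign_chi y x * (eigenX x * v.1 x).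
Proof.
rewrite comp_lfunE fourier_op2; congr (_ * _); apply: eq_bigr => x _.
by rewrite diag_op1.
Qed.

Section Trivial.
Context (x0 : X) (y0 : Y).
Hypotheses (X1 : forall x, x = x0) (Y1 : forall y, y = y0).
Hypotheses (kX0 : kX x0 = false) (kY0 : kY y0 = false).

Let sumX (F : X -> C) : \sum_x F x = F x0.
Proof. by rewrite (big_pred1 x0) // => x; rewrite (X1 x) /= eqxx. Qed.

Let sumY (F : Y -> C) : \sum_y F y = F y0.
Proof. by rewrite (big_pred1 y0) // => y; rewrite (Y1 y) /= eqxx. Qed.

Let c1 : c = 1.
Proof. by rewrite /c /inv_sqrt (card_singleton X1) sqrtr1 invr1. Qed.

Lemma opS_involutive1 (v : W) : opS (opS v) = v.
Proof.
apply: rep_ext => z; rewrite ?(X1 z) ?(Y1 z).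
  by rewrite fourier_op1 sumY fourier_op2 sumX /sign_chi kX0 c1 !mul1r.
by rewrite fourier_op2 sumX fourier_op1 sumY /sign_chi kX0 c1 !mul1r.
Qed.

Lemma opST_sqr1 (v : W) : opST (opST v) = (a * b) *: v.
Proof.
apply: rep_ext => z; rewrite ?(X1 z) ?(Y1 z) ?rep_scale1 ?rep_scale2.
  rewrite opST1 sumY opST2 sumX /sign_chi /eigenX /eigenY kX0 kY0 c1 /=; ring.
rewrite opST2 sumX opST1 sumY /sign_chi /eigenX /eigenY kX0 kY0 c1 /=; ring.
Qed.

End Trivial.

Section OrderTwo.
Context (x0 x1 : X) (y0 y1 : Y).
Hypotheses (X2 : forall x, x = x0 \/ x = x1) (Y2 : forall y, y = y0 \/ y = y1).
Hypotheses (kX0 : kX x0 = false) (kX1 : kX x1) (kY0 : kY y0 = false) (kY1 : kY y1).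

Let x10 : x1 != x0. Proof. by apply: contraTneq kX1 => ->; rewrite kX0. Qed.
Let y10 : y1 != y0. Proof. by apply: contraTneq kY1 => ->; rewrite kY0. Qed.

Let sumX (F : X -> C) : \sum_x F x = F x0 + F x1.
Proof.
rewrite (bigD1 x0) //= (big_pred1 x1) // => x.
by case: (X2 x) => ->; rewrite /= ?eqxx ?x10 // eq_sym (negPf x10).
Qed.

Let sumY (F : Y -> C) : \sum_y F y = F y0 + F y1.
Proof.
rewrite (bigD1 y0) //= (big_pred1 y1) // => y.
by case: (Y2 y) => ->; rewrite /= ?eqxx ?y10 // eq_sym (negPf y10).
Qed.

Let cc : 2 * (c * c) = 1.
Proof.
rewrite /c /inv_sqrt (card_pair x10 X2) -rmorphM /= -expr2 exprVn sqr_sqrtr ?ler0n //.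
by rewrite -[2](rmorph_nat (real_complex R)) -rmorphM divff ?pnatr_eq0.
Qed.

Let chi : (sign_chi y0 x0 = 1) * (sign_chi y0 x1 = 1) * (sign_chi y1 x0 = 1) *
  (sign_chi y1 x1 = -1).
Proof. by rewrite /sign_chi kX0 kX1 kY0 kY1. Qed.

Let eig : (eigenX x0 = a) * (eigenX x1 = a * p) * (eigenY y0 = b) * (eigenY y1 = b * q).
Proof. by rewrite /eigenX /eigenY kX0 kX1 kY0 kY1 !mulr1. Qed.

Lemma opS_involutive2 (v : W) : opS (opS v) = v.
Proof.
apply: rep_ext => z.
  rewrite fourier_op1 sumY !fourier_op2 !sumX.
  transitivity (2 * (c * c) * v.1 z); last by rewrite cc mul1r.
  by case: (X2 z) => ->; rewrite !chi; ring.
rewrite fourier_op2 sumX !fourier_op1 !sumY.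
transitivity (2 * (c * c) * v.2 z); last by rewrite cc mul1r.
by case: (Y2 z) => ->; rewrite !chi; ring.
Qed.

(** On each of the two summands [(S T)^2] is a two by two matrix whose square is the
    scalar [(a b)^2 q] if [p = -1], and [(a b)^2 p] if [q = -1]. *)
Lemma opST_pow4 (v : W) : (p = -1 /\ (a * b) ^+ 2 * q = 1) \/
  (q = -1 /\ (a * b) ^+ 2 * p = 1) -> opST (opST (opST (opST v))) = v.
Proof.
move=> pq.
have sq1 (w : W) x : (opST (opST w)).1 x = c * c * (a * b) *
    ((sign_chi y0 x + sign_chi y1 x * q) * w.1 x0 +
     (sign_chi y0 x - sign_chi y1 x * q) * p * w.1 x1).
  by rewrite opST1 sumY !opST2 !sumX !chi !eig; ring.
have sq2 (w : W) y : (opST (opST w)).2 y = c * c * (a * b) *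
    ((sign_chi y x0 + sign_chi y x1 * p) * w.2 y0 +
     (sign_chi y x0 - sign_chi y x1 * p) * q * w.2 y1).
  by rewrite opST2 sumX !opST1 !sumY !chi !eig; ring.
case: pq => -[h E]; apply: rep_ext => z.
- transitivity ((2 * (c * c)) ^+ 2 * ((a * b) ^+ 2 * q) * v.1 z); last first.
    by rewrite E cc expr1n !mul1r.
  by rewrite !sq1 h; case: (X2 z) => ->; rewrite !chi; ring.
- transitivity ((2 * (c * c)) ^+ 2 * ((a * b) ^+ 2 * q) * v.2 z); last first.
    by rewrite E cc expr1n !mul1r.
  by rewrite !sq2 h; case: (Y2 z) => ->; rewrite !chi; ring.
- transitivity ((2 * (c * c)) ^+ 2 * ((a * b) ^+ 2 * p) * v.1 z); last first.
    by rewrite E cc expr1n !mul1r.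
  by rewrite !sq1 h; case: (X2 z) => ->; rewrite !chi; ring.
- transitivity ((2 * (c * c)) ^+ 2 * ((a * b) ^+ 2 * p) * v.2 z); last first.
    by rewrite E cc expr1n !mul1r.
  by rewrite !sq2 h; case: (Y2 z) => ->; rewrite !chi; ring.
Qed.

End OrderTwo.
End Relations.

(** * The classes of the center *)

Section CenterClasses.
Context {R : realType} {V : vectType R} (B : {dot V for @idfun R}).
Implicit Types (D : {fset V}) (u v : V).

Lemma coset_eq D u v : coroot_lattice B D (u - v) ->
  coset (coroot_lattice B D) u = coset (coroot_lattice B D) v.
Proof.
move=> h; apply/seteqP; split=> w; rewrite /coset /= => hw.
  by rewrite -[w](subrK u) -addrA; exact: zspan_add.
by rewrite -[w](subrK v) -addrA; apply: zspan_add => //; rewrite -opprB; exact: zspan_opp.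
Qed.

Lemma coset_self D u : coset (coroot_lattice B D) u u.
Proof. by rewrite /coset /= subrr; exact: zspan0. Qed.

Section OneSide.
Context (D : {fset V}) (k : V -> bool).
Hypothesis rsD : root_system B D.
Hypothesis kP : forall u v, coweight_lattice B D u -> coweight_lattice B D v ->
  coroot_lattice B D (u - v) <-> k u = k v.
Local Notation Q := (coset (coroot_lattice B D)).

(** At most two cosets, one for each value of [k]. *)
Lemma finite_cosets : finite_set [set Q u | u in coweight_lattice B D]%classic.
Proof.
have repP b : {A | forall u, coweight_lattice B D u -> k u = b -> Q u = A}.
  apply: cid; have [[u [Wu ku]]|no] := pselect (exists u, coweight_lattice B D u /\ k u = b).
    by exists (Q u) => v Wv kv; apply: coset_eq; apply/kP; rewrite // ku.
  by exists set0 => u Wu ku; case: no; exists u.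
apply: (@sub_finite_set _ _ [set sval (repP true); sval (repP false)]%classic).
  move=> _ [u Wu <-]; case Eu : (k u); [left|right].
    exact: (svalP (repP true)).
  exact: (svalP (repP false)).
exact: finite_set2.
Qed.

Lemma center_rep (x : center B D) :
  exists2 u, coweight_lattice B D u & fsval x = Q u.
Proof.
have := fsvalP x; rewrite in_fset_set; last exact: finite_cosets.
by rewrite inE => -[u Wu <-]; exists u.
Qed.

Lemma center_of u : coweight_lattice B D u -> exists x : center B D, fsval x = Q u.
Proof.
move=> Wu; have h : Q u \in center B D.
  by rewrite in_fset_set ?inE; [exists u|exact: finite_cosets].
by exists [` h]%fset.
Qed.

Lemma center_classes : exists cls : center B D -> bool,
  [/\ forall x u, represents x u -> coweight_lattice B D u /\ k u = cls x,
      injective cls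
    & forall u, coweight_lattice B D u ->
        exists x, fsval x = Q u /\ cls x = k u].
Proof.
have [r rP] : exists r : center B D -> V,
    forall x, coweight_lattice B D (r x) /\ fsval x = Q (r x).
  have h (x : center B D) : exists u, coweight_lattice B D u /\ fsval x = Q u.
    by have [u Wu E] := center_rep x; exists u.
  by have [r rP] := choice h; exists r.
have clsP x u : represents x u -> coweight_lattice B D u /\ k u = k (r x).
  have [Wr E] := rP x; rewrite /represents E /coset /= => h.
  have Wu : coweight_lattice B D u.
    rewrite -[u](subrK (r x)); apply: coweight_add => //.
    exact: coroot_lattice_coweight.
  by split=> //; apply/kP.
exists (k \o r); split=> //.
  move=> x y /= E; apply: val_inj; rewrite /= (rP x).2 (rP y).2.
  have [Wx _] := rP x; have [Wy _] := rP y.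
  by apply: coset_eq; apply/kP.
move=> u Wu; have [x Ex] := center_of Wu; exists x; split=> //=.
have xu : represents x u by rewrite /represents Ex; exact: coset_self.
by have [_ ->] := clsP x u xu.
Qed.

Lemma pi1P (L : set V) (x : center B D) :
  reflect (exists2 u, L u & fsval x = Q u) (x \in pi1 B D L).
Proof. by rewrite inE; exact: asboolP. Qed.

End OneSide.

(** [pi_1(G)] and [pi_1(^L G)] are annihilators of each other under a perfect pairing
    of groups of order at most two, so one of them is trivial and the other one is
    the full center. *)
Lemma pi1_dual n D ell k1 k2 p q (c1 : center B D -> bool)
    (c2 : center B (langlands_roots B n D) -> bool) :
  let LD := langlands_roots B n D in
  (0 < n)%N -> root_system B D -> cocharacter_lattice B D ell ->
  center_data B n D LD k1 k2 p q -> k1 0 = false -> k2 0 = false ->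
  (forall x u, represents x u -> coweight_lattice B D u /\ k1 u = c1 x) ->
  injective c1 ->
  (forall u, coweight_lattice B D u ->
    exists x, fsval x = coset (coroot_lattice B D) u /\ c1 x = k1 u) ->
  (forall x u, represents x u -> coweight_lattice B LD u /\ k2 u = c2 x) ->
  injective c2 ->
  (forall u, coweight_lattice B LD u ->
    exists x, fsval x = coset (coroot_lattice B LD) u /\ c2 x = k2 u) ->
  (pi1 B D ell = [set x | ~~ c1 x]%SET /\
   pi1 B LD (langlands_lattice B n ell) = [set: center B LD]%SET) \/
  (pi1 B D ell = [set: center B D]%SET /\
   pi1 B LD (langlands_lattice B n ell) = [set y | ~~ c2 y]%SET).
Proof.
move=> LD n0 rsD [[ell0 ellB] Qell ellW] data k10 k20 h1 inj1 sur1 h2 inj2 sur2.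
have [d1 d2 _ _ d5] := data.
have rsLD := langlands_root_system n0 rsD.
have W10 : coweight_lattice B D 0 by exact: ellW.
have W20 : coweight_lattice B LD 0 := coroot_lattice_coweight rsLD (zspan0 _).
have s0 : Num.sqrt n%:R != 0 :> R by rewrite gt_eqF // sqrtr_gt0 ltr0n.
have Lell0 : langlands_lattice B n ell 0.
  by exists 0; rewrite ?scaler0 // => w _; rewrite dot0l int_num0.
have LellW mu : langlands_lattice B n ell mu -> coweight_lattice B LD mu.
  move=> [v dv <-]; apply: (langlands_coweightP B D n0 v).2 => a aD; apply: dv.
  by apply: Qell; exact: coroot_lattice_gen.
have zero1 x : c1 x = false -> fsval x = coset (coroot_lattice B D) 0.
  move=> cx; have [x' [<- cx']] := sur1 _ W10.
  by congr fsval; apply: inj1; rewrite cx cx' k10.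
have zero2 y : c2 y = false -> fsval y = coset (coroot_lattice B LD) 0.
  move=> cy; have [y' [<- cy']] := sur2 _ W20.
  by congr fsval; apply: inj2; rewrite cy cy' k20.
have rep1 x u : fsval x = coset (coroot_lattice B D) u -> k1 u = c1 x.
  move=> E; have xu : represents x u by rewrite /represents E; exact: coset_self.
  by have [_ ->] := h1 x u xu.
have rep2 x u : fsval x = coset (coroot_lattice B LD) u -> k2 u = c2 x.
  move=> E; have xu : represents x u by rewrite /represents E; exact: coset_self.
  by have [_ ->] := h2 x u xu.
have [[u1 [eu1 ku1]]|no] := pselect (exists u, ell u /\ k1 u).
  right; split; apply/setP => x; rewrite [RHS]inE.
    apply/pi1P; case Ecx : (c1 x); last by exists 0; rewrite ?zero1.
    have [x' [Ex' cx']] := sur1 u1 (ellW _ eu1).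
    by exists u1; rewrite // -Ex'; congr fsval; apply: inj1; rewrite Ecx cx' ku1.
  apply/pi1P/idP => [[mu Lmu Ex]|/negbTE cx]; last by exists 0; rewrite ?zero2.
  rewrite -(rep2 _ _ Ex); have := d5 _ _ (ellW _ eu1) (LellW _ Lmu).
  have [v dv Emu] := Lmu; rewrite -Emu phase_S_scaled // expi_2pi_int; last first.
    by apply: int_opp; exact: dv.
  rewrite ku1 Emu; case: (k2 mu) => //= /eqP.
  by rewrite -addr_eq0 -mulr2n pnatr_eq0.
left; split; apply/setP => x; rewrite [RHS]inE.
  apply/pi1P/idP => [[u eu Ex]|/negbTE cx]; last by exists 0; rewrite ?zero1.
  by rewrite -(rep1 _ _ Ex); apply/negP => ku; apply: no; exists u.
apply/pi1P; have [mu Wmu Ex] := center_rep d2 x; exists mu => //.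
have [w Ew] := langlands_coweight_exists n0 mu; exists w; last by [].
move: Wmu; rewrite Ew => /(langlands_coweightP B D n0 w) hw u eu.
have : coroot_lattice B D u.
  rewrite -[u]subr0; apply/d1; [exact: ellW|exact: W10|rewrite k10].
  by apply/negbTE/negP => ku; apply: no; exists u.
apply: (coroot_lattice_ind (P := fun u => B w u \is a Num.int)) => //.
  by rewrite dot0r int_num0.
by move=> u' v' hu hv; rewrite dotDr dotNr int_sub.
Qed.

End CenterClasses.

(** * The representation *)

Section Representation.
Context {R : realType} {X Y : finType}.
Local Notation C := R[i].
Local Notation W := (@rep_space R X Y).
Context (n : nat) (kX : X -> bool) (kY : Y -> bool) (a b p q : C).
Hypothesis n23 : n = 2%N \/ n = 3%N.
Hypotheses (ua : a^* * a = 1) (ub : b^* * b = 1) (up : p^* * p = 1) (uq : q^* * q = 1).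
Local Notation S := (opS kX kY : 'End(W)).
Local Notation T := (opT kX kY a b p q : 'End(W)).
Local Notation ST := (opST kX kY a b p q : 'End(W)).
Hypothesis SS : forall v, S (S v) = v.
Hypothesis STm : forall v, iter (half_order n) ST v = v.

Let unit_eigen (z w : C) (k : bool) : z^* * z = 1 -> w^* * w = 1 ->
  (z * (if k then w else 1))^* * (z * (if k then w else 1)) = 1.
Proof.
by move=> hz hw; rewrite rmorphM /= mulrACA hz mul1r; case: k; rewrite ?rmorph1 ?mulr1.
Qed.

Let eigenX_unit x : (eigenX kX a p x)^* * eigenX kX a p x = 1.
Proof. exact: unit_eigen. Qed.

Let eigenY_unit y : (eigenY kY b q y)^* * eigenY kY b q y = 1.
Proof. exact: unit_eigen. Qed.

Let Tinv : 'End(W) :=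
  diag_op (fun x => (eigenX kX a p x)^*) (fun y => (eigenY kY b q y)^*).

Let TinvT : (Tinv \o T)%VF = \1%VF.
Proof.
apply/lfunP => v; rewrite comp_lfunE id_lfunE; apply: rep_ext => z.
  by rewrite !diag_op1 mulrA eigenX_unit mul1r.
by rewrite !diag_op2 mulrA eigenY_unit mul1r.
Qed.

Let TTinv : (T \o Tinv)%VF = \1%VF.
Proof.
apply/lfunP => v; rewrite comp_lfunE id_lfunE; apply: rep_ext => z.
  by rewrite !diag_op1 mulrA [_ * _^*]mulrC eigenX_unit mul1r.
by rewrite !diag_op2 mulrA [_ * _^*]mulrC eigenY_unit mul1r.
Qed.

Lemma representation_exists : exists rho : 'M[R]_2 -> 'End(W),
  [/\ unitary_representation (Gamma_star R n) rho,
      rho (Smx R n) = S & rho (Tmx R) = T].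
Proof.
have S2 : (S \o S)%VF = \1%VF.
  by apply/lfunP => v; rewrite comp_lfunE id_lfunE.
have order : iter (half_order n) (fun f : 'End(W) => ((S \o T) \o f)%VF) \1%VF = \1%VF.
  apply/lfunP => v; rewrite id_lfunE -[RHS]STm.
  by elim: (half_order n) => [|k IH] /=; rewrite ?id_lfunE // comp_lfunE IH.
pose op (f g : 'End(W)) : 'End(W) := (f \o g)%VF.
have opA : associative op by move=> f g h; exact: comp_lfunA.
have op1 : left_id (\1%VF : 'End(W)) op by move=> f; exact: comp_lfun1l.
have opr1 : right_id (\1%VF : 'End(W)) op by move=> f; exact: comp_lfun1r.
have [rho [r1 rS rT rM rK]] :=
  lifting_exists (R := R) n23 opA op1 opr1 S2 TTinv TinvT order.
exists rho; split=> //; split=> // g v w hg; move: v w.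
apply: (rK (fun f => isometric f) _ _ _ _ _ g hg) => //.
- by move=> v w; rewrite !id_lfunE.
- apply: fourier_isometric SS.
    by apply/eqP; rewrite eq_complex /= oppr0 !eqxx.
  by move=> y x; rewrite /sign_chi; case: ifP => _; rewrite ?rmorphN rmorph1.
- exact: diag_isometric.
- by apply: diag_isometric => z; rewrite conjCK mulrC.
- by move=> f h hf hh v w; rewrite !comp_lfunE hf hh.
Qed.

End Representation.

Section BasisStates.
Context {R : realType} {X Y : finType} (kX : X -> bool) (kY : Y -> bool).
Context (x0 : X) (y0 : Y).
Hypotheses (HX : forall x, kX x = (x != x0)) (HY : forall y, kY y = (y != y0)).
Hypothesis cardXY : #|X| = #|Y|.
Local Notation W := (@rep_space R X Y).
Local Notation S := (opS kX kY : 'End(W)).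

Let inv_sqrt1 : inv_sqrt 1 = 1 :> R[i].
Proof. by rewrite /inv_sqrt sqrtr1 invr1. Qed.

Lemma opS_suml : S (normalized_suml [set x | ~~ kX x]%SET) =
  normalized_sumr [set: Y]%SET.
Proof.
have -> : [set x | ~~ kX x]%SET = [set x0]%SET.
  by apply/setP => x; rewrite !inE HX negbK.
rewrite /normalized_suml /normalized_sumr cards1 inv_sqrt1 scale1r big_set1 cardsT.
rewrite fourier_ketl cardXY; congr (_ *: _); apply: eq_big => [y|y _].
  by rewrite inE.
by rewrite /sign_chi HX eqxx scale1r.
Qed.

Lemma opS_sumr : S (normalized_sumr [set y | ~~ kY y]%SET) =
  normalized_suml [set: X]%SET.
Proof.
have -> : [set y | ~~ kY y]%SET = [set y0]%SET.
  by apply/setP => y; rewrite !inE HY negbK.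
rewrite /normalized_suml /normalized_sumr cards1 inv_sqrt1 scale1r big_set1 cardsT.
rewrite fourier_ketr; congr (_ *: _); apply: eq_big => [x|x _].
  by rewrite inE.
by rewrite /sign_chi HY eqxx andbF scale1r.
Qed.

End BasisStates.

(** Everything about the pair [D], [^L D] that the operators see: trivial centers
    (types G2 and F4), or centers of order two (types B and C). *)
Lemma center_data_exists (R : realType) (V : vectType R) (B : {dot V for @idfun R})
    (D : {fset V}) (n : nat) :
  let LD := langlands_roots B n D in
  n = 2%N \/ n = 3%N -> two_lengths B n D ->
  (center_data B n D LD (fun=> false) (fun=> false) 1 1 /\
    (n = 2%N /\ rank V = 4%N \/ n = 3%N /\ rank V = 2%N)) \/
  exists k1 k2 p q, let z := expi (pi * ((rank V)%:R / 2)) in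
   [/\ n = 2%N, center_data B n D LD k1 k2 p q, p = -1 /\ q = z \/ p = z /\ q = -1,
      exists2 u, coweight_lattice B D u & k1 u
    & exists2 u, coweight_lattice B LD u & k2 u].
Proof.
move=> LD [] En tlD; rewrite /LD {LD}; subst n; last first.
  by left; have [h r] := center_data_G tlD; split=> //; right.
have [rsD _ _ _ _] := tlD.
have [[E coE]|[E coE]] := coordinates_or_dual tlD.
  have [[h r]|[k1 [k2 [h h1 h2]]]] := center_data_coordinates tlD coE.
    by left; split=> //; left.
  by right; exists k1, k2, (-1), (expi (pi * ((rank V)%:R / 2))); split=> //; left.
have tlLD := langlands_two_lengths (isT : (0 < 2)%N) tlD.
have := center_data_coordinates tlLD coE.
rewrite /= langlands_roots_involutive // => -[[/center_data_sym h r]|].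
  by left; split=> //; left.
move=> [k1 [k2 [/center_data_sym h h1 h2]]].
by right; exists k2, k1, (expi (pi * ((rank V)%:R / 2))), (-1); split=> //; right.
Qed.

(** Only the sum of the two dual Coxeter numbers enters, and it is determined by the
    Coxeter number through [dual_coxeter_numbers_sum]. *)
Lemma central_phase (R : realType) (V : vectType R) (B : {dot V for @idfun R})
    (D : {fset V}) (n : nat) (hv Lhv : R) : (0 < n)%N -> two_lengths B n D ->
  dual_coxeter_number B D hv -> dual_coxeter_number B (langlands_roots B n D) Lhv ->
  (0 < rank V)%N ->
  let phase k := expi (- (pi / 12) * (n%:R * (k / coxeter_number D) * (rank V)%:R)) in
  phase Lhv * phase hv = expi (- (pi / 12) * (n.+1%:R * (rank V)%:R)).
Proof.
move=> n0 tlD hD hLD r0 phase; rewrite -expiD; congr expi.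
have E := dual_coxeter_numbers_sum n0 tlD hD hLD.
have rR : (rank V)%:R != 0 :> R by rewrite pnatr_eq0 -lt0n.
have nR : n%:R != 0 :> R by rewrite pnatr_eq0 -lt0n.
have [_ [/fset0Pn[a aD] _] _ _ _] := tlD.
have DR : #|` D|%:R != 0 :> R.
  by rewrite pnatr_eq0 -lt0n cardfs_gt0; apply/fset0Pn; exists a.
rewrite /coxeter_number -mulrDr -[n.+1%:R]natr1; congr (_ * _).
transitivity (n%:R * ((hv + Lhv) * (rank V)%:R) / #|` D|%:R * (rank V)%:R).
  by field; rewrite DR rR.
by rewrite E; field; rewrite nR DR.
Qed.

Theorem theorem4p1 (R : realType) (V : vectType R) (B : {dot V for @idfun R})
    (D : {fset V}) (n : nat) (hv Lhv : R) (ell : set V) :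
  let LD := langlands_roots B n D in
  let Lell := langlands_lattice B n ell in
  let h := coxeter_number D in
  let S := Smx R n in
  let T := Tmx R in
  root_system B D ->
  irreducible B D ->
  non_simply_laced B D ->
  normalized B D ->
  n = 2%N \/ n = 3%N ->
  length_ratio B D n ->
  dual_coxeter_number B D hv ->
  dual_coxeter_number B LD Lhv ->
  cocharacter_lattice B D ell ->
  [/\ group_isomorphism (Hecke (Num.sqrt n%:R)) (Gamma_star R n) (hecke_conj n),
      hecke_conj n (mat2 0 (- 1) 1 0) = S,
      hecke_conj n (mat2 1 (Num.sqrt n%:R) 0 1) = T
    & exists rho : 'M[R]_2 -> 'End(rep_space (center B D) (center B LD)),
      [/\ unitary_representation (Gamma_star R n) rho,
          (forall x u, represents x u ->
             rho T (ketl x) = phase_T B n h Lhv u *: ketl x)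
          /\
          (forall y mu, represents y mu ->
             rho T (ketr y) = phase_T B n h hv mu *: ketr y),
          (forall x u (s : center B LD -> V),
             represents x u -> (forall y, represents y (s y)) ->
             rho S (ketl x) =
               inv_sqrt #|{: center B D}| *:
               \sum_(y : center B LD) phase_S B n (s y) u *: ketr y)
          /\
          (forall y mu (s : center B D -> V),
             represents y mu -> (forall x, represents x (s x)) ->
             rho S (ketr y) =
               inv_sqrt #|{: center B D}| *:
               \sum_(x : center B D) phase_S B n mu (s x) *: ketl x),
          rho S (normalized_suml (pi1 B D ell)) =
            normalized_sumr (pi1 B LD Lell)
        & rho S (normalized_sumr (pi1 B LD Lell)) =
            normalized_suml (pi1 B D ell)]].
Proof.
move=> LD Lell h S T rsD irrD nsl nD n23 lrD hD hLD coch.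
have n0 : (0 < n)%N by case: n23 => ->.
have tlD := two_lengths_intro rsD irrD nD n23 lrD.
have r0 : (0 < rank V)%N.
  rewrite lt0n; apply: contraTneq isT => r0; have [_ _ _ [a aD _] _] := tlD.
  have : a \in (fullv : {vspace V}) by exact: memvf.
  have /eqP := r0; rewrite /rank dimv_eq0 => /eqP ->.
  by rewrite memv0 (negPf (root_neq0 rsD aD)).
split; [exact: hecke_isomorphism|exact: hecke_conj_S|exact: hecke_conj_T|].
have rsLD := langlands_root_system n0 rsD.
pose a := expi (- (pi / 12) * (n%:R * (Lhv / h) * (rank V)%:R)).
pose b := expi (- (pi / 12) * (n%:R * (hv / h) * (rank V)%:R)).
have ab : a * b = _ := central_phase n0 tlD hD hLD r0.
(* Here [c1] and [c2] identify the two centers with subgroups of [bool]. *)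
suff [k1 [k2 [p [q [data [up uq] [k10 k20] final]]]]] :
  exists k1 k2 p q, [/\ center_data B n D LD k1 k2 p q,
    p^* * p = 1 /\ q^* * q = 1, k1 0 = false /\ k2 0 = false &
    forall (c1 : center B D -> bool) (c2 : center B LD -> bool),
    injective c1 -> injective c2 ->
    (forall u, coweight_lattice B D u -> exists x, c1 x = k1 u) ->
    (forall u, coweight_lattice B LD u -> exists x, c2 x = k2 u) ->
    (forall x, exists2 u, coweight_lattice B D u & c1 x = k1 u) ->
    (forall x, exists2 u, coweight_lattice B LD u & c2 x = k2 u) ->
    [/\ #|{: center B D}| = #|{: center B LD}|,
        forall v : @rep_space R _ _, opS c1 c2 (opS c1 c2 v) = v
      & forall v, iter (half_order n) (opST c1 c2 a b p q) v = v]].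
  have [d1 d2 d3 d4 d5] := data.
  have [c1 [rep1 inj1 sur1]] := center_classes rsD d1.
  have [c2 [rep2 inj2 sur2]] := center_classes rsLD d2.
  have W10 := coroot_lattice_coweight rsD (zspan0 _).
  have W20 := coroot_lattice_coweight rsLD (zspan0 _).
  have [x0 [_ cx0]] := sur1 0 W10; rewrite k10 in cx0.
  have [y0 [_ cy0]] := sur2 0 W20; rewrite k20 in cy0.
  have HX x : c1 x = (x != x0).
    have [->|nx] := eqVneq x x0; first exact: cx0.
    by apply: contra_neqT nx => /negbTE cx; apply: inj1; rewrite cx cx0.
  have HY y : c2 y = (y != y0).
    have [->|ny] := eqVneq y y0; first exact: cy0.
    by apply: contra_neqT ny => /negbTE cy; apply: inj2; rewrite cy cy0.
  have [||||cardXY SS STm] := final c1 c2 inj1 inj2.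
  - by move=> u /sur1[x [_ E]]; exists x.
  - by move=> u /sur2[x [_ E]]; exists x.
  - move=> x; have [u Wu E] := center_rep d1 x; exists u => //.
    have xu : represents x u by rewrite /represents E; exact: coset_self.
    by have [_ ->] := rep1 x u xu.
  - move=> x; have [u Wu E] := center_rep d2 x; exists u => //.
    have xu : represents x u by rewrite /represents E; exact: coset_self.
    by have [_ ->] := rep2 x u xu.
  have [rho [urho rS rT]] := representation_exists n23 (conj_expi _) (conj_expi _)
    up uq SS STm.
  exists rho; split=> //; rewrite ?/S ?/T ?rS ?rT.
  - split=> [x u xu|y mu ymu].
      have [Wu ku] := rep1 x u xu.
      by rewrite diag_ketl /eigenX -ku -d3 // /phase_T expiD.
    have [Wmu kmu] := rep2 y mu ymu.
    by rewrite diag_ketr /eigenY -kmu -d4 // /phase_T expiD.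
  - split=> [x u s xu ys|y mu s ymu xs].
      have [Wu ku] := rep1 x u xu; rewrite fourier_ketl; congr (_ *: _).
      apply: eq_bigr => y _; have [Wy ky] := rep2 _ _ (ys y).
      by rewrite d5 // ku ky.
    have [Wmu kmu] := rep2 y mu ymu; rewrite fourier_ketr; congr (_ *: _).
    apply: eq_bigr => x _; have [Wx kx] := rep1 _ _ (xs x).
    by rewrite d5 // kx kmu.
  - have [[-> ->]|[-> ->]] := pi1_dual n0 rsD coch data k10 k20 rep1 inj1 sur1 rep2 inj2 sur2.
      exact: (opS_suml c2 HX cardXY).
    by rewrite -(opS_sumr c1 HY) SS.
  - have [[-> ->]|[-> ->]] := pi1_dual n0 rsD coch data k10 k20 rep1 inj1 sur1 rep2 inj2 sur2.
      by rewrite -(opS_suml c2 HX cardXY) SS.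
    exact: (opS_sumr c1 HY).
have [[data nr]|[k1 [k2 [p [q [n2 data pq [u1 Wu1 ku1] [u2 Wu2 ku2]]]]]]] :=
  center_data_exists n23 tlD.
  exists (fun=> false), (fun=> false), 1, 1; split=> //.
    by rewrite rmorph1 mulr1.
  move=> c1 c2 inj1 inj2 sur1 sur2 val1 val2.
  have [x0 cx0] := sur1 0 (coroot_lattice_coweight rsD (zspan0 _)).
  have [y0 cy0] := sur2 0 (coroot_lattice_coweight rsLD (zspan0 _)).
  have X1 x : x = x0 by apply: inj1; have [? _ ->] := val1 x.
  have Y1 y : y = y0 by apply: inj2; have [? _ ->] := val2 y.
  split.
  - by rewrite (card_singleton X1) (card_singleton Y1).
  - exact: opS_involutive1 X1 Y1 cx0.
  - move=> v; have sq := opST_sqr1 a b 1 1 X1 Y1 cx0 cy0.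
    case: nr => -[En Er]; rewrite /half_order En /= !sq !scalerA ab En Er -!expiD.
      rewrite (_ : _ + _ = 2 * pi * -1); last by field.
      by rewrite expi_2pi_int ?scale1r // int_opp // int_num1.
    rewrite (_ : _ + _ = 2 * pi * -1); last by field.
    by rewrite expi_2pi_int ?scale1r // int_opp // int_num1.
exists k1, k2, p, q.
have unit_pq : p^* * p = 1 /\ q^* * q = 1.
  have m1 : (-1)^* * -1 = 1 :> R[i] by rewrite rmorphN rmorph1 mulrNN mulr1.
  by case: pq => -[-> ->]; split=> //; exact: conj_expi.
have [_ _ _ _ d5] := data.
have W10 := coroot_lattice_coweight rsD (zspan0 _).
have W20 := coroot_lattice_coweight rsLD (zspan0 _).
have one_neqN : (1 : R[i]) = -1 -> False.
  by move/eqP; rewrite -addr_eq0 -mulr2n pnatr_eq0.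
have k10 : k1 0 = false.
  have := d5 _ _ W10 Wu2; rewrite ku2 andbT /phase_S dot0r mul0r mulr0 expi0.
  by case: (k1 0) => // /one_neqN.
have k20 : k2 0 = false.
  have := d5 _ _ Wu1 W20; rewrite ku1 /= /phase_S dot0l mul0r mulr0 expi0.
  by case: (k2 0) => // /one_neqN.
split=> // c1 c2 inj1 inj2 sur1 sur2 val1 val2.
have [x0 cx0] := sur1 0 W10; rewrite k10 in cx0.
have [y0 cy0] := sur2 0 W20; rewrite k20 in cy0.
have [x1 cx1] := sur1 u1 Wu1; rewrite ku1 in cx1.
have [y1 cy1] := sur2 u2 Wu2; rewrite ku2 in cy1.
have X2 x : x = x0 \/ x = x1.
  by case Ex : (c1 x); [right|left]; apply: inj1; rewrite Ex.
have Y2 y : y = y0 \/ y = y1.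
  by case Ey : (c2 y); [right|left]; apply: inj2; rewrite Ey.
have abz : (a * b) ^+ 2 * expi (pi * ((rank V)%:R / 2)) = 1.
  rewrite ab n2 expr2 -!expiD -[RHS](@expi0 R); congr expi; by field.
split.
- rewrite (card_pair (x0 := x0) (x1 := x1)) ?(card_pair (x0 := y0) (x1 := y1)) //.
    by apply: contraTneq cy1 => ->; rewrite cy0.
  by apply: contraTneq cx1 => ->; rewrite cx0.
- exact: opS_involutive2 X2 Y2 cx0 cx1 cy0 cy1.
- move=> v; rewrite /half_order n2 /=.
  apply: (opST_pow4 X2 Y2 cx0 cx1 cy0 cy1).
  by case: pq => -[Ep Eq]; [left|right]; rewrite Ep Eq.
Qed.
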